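(* Let $\Omega\subset\mathbb{R}^n$ be non-empty, open and bounded, and let $m\in\{2,\ldots,n\}$. Let $f:\overline{\Omega}\to\mathbb{R}^n$ be a homeomorphism (onto its image) in $W^{1,p}(\Omega,\mathbb{R}^n)$ such that $f|_{\partial\Omega}=\mathrm{id}|_{\partial\Omega}$. Assume one of the following: (a) $p=m$ and $f$ is Hölder continuous; (b) $p>m$. Then $\operatorname{rank}(Df(x))\ge m$ for all $x$ in a subset of $\Omega$ of positive (Lebesgue) measure.
   Context: $Df$ denotes the weak derivative of the Sobolev map $f$. Hölder continuous means that there are $\alpha\in(0,1]$ and $C>0$ such that $|f(x)-f(y)|\le C|x-y|^\alpha$ for all $x,y$ in $\overline{\Omega}$. *)

(* Defs.v *)
(* MathComp / MathComp-Analysis, over an abstract real field [R : realType]. *)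
From HB Require Import structures.
From mathcomp Require Import all_boot all_order all_algebra.
From mathcomp Require Import all_classical all_reals all_analysis.
Import Order.TTheory GRing.Theory Num.Theory.
Import numFieldNormedType.Exports.

Set Implicit Arguments.
Unset Strict Implicit.
Unset Printing Implicit Defensive.

Local Open Scope classical_set_scope.
Local Open Scope ring_scope.

(* Lebesgue measure on R^n: the n-fold product of the one-dimensional measure
   is built on the Borel sigma-algebra of [n.-tuple R], moved to 'rV[R]_n, and
   completed by the Caratheodory construction.  Hence the measurable sets of
   [lebesgue_space R n] are the Lebesgue measurable subsets of R^n, not only
   the Borel ones. *)
Section product_step.
Context {R : realType} {n : nat}.
Local Notation T := (measurableTypeR R).

Definition tuple_cons (p : T * n.-tuple T) : n.+1.-tuple T :=
  [tuple of p.1 :: p.2].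

Lemma measurable_tuple_cons : measurable_fun [set: T * n.-tuple T] tuple_cons.
Proof.
exact: (measurable_cons (f := fst) (g := snd) measurable_fst measurable_snd).
Qed.

Definition product_step (mu : set (n.-tuple T) -> \bar R) :
    set (n.+1.-tuple T) -> \bar R :=
  pushforward (@lebesgue_measure R \x mu)%E tuple_cons.

Variable mu : {sigma_finite_measure set (n.-tuple T) -> \bar R}.

Let product_step0 : product_step mu set0 = 0%E.
Proof. by rewrite /product_step /pushforward preimage_set0 measure0. Qed.

Let product_step_ge0 A : (0 <= product_step mu A)%E.
Proof. exact: (measure_ge0 (@lebesgue_measure R \x mu)%E). Qed.

Let product_step_sigma_additive : semi_sigma_additive (product_step mu).
Proof.
have mcons A : measurable A -> measurable (tuple_cons @^-1` A).
  by move=> mA; rewrite -[X in measurable X]setTI; exact: measurable_tuple_cons.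
move=> F mF tF mUF; rewrite /product_step /pushforward preimage_bigcup.
apply: measure_semi_sigma_additive.
- by move=> k; exact: mcons.
- apply/trivIsetP => i j _ _ ij; rewrite -preimage_setI.
  by move/trivIsetP : tF => /(_ _ _ _ _ ij) ->//; rewrite preimage_set0.
- by rewrite -preimage_bigcup; exact: mcons.
Qed.

HB.instance Definition _ := isMeasure.Build _ _ _ (product_step mu)
  product_step0 product_step_ge0 product_step_sigma_additive.

Let product_step_sigma_finite : sigma_finite setT (product_step mu).
Proof.
pose nu : {sigma_finite_measure set T -> \bar R} := lebesgue_measure.
have /sigma_finiteP[F [FT ndF Foo]] := sigma_finiteT nu.
have /sigma_finiteP[G [GT ndG Goo]] := sigma_finiteT mu.
pose uncons (t : n.+1.-tuple T) : T * n.-tuple T :=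
  (tnth t ord0, [tuple of behead t]).
have muncons : measurable_fun setT uncons.
  apply/measurable_fun_pairP; split; first exact: measurable_tnth.
  exact: measurable_behead.
have consK : uncons \o tuple_cons = id.
  by apply/funext => -[x t]; congr pair; exact: val_inj.
exists (fun k => uncons @^-1` (F k `*` G k)).
  apply/esym/seteqP; split=> // t _.
  have [i _ Fi] : (\bigcup_k F k) (uncons t).1 by rewrite -FT.
  have [j _ Gj] : (\bigcup_k G k) (uncons t).2 by rewrite -GT.
  exists (maxn i j) => //; split.
    by move: Fi; exact/subsetPset/ndF/leq_maxl.
  by move: Gj; exact/subsetPset/ndG/leq_maxr.
move=> k; have [mF Fkoo] := Foo k; have [mG Gkoo] := Goo k; split.
  by rewrite -[X in measurable X]setTI; apply: muncons => //; exact: measurableX.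
rewrite /product_step /pushforward -comp_preimage consK preimage_id.
by rewrite (product_measure1E nu mu mF mG) lte_mul_pinfty// ge0_fin_numE.
Qed.

HB.instance Definition _ := Measure_isSigmaFinite.Build _ _ _
  (product_step mu) product_step_sigma_finite.

End product_step.

Fixpoint tuple_lebesgue (R : realType) (n : nat) :
    {sigma_finite_measure set (n.-tuple (measurableTypeR R)) -> \bar R} :=
  match n with
  | 0 => \d_([tuple] : 0.-tuple (measurableTypeR R))
  | n'.+1 => product_step (tuple_lebesgue R n')
  end.

Definition row_of_tuple (R : realType) n (t : n.-tuple (measurableTypeR R)) :
  'rV[R]_n := \row_i tnth t i.

Definition lebesgue_outer (R : realType) n (A : set 'rV[R]_n) : \bar R :=
  mu_ext (tuple_lebesgue R n) (@row_of_tuple R n @^-1` A).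

Section lebesgue_outer_instance.
Variables (R : realType) (n : nat).

Let lebesgue_outer0 : @lebesgue_outer R n set0 = 0%E.
Proof. by rewrite /lebesgue_outer preimage_set0 outer_measure0. Qed.

Let lebesgue_outer_ge0 A : (0 <= @lebesgue_outer R n A)%E.
Proof. exact: outer_measure_ge0. Qed.

Let le_lebesgue_outer :
  {homo @lebesgue_outer R n : A B / A `<=` B >-> (A <= B)%E}.
Proof. by move=> A B AB; apply: le_outer_measure => t /AB. Qed.

Let lebesgue_outer_sigma_subadditive :
  sigma_subadditive (@lebesgue_outer R n).
Proof.
move=> A; rewrite /lebesgue_outer preimage_bigcup.
exact: (outer_measure_sigma_subadditive (mu_ext (tuple_lebesgue R n))).
Qed.

HB.instance Definition _ := isOuterMeasure.Build R _ (@lebesgue_outer R n)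
  lebesgue_outer0 lebesgue_outer_ge0 le_lebesgue_outer
  lebesgue_outer_sigma_subadditive.

End lebesgue_outer_instance.

Definition lebesgue_space (R : realType) n :=
  caratheodory_type (@lebesgue_outer R n).

HB.instance Definition _ (R : realType) n :=
  Measurable.on (lebesgue_space R n).

Definition lebesgue_rV (R : realType) n : set (lebesgue_space R n) -> \bar R :=
  @lebesgue_outer R n.

HB.instance Definition _ (R : realType) n :=
  isMeasure.Build _ (lebesgue_space R n) R (@lebesgue_rV R n)
    (@caratheodory_measure0 R _ (@lebesgue_outer R n))
    (@caratheodory_measure_ge0 R _ (@lebesgue_outer R n))
    (@caratheodory_measure_sigma_additive R _ (@lebesgue_outer R n)).

Section sobolev.
Context {R : realType} {n : nat}.
Local Notation V := 'rV[R]_n.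
Implicit Types (Omega : set V) (phi g : V -> R).

Definition partial (j : 'I_n) phi : V -> R := 'D_(delta_mx 0 j) phi.

(* All iterated partial derivatives exist everywhere and are continuous. *)
Definition smooth phi : Prop := forall s : seq 'I_n,
  let psi := foldr partial phi s in
  continuous psi /\ forall j x, derivable psi x (delta_mx 0 j).

Definition test_function Omega phi : Prop :=
  let supp := closure [set x | phi x != 0] in
  [/\ smooth phi, compact supp & supp `<=` Omega].

Definition loc_integrable Omega g : Prop :=
  forall K : set V, compact K -> K `<=` Omega ->
    (@lebesgue_rV R n).-integrable K (EFin \o g).

Definition weak_partial Omega (j : 'I_n) g h : Prop :=
  [/\ loc_integrable Omega g, loc_integrable Omega h &
    forall phi, test_function Omega phi ->
      (\int[@lebesgue_rV R n]_(x in Omega) (g x * partial j phi x)%:E =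
       - \int[@lebesgue_rV R n]_(x in Omega) (h x * phi x)%:E)%E].

(* [g \_ Omega] is the extension of g by zero outside Omega. *)
Definition Lp Omega (p : \bar R) g : Prop :=
  (g \_ Omega : lebesgue_space R n -> R) \in Lfun (@lebesgue_rV R n) p.

(* f is in W^{1,p}(Omega, R^n) and Df is (a representative of) its weak
   derivative, [Df x i j] being the j-th partial derivative of the i-th
   component of f. *)
Definition W1p Omega (p : \bar R) (f : V -> V) (Df : V -> 'M[R]_n) : Prop :=
  [/\ forall i, Lp Omega p (fun x => f x 0 i),
      forall i j, Lp Omega p (fun x => Df x i j) &
      forall i j, weak_partial Omega j (fun x => f x 0 i) (fun x => Df x i j)].

Definition homeo_onto_image (D : set V) (f : V -> V) : Prop :=
  {within D, continuous f} /\
  exists2 g : V -> V, {within f @` D, continuous g} &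
                      forall x, D x -> g (f x) = x.

Definition boundary Omega : set V := closure Omega `\` Omega°.

(* The library norm of 'rV[R]_n is the sup norm. *)
Definition eucl_norm (x : V) : R := Num.sqrt (\sum_i x 0 i ^+ 2).

Definition hoelder_on (D : set V) (f : V -> V) : Prop :=
  exists alpha C : R, [/\ 0 < alpha, alpha <= 1, 0 < C &
    forall x y, D x -> D y ->
      eucl_norm (f x - f y) <= C * eucl_norm (x - y) `^ alpha].

End sobolev.

(* Main.v *)
Require Import Defs.
From HB Require Import structures.
From mathcomp Require Import all_boot all_order all_fingroup all_algebra finmap.
From mathcomp Require Import all_classical all_reals all_analysis.
From mathcomp Require Import measurable_realfun ess_sup_inf.
From mathcomp Require Import ring lra zify.
Import Order.TTheory GRing.Theory Num.Theory.
Import numFieldNormedType.Exports.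

Set Implicit Arguments.
Unset Strict Implicit.
Unset Printing Implicit Defensive.

Local Open Scope classical_set_scope.
Local Open Scope ring_scope.

(** Let u_k = f_k - x_k for the first m coordinates, extended by zero outside Omega. The boundary
    condition makes u_k continuous on R^n. Let g_kj be the j-th weak derivative of u_k in Omega and
    zero outside, and let D be the determinant of the m by m matrix with entries delta_kj + g_kj. In
    Omega, D is a minor of Df; outside, D = 1. Since the determinant of I + Du is a null Lagrangian,
    D - 1 has integral 0 over a large ball containing Omega ([det_integral_sobolev]). If the minor
    vanished almost everywhere in Omega, that integral would be -|Omega| < 0. Hence the minor is
    nonzero on a set of positive measure, and there the rank is at least m. The condition p >= m
    makes a product of m entries integrable.

    The boundary of Omega is arbitrary and the derivatives are merely in L^m. Both difficulties are
    met with difference quotients instead of mollification.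

    Inside Omega, the difference quotients of u_k converge to g_kj in L^m on small balls
    ([diffq_close], [diffq_cvg_ball]). An increment of a weakly differentiable function, integrated
    against a test function, is an integral of a translate of the derivative ([weak_difference]).
    Density of test functions and a duality argument turn this into a norm estimate, and continuity
    of translations in L^m ([translation_continuity]) makes the estimate small.

    To cross the boundary, u_k is cut off near the value 0. The truncation lives on {|u_k| >= e}, a
    compact subset of Omega, so its difference quotients converge in L^m on all of R^n
    ([trunc_diffq_cvg]). As e tends to 0 the derivatives of the truncations tend to g_kj, because
    g_kj = 0 almost everywhere on {u_k = 0} ([zero_level]).

    The null Lagrangian property is proved for differences: a suitably staggered discrete
    determinant minus 1 is exactly a sum of functions of the form F(x + v) - F(x)
    ([discrete_det_sub1]), so its integral is exactly 0. Stability of products in L^m ([prod_close],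
    [det_close]) passes this to the limit, first for the truncations ([det_integral0]), then for u
    itself. *)

(** * Product Lebesgue measure on tuples: translations and boxes *)

Section tuple_measure.
Context {R : realType}.
Local Notation T := (measurableTypeR R).

Definition tuple_shift n (v t : n.-tuple T) : n.-tuple T :=
  [tuple (tnth t i : R) + (tnth v i : R) | i < n].

Lemma measurable_tuple_shift n (v : n.-tuple T) :
  measurable_fun [set: n.-tuple T] (tuple_shift v).
Proof.
apply/measurable_fun_tnthP => i.
rewrite (_ : _ \o _ = fun t : n.-tuple T => (tnth t i : R) + (tnth v i : R)).
  by apply: measurable_funD => //; exact: measurable_tnth.
by apply/funext => t /=; rewrite tnth_mktuple.
Qed.

Lemma lebesgue_measure_shift (v : R) (A : set T) : measurable A ->
  lebesgue_measure ((fun x : R => x + v) @^-1` A) = lebesgue_measure A.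
Proof.
move=> mA.
have ms : measurable_fun [set: T] (fun x : T => (x : R) + v : T).
  by apply: measurable_funD.
have -> : lebesgue_measure ((fun x : R => x + v) @^-1` A) =
   pushforward (@lebesgue_measure R) (fun x : T => (x : R) + v : T) A by [].
apply/esym.
apply: (@lebesgue_measure_unique R
  (Measure.clone _ _ _ (pushforward (@lebesgue_measure R) (fun x : T => (x : R) + v : T)) _)) => //.
move=> _ [[a b]] _ <- /=; rewrite /pushforward.
rewrite (_ : _ @^-1` _ = `]a - v, b - v]%classic).
  rewrite !lebesgue_measure_itv /= !lte_fin ltrD2r.
  by case: ifP => // _; rewrite !EFinN -!EFinB; congr EFin; ring.
by apply/seteqP; split => x /=; rewrite !in_itv/= ltrBlDr lerBrDr.
Qed.


(** A translation acts separately on head and tail, so by induction the pushforward agrees with the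
    product measure on rectangles; uniqueness of product measures concludes. *)
Lemma tuple_lebesgue_shift n (v : n.-tuple T) (A : set (n.-tuple T)) :
  measurable A ->
  tuple_lebesgue R n (tuple_shift v @^-1` A) = tuple_lebesgue R n A.
Proof.
elim: n v A => [v A _|n IH v A mA].
  congr (tuple_lebesgue R 0 _); apply/seteqP; split => t /=.
    by rewrite (tuple0 t) (tuple0 (tuple_shift _ _)).
  by rewrite (tuple0 t) (tuple0 (tuple_shift _ _)).
pose v' : n.-tuple T := [tuple of behead v].
pose S (p : T * n.-tuple T) : T * n.-tuple T :=
  ((p.1 : R) + (tnth v ord0 : R) : T, tuple_shift v' p.2).
have mS : measurable_fun [set: T * n.-tuple T] S.
  apply/measurable_fun_pairP; split => /=.
    by apply: (@measurable_funD _ _ R) => //; exact: measurable_fst.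
  apply: (@measurableT_comp _ _ _ _ _ _ (tuple_shift v')).
    exact: measurable_tuple_shift.
  exact: measurable_snd.
have mcons : measurable ((@tuple_cons R n) @^-1` A).
  by rewrite -[X in measurable X]setTI; exact: measurable_tuple_cons.
have ES : @tuple_cons R n @^-1` (tuple_shift v @^-1` A) =
    S @^-1` (@tuple_cons R n @^-1` A).
  apply/funext => -[x t] /=; congr A; apply: eq_from_tnth => i.
  rewrite tnth_mktuple /tuple_cons /S /=.
  case: (unliftP ord0 i) => [j ->|->]; last by rewrite !tnth0.
  rewrite !tnthS tnth_mktuple; congr (_ + _).
  by rewrite [in LHS](tuple_eta v) tnthS.
rewrite /= /product_step /pushforward ES.
have -> : (lebesgue_measure \x tuple_lebesgue R n)%E
    (S @^-1` (@tuple_cons R n @^-1` A)) =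
  pushforward (lebesgue_measure \x tuple_lebesgue R n)%E S
    (@tuple_cons R n @^-1` A) by [].
apply/esym.
apply: (@product_measure_unique _ _ _ _ R (@lebesgue_measure R) _
   (Measure.clone _ _ _ (pushforward (lebesgue_measure \x tuple_lebesgue R n)%E S) _)) => //.
move=> B C mB mC /=; rewrite /pushforward.
have -> : S @^-1` (B `*` C) =
   ((fun x : R => x + (tnth v ord0 : R)) @^-1` B) `*` (tuple_shift v' @^-1` C).
  by [].
rewrite product_measure1E.
- by congr (_ * _)%E; [exact: lebesgue_measure_shift|exact: IH].
- rewrite -[X in measurable X]setTI.
  by apply: (@measurable_funD _ _ R).
- by rewrite -[X in measurable X]setTI; exact: measurable_tuple_shift.
Qed.

Lemma measurable_tuple_box n (E : 'I_n -> set T) :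
  (forall i, measurable (E i)) ->
  measurable [set t : n.-tuple T | forall i, E i (tnth t i)].
Proof.
move=> mE.
rewrite (_ : mkset _ = \bigcap_(i in [set` [pred i : 'I_n | true]])
   ((fun t : n.-tuple T => tnth t i) @^-1` E i)); last first.
  by apply/seteqP; split => [t h i _|t h i]; [exact: h|exact: (h i)].
apply: fin_bigcap_measurable; first exact: finite_finset.
move=> i _; rewrite -[X in measurable X]setTI.
exact: measurable_tnth.
Qed.

Lemma tuple_lebesgue_box n (E : 'I_n -> set T) (c : 'I_n -> R) :
  (forall i, measurable (E i)) ->
  (forall i, lebesgue_measure (E i) = (c i)%:E) ->
  tuple_lebesgue R n [set t | forall i, E i (tnth t i)] = (\prod_i c i)%:E.
Proof.
elim: n E c => [E c _ _|n IH E c mE cE].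
  rewrite big_ord0 /= diracE mem_set//= => -[].
  by [].
rewrite /= /product_step /pushforward big_ord_recl.
have -> : @tuple_cons R n @^-1` [set t | forall i, E i (tnth t i)] =
    E ord0 `*` [set t | forall i, E (lift ord0 i) (tnth t i)].
  apply/seteqP; split => -[x t] /=.
    move=> h; split; first by have := h ord0; rewrite tnth0.
    by move=> i; have := h (lift ord0 i); rewrite tnthS.
  move=> [h0 h] i.
  case: (unliftP ord0 i) => [j ->|->]; last by rewrite tnth0.
  by rewrite tnthS.
have m1 := mE ord0.
have m2 : measurable
    [set t : n.-tuple T | forall i, E (lift ord0 i) (tnth t i)].
  by apply: (@measurable_tuple_box _ (fun i => E (lift ord0 i))) => i.
rewrite (product_measure1E _ _ m1 m2)/=.
rewrite cE (IH (fun i => E (lift ord0 i)) (fun i => c (lift ord0 i)))//.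
Qed.

End tuple_measure.

(** * Lebesgue measure on row vectors: translation invariance, balls, open sets *)

Section lebesgue_space_basics.
Context {R : realType} {n : nat}.
Local Notation V := 'rV[R]_n.
Local Notation L := (lebesgue_space R n).
Local Notation mu := (@lebesgue_rV R n).
Local Notation T := (measurableTypeR R).

Definition tuple_of_row (x : V) : n.-tuple T := [tuple x 0 i | i < n].

Lemma row_of_tupleK : cancel (@row_of_tuple R n) tuple_of_row.
Proof. by move=> t; apply: eq_from_tnth => i; rewrite tnth_mktuple mxE. Qed.

Lemma tuple_of_rowK : cancel tuple_of_row (@row_of_tuple R n).
Proof. by move=> x; apply/rowP => i; rewrite mxE tnth_mktuple. Qed.

Lemma row_of_tuple_shift (v t : n.-tuple T) :
  row_of_tuple (tuple_shift v t) = row_of_tuple t + row_of_tuple v.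
Proof. by apply/rowP => i; rewrite !mxE tnth_mktuple. Qed.

Let measurable_caratheodory (E : set V) :
  measurable (E : set L) = caratheodory_measurable (@lebesgue_outer R n) E.
Proof. by []. Qed.

Lemma measurable_row_preimage (E : set V) :
  measurable (@row_of_tuple R n @^-1` E) -> measurable (E : set L).
Proof.
rewrite measurable_caratheodory => mE X; rewrite /lebesgue_outer.
exact: (caratheodory_measurable_mu_ext (tuple_lebesgue R n) mE
  (@row_of_tuple R n @^-1` X)).
Qed.

Lemma lebesgue_rVE (E : set V) :
  measurable (@row_of_tuple R n @^-1` E) ->
  mu E = tuple_lebesgue R n (@row_of_tuple R n @^-1` E).
Proof. by move=> mE; rewrite /lebesgue_rV /lebesgue_outer measurable_mu_extE. Qed.

(** Translating a countable Borel cover of A covers the translate of A at the same cost. The reverse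
    inequality then follows by translating back. *)
Let lebesgue_outer_shift_le (v : V) (A : set V) :
  (lebesgue_outer ((fun x => (x + v)%R) @^-1` A) <= lebesgue_outer A)%E.
Proof.
rewrite /lebesgue_outer /mu_ext; apply: le_ereal_inf_tmp => _ [F [mF AF] <-].
apply: ereal_inf_lbound.
exists (fun k => tuple_shift (tuple_of_row v) @^-1` F k).
  split=> [k|t /=].
    by rewrite -[X in measurable X]setTI; exact: measurable_tuple_shift.
  rewrite -{1}(tuple_of_rowK v) -row_of_tuple_shift => /AF[k _ Fk].
  by exists k.
by apply: eq_eseriesr => k _; rewrite tuple_lebesgue_shift.
Qed.

Lemma lebesgue_outer_shift (v : V) (A : set V) :
  lebesgue_outer ((fun x => x + v) @^-1` A) = lebesgue_outer A.
Proof.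
apply/eqP; rewrite eq_le lebesgue_outer_shift_le /=.
rewrite -{1}(_ : (fun x => x - v) @^-1` ((fun x => x + v) @^-1` A) = A).
  exact: lebesgue_outer_shift_le.
by apply/funext => x /=; rewrite subrK.
Qed.

(** The Caratheodory splitting of X by a translate of E is the splitting of a translate of X by E,
    and the outer measure is translation invariant. *)
Lemma measurable_shift (v : V) : measurable_fun [set: L] (fun x : L => x + v : L).
Proof.
move=> _ E; rewrite !measurable_caratheodory => mE; rewrite setTI => X.
have := mE ((fun x => x - v) @^-1` X).
rewrite lebesgue_outer_shift => ->.
rewrite -(lebesgue_outer_shift v (_ `&` E)) -(lebesgue_outer_shift v (_ `&` ~` E)).
have H B : (fun x => x + v) @^-1` ((fun x => x - v) @^-1` X `&` B) =
    X `&` (fun x => x + v) @^-1` B.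
  by apply/funext => x /=; rewrite addrK.
by rewrite !H.
Qed.

Let shift_measure (v : V) : {measure set L -> \bar R} :=
  measure_function_pushforward__canonical__measure_function_Measure mu (measurable_shift v).

Lemma ge0_integral_shift (v : V) (f : V -> \bar R) :
  measurable_fun [set: L] f -> (forall x, 0 <= f x)%E ->
  (\int[mu]_x f (x + v)%R = \int[mu]_x f x)%E.
Proof.
move=> mf f0.
have /= := @ge0_integral_pushforward _ _ L L R (fun x : L => x + v : L)
  (measurable_shift v) mu setT f measurableT mf (fun x _ => f0 x).
rewrite preimage_setT => <-.
apply: (@eq_measure_integral _ L R setT mu (shift_measure v) f) => A mA _.
exact: lebesgue_outer_shift.
Qed.

Lemma integrable_shift (v : V) (f : V -> \bar R) :
  mu.-integrable [set: L] f -> mu.-integrable [set: L] (fun x : L => f (x + v)).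
Proof.
move=> /integrableP[mf foo]; apply/integrableP; split.
  exact: (measurableT_comp (T2 := L) mf (measurable_shift v)).
apply: (eq_ind_r (fun z => (z < +oo)%E) foo).
apply: (@ge0_integral_shift v (fun x => `|f x|%E)) => [|x].
  exact: measurableT_comp.
exact: abse_ge0.
Qed.

Lemma integral_shift (v : V) (f : V -> \bar R) :
  mu.-integrable [set: L] f ->
  (\int[mu]_x f (x + v)%R = \int[mu]_x f x)%E.
Proof.
move=> intf.
have mf := measurable_int _ intf.
have /= := @integral_pushforward _ _ L L R (fun x : L => x + v : L)
  (measurable_shift v) mu setT f mf (integrable_shift v intf) measurableT.
rewrite preimage_setT => <-.
apply: (@eq_measure_integral _ L R setT mu (shift_measure v) f) => A mA _.
exact: lebesgue_outer_shift.
Qed.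

Lemma rV_ballE (x : V) (r : R) (y : V) : 0 < r ->
  ball x r y <-> forall i, y 0 i \in `]x 0 i - r, x 0 i + r[.
Proof.
move=> r0; split.
  by move=> [_ h] i; have := h 0 i; rewrite /ball/= in_itv/= ltr_distlC.
by move=> h; split => // i j; rewrite (ord1 i); have := h j;
  rewrite /ball/= in_itv/= ltr_distlC.
Qed.

Let row_preimage_box (E : 'I_n -> set R) :
  @row_of_tuple R n @^-1` [set x | forall i, E i (x 0 i)] =
  [set t | forall i, E i (tnth t i)].
Proof. by apply/seteqP; split => t h i; have := h i; rewrite mxE. Qed.

Lemma measurable_box (E : 'I_n -> set R) : (forall i, measurable (E i)) ->
  measurable (@row_of_tuple R n @^-1` [set x | forall i, E i (x 0 i)]).
Proof. by move=> mE; rewrite row_preimage_box; exact: measurable_tuple_box. Qed.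

Lemma lebesgue_rV_box (E : 'I_n -> set R) (c : 'I_n -> R) :
  (forall i, measurable (E i)) ->
  (forall i, @lebesgue_measure R (E i) = (c i)%:E) ->
  mu [set x | forall i, E i (x 0 i)] = (\prod_i c i)%:E.
Proof.
move=> mE cE; rewrite lebesgue_rVE; last exact: measurable_box.
by rewrite row_preimage_box; exact: tuple_lebesgue_box.
Qed.

Let rV_ball_box (x : V) (r : R) : 0 < r ->
  ball x r = [set y | forall i, `]x 0 i - r, x 0 i + r[%classic (y 0 i)].
Proof. by move=> r0; apply/seteqP; split => y /(rV_ballE _ _ r0). Qed.

Lemma lebesgue_rV_ball (x : V) (r : R) : 0 < r ->
  mu (ball x r) = ((2 * r) ^+ n)%:E.
Proof.
move=> r0; rewrite (rV_ball_box x r0).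
have -> : (2 * r) ^+ n = \prod_(i < n) (2 * r) by rewrite prodr_const card_ord.
apply: (@lebesgue_rV_box (fun i => `]x 0 i - r, x 0 i + r[%classic) (fun=> 2 * r)) => // i.
rewrite lebesgue_measure_itv/= lte_fin ifT.
  by rewrite -EFinB; congr EFin; ring.
lra.
Qed.

(** The radius is doubled in the index set so that each ball of the cover has a concentric
    enlargement inside A. Local convergence of difference quotients needs exactly this margin. *)
Lemma open_rational_cover (A : set V) : open A ->
  A = \bigcup_(q in [set q : 'rV[rat]_n * nat |
    ball (map_mx ratr q.1 : V) (q.2.+1%:R^-1 + q.2.+1%:R^-1) `<=` A])
    ball (map_mx ratr q.1 : V) q.2.+1%:R^-1.
Proof.
move=> oA; apply/seteqP; split => [x Ax|x [q qA qx]]; last first.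
  apply: qA; apply: le_ball qx.
  by rewrite lerDl invr_ge0.
have [e /= e0 xeA] : nbhs_ball x A by rewrite nbhs_ballE; exact: oA.
have [k ke] : exists k : nat, k.+1%:R^-1 < e / 3.
  exists (Num.trunc (e / 3)^-1).
  by rewrite invf_plt ?posrE ?divr_gt0// truncnS_gt.
have k0 : 0 < k.+1%:R^-1 :> R by rewrite invr_gt0.
have /(_ _)/cid-/all_sig[q qP] : forall i : 'I_n, exists q : rat,
    ratr q \in `]x 0 i - k.+1%:R^-1, x 0 i + k.+1%:R^-1[.
  by move=> i; apply: rat_in_itvoo; rewrite ltrD2l (lt_trans _ k0)// oppr_lt0.
have xc : ball x k.+1%:R^-1 (map_mx ratr (\row_i q i) : V).
  by apply/rV_ballE => // i; rewrite !mxE.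
exists (\row_i q i, k); last exact: ball_sym.
move=> y /= cy; apply: xeA; apply: le_ball (ball_triangle xc cy) => /=.
by move: ke; rewrite ltr_pdivlMr//; move: (k.+1%:R^-1) => a; lra.
Qed.

Lemma measurable_row_open (A : set V) : open A ->
  measurable (@row_of_tuple R n @^-1` A).
Proof.
move=> oA; rewrite (open_rational_cover oA) preimage_bigcup.
rewrite bigcup_mkcond; apply: countable_bigcupT_measurable => // q.
case: ifPn => // _; rewrite rV_ball_box ?invr_gt0//.
pose c : V := map_mx ratr q.1.
apply: (@measurable_box
  (fun i => `]c 0 i - q.2.+1%:R^-1, c 0 i + q.2.+1%:R^-1[%classic)) => i.
exact: measurable_itv.
Qed.

Lemma open_measurable_rV (A : set V) : open A -> measurable (A : set L).
Proof. by move=> oA; apply: measurable_row_preimage; exact: measurable_row_open. Qed.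

Lemma closed_measurable_rV (A : set V) : closed A -> measurable (A : set L).
Proof.
by move=> cA; rewrite -(setCK A); apply: measurableC; apply: open_measurable_rV;
   exact: closed_openC.
Qed.

Lemma continuous_measurable_rV (g : V -> R) :
  continuous g -> measurable_fun [set: L] (g : L -> R).
Proof.
move=> cg; apply: (measurability _ (RGenOInfty.measurableE R)) => //.
move=> _ [_ [a ->] <-]; rewrite setTI.
apply: open_measurable_rV; apply: open_comp => [x _|//].
exact: cg.
Qed.

End lebesgue_space_basics.

(** * Integrals of q-th powers *)

Section abs_power_integral.
Context d (T : measurableType d) (R : realType) (mu : {measure set T -> \bar R}).
Implicit Types (D : set T) (f g : T -> R) (q : nat).

(** The q-th power of the L^q norm for a natural exponent. Without roots it stays a plain integral,
    at the price of a factor 2^q in the triangle inequality. *)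
Definition abs_pow_int q D f : \bar R := (\int[mu]_(x in D) (`|f x| ^+ q)%:E)%E.
Local Notation I_ := abs_pow_int.

Lemma abs_pow_int_ge0 q D f : (0 <= I_ q D f)%E.
Proof. by apply: integral_ge0 => x _; rewrite lee_fin exprn_ge0. Qed.

Lemma measurable_abs_pow q D f : measurable_fun D f ->
  measurable_fun D (fun x => (`|f x| ^+ q)%:E).
Proof.
move=> mf; apply/measurable_EFinP; apply: measurable_funX.
exact: measurableT_comp.
Qed.

Lemma abs_pow_int_le q D f g : measurable D -> measurable_fun D f ->
  measurable_fun D g -> (forall x, D x -> `|f x| <= `|g x|) ->
  (I_ q D f <= I_ q D g)%E.
Proof.
move=> mD mf mg fg; apply: ge0_le_integral => //.
- exact: measurable_abs_pow.
- exact: measurable_abs_pow.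
- by move=> x Dx; rewrite lee_fin lerXn2r ?nnegrE// fg.
Qed.

Lemma eq_abs_pow_int q D f g : (forall x, D x -> `|f x| = `|g x|) ->
  I_ q D f = I_ q D g.
Proof. by move=> fg; apply: eq_integral => x /set_mem Dx; rewrite fg. Qed.

Lemma abs_pow_int_subset q D D' f : measurable D -> measurable D' ->
  measurable_fun D' f -> D `<=` D' -> (I_ q D f <= I_ q D' f)%E.
Proof.
move=> mD mD' mf DD'; apply: ge0_subset_integral => //.
- exact: measurable_abs_pow.
Qed.

(** A crude substitute for Minkowski's inequality: |a + b| is at most twice the larger of |a| and
    |b|. *)
Lemma normD_pow_le q (a b : R) :
  `|a + b| ^+ q <= 2 ^+ q * (`|a| ^+ q + `|b| ^+ q).
Proof.
apply: (@le_trans _ _ ((2 * Num.max `|a| `|b|) ^+ q)).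
  rewrite lerXn2r ?nnegrE ?mulr_ge0 ?le_max ?normr_ge0//.
  apply: le_trans (ler_normD _ _) _.
  by rewrite mulr_natl mulr2n lerD// le_max lexx// orbT.
rewrite exprMn ler_wpM2l ?exprn_ge0//.
have a0 : 0 <= `|a| ^+ q by exact: exprn_ge0.
have b0 : 0 <= `|b| ^+ q by exact: exprn_ge0.
by rewrite maxEle; case: ifP => _; lra.
Qed.

Lemma abs_pow_intD q D f g : measurable D -> measurable_fun D f ->
  measurable_fun D g ->
  (I_ q D (fun x => f x + g x)%R <= (2 ^+ q)%:E * (I_ q D f + I_ q D g))%E.
Proof.
move=> mD mf mg.
rewrite -ge0_integralD//; first last.
- exact: measurable_abs_pow.
- exact: measurable_abs_pow.
rewrite -ge0_integralZl_EFin ?exprn_ge0//; first last.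
- by apply: emeasurable_funD; exact: measurable_abs_pow.
- by move=> x _; rewrite -EFinD lee_fin addr_ge0// exprn_ge0.
apply: ge0_le_integral => //.
- by apply: measurable_abs_pow; exact: measurable_funD.
- by apply: measurable_funeM; apply: emeasurable_funD; exact: measurable_abs_pow.
- by move=> x _; rewrite -EFinD -EFinM lee_fin normD_pow_le.
Qed.

Lemma abs_pow_intZ q D (a : R) f : measurable D -> measurable_fun D f ->
  I_ q D (fun x => a * f x) = ((`|a| ^+ q)%:E * I_ q D f)%E.
Proof.
move=> mD mf; rewrite -ge0_integralZl_EFin ?exprn_ge0//; first last.
- exact: measurable_abs_pow.
by apply: eq_integral => x _; rewrite normrM exprMn EFinM.
Qed.

Lemma abs_pow_int_dominated q D (f_ : nat -> T -> R) g : (0 < q)%N ->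
  measurable D -> (forall k, measurable_fun D (f_ k)) -> measurable_fun D g ->
  (forall x, D x -> f_ k x @[k --> \oo] --> (0 : R)) ->
  (forall k x, D x -> `|f_ k x| <= g x) -> (I_ q D g < +oo)%E ->
  (I_ q D (f_ k) @[k --> \oo] --> 0)%E.
Proof.
move=> q0 mD mf mg f0 fg goo.
have ig : mu.-integrable D (fun x => (`|g x| ^+ q)%:E).
  apply/integrableP; split; first exact: measurable_abs_pow.
  rewrite (eq_integral (fun x => (`|g x| ^+ q)%:E))// => x _.
  by rewrite gee0_abs// lee_fin exprn_ge0.
have := @dominated_cvg _ _ _ mu _ mD (fun k x => (`|f_ k x| ^+ q)%:E) (cst 0%E)
  (fun x => (`|g x| ^+ q)%:E) _ _ (fun=> fun=> erefl) ig _.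
rewrite integral_cst// mul0e; apply.
- by move=> k; exact: measurable_abs_pow.
- move=> x Dx; apply: cvg_EFin; first exact: nearW.
  have c0 : {for (0 : R), continuous (fun y : R => `|y| ^+ q)}.
    apply: (@continuous_comp _ _ _ (fun y : R => `|y|) (fun y => y ^+ q)).
      exact: norm_continuous.
    exact: exprn_continuous.
  have := cvg_comp _ _ (f0 x Dx) c0.
  by rewrite normr0 expr0n eqn0Ngt q0.
- move=> k x Dx; rewrite gee0_abs ?lee_fin ?exprn_ge0//.
  rewrite lerXn2r ?nnegrE//.
  by rewrite (le_trans (fg k x Dx))// ler_norm.
Qed.

Lemma abs_pow_int_lower p q D g : (p <= q)%N -> measurable D ->
  (mu D < +oo)%E -> measurable_fun D g -> (I_ q D g < +oo -> I_ p D g < +oo)%E.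
Proof.
move=> pq mD muD mg goo.
have h : (I_ p D g <= \int[mu]_(x in D) (1 + (`|g x| ^+ q)%:E))%E.
  apply: ge0_le_integral => //.
  - exact: measurable_abs_pow.
  - by apply: emeasurable_funD => //; exact: measurable_abs_pow.
  - move=> x _; rewrite -EFinD lee_fin.
    have [g1|g1] := leP `|g x| 1.
      by rewrite (@le_trans _ _ 1)// ?exprn_ile1// lerDl exprn_ge0.
    by rewrite (@le_trans _ _ (`|g x| ^+ q))// ?ler_weXn2l ?lerDr// ltW.
apply: le_lt_trans h _.
rewrite ge0_integralD//; last exact: measurable_abs_pow.
by rewrite integral_cst// mul1e lte_add_pinfty.
Qed.

Lemma abs_pow_int_integrable q D f : (0 < q)%N -> measurable D ->
  (mu D < +oo)%E -> measurable_fun D f -> (I_ q D f < +oo)%E ->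
  mu.-integrable D (EFin \o f).
Proof.
move=> q0 mD muD mf /(abs_pow_int_lower q0 mD muD mf) foo.
apply/integrableP; split; first exact/measurable_EFinP.
by apply: le_lt_trans foo; rewrite le_eqVlt; apply/orP; left; apply/eqP;
   apply: eq_integral => x _; rewrite expr1.
Qed.

End abs_power_integral.

(** * Smooth functions built from exp(-1/s) *)

Section flat_functions.
Context {R : realType}.

Lemma cvg_is_derive (V : normedModType R) (f : V -> R) (x v : V) (df : R) :
  h^-1 *: ((f \o shift x) (h *: v) - f x) @[h --> 0^'] --> df ->
  is_derive x v f df.
Proof.
move=> fdf; apply: DeriveDef; first by apply/cvg_ex; exists df.
exact: cvg_lim.
Qed.

(** All powers s^-k exp(-1/s) are treated together because the span of this family is closed under
    differentiation. *)
Definition flat k (s : R) : R :=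
  if 0 < s then s^-1 ^+ k * expR (- s^-1) else 0.

Lemma flat_ge0 k s : 0 <= flat k s.
Proof. by rewrite /flat; case: ifP => // s0; rewrite mulr_ge0 ?expR_ge0 ?exprn_ge0 ?invr_ge0 ?ltW. Qed.

(** One term of the exponential series of 1/s suffices. The quadratic bound is what gives derivative
    0 at the gluing point s = 0. *)
Lemma flat_le k s : flat k s <= (k.+2)`!%:R * `|s| ^+ 2.
Proof.
rewrite /flat; case: ifPn => [s0|_]; last by rewrite mulr_ge0// exprn_ge0.
have si0 : 0 < s^-1 by rewrite invr_gt0.
have f0 : 0 < (k.+2)`!%:R :> R by rewrite ltr0n fact_gt0.
have e : expR (- s^-1) <= (k.+2)`!%:R * s ^+ k.+2.
  have s1 : 0 < s ^+ k.+2 by exact: exprn_gt0.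
  rewrite expRN invf_ple ?posrE ?expR_gt0 ?(mulr_gt0 f0 s1)//.
  rewrite invfM -exprVn mulrC.
  by apply: le_trans (expR_ge1Dxn k.+1 (ltW si0)); rewrite lerDr.
rewrite gtr0_norm// -[leRHS](_ : s^-1 ^+ k * ((k.+2)`!%:R * s ^+ k.+2) = _).
  by rewrite ler_wpM2l// exprn_ge0// ltW.
rewrite mulrCA; congr (_ * _).
by rewrite -addn2 exprD mulrA -exprMn mulVf ?gt_eqF// expr1n mul1r.
Qed.


Lemma is_derive_flat k (s : R) :
  is_derive s (1 : R) (flat k) (flat k.+2 s - k%:R * flat k.+1 s).
Proof.
have [s0|s0|<-] := ltgtP 0 s.
- have E : {near s, (fun t => t^-1 ^+ k * expR (- t^-1)) =1 flat k}.
    near=> t; rewrite /flat ifT//; near: t; exact: lt_nbhsr.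
  apply: (near_eq_is_derive E).
  rewrite /flat s0.
  have sN : s != 0 by rewrite gt_eqF.
  have dV : is_derive s 1 (fun t : R => t^-1) (- s ^- 2).
    have := @is_deriveV R id s 1 1 sN (is_derive_id _ _).
    by rewrite [_ *: _]mulr1.
  have dE : is_derive s 1 (fun t : R => expR (- t^-1)) (expR (- s^-1) * s ^- 2).
    have dN : is_derive s 1 (fun t : R => - t^-1) (s ^- 2).
      by rewrite -[s ^- 2]opprK; apply: is_deriveN.
    exact: (@is_derive1_comp R expR (fun t => - t^-1) s _ _ (is_derive_expR _) dN).
  have dX := @is_deriveX R _ (fun t : R => t^-1) k s 1 _ dV.
  have -> : (fun t : R => t^-1 ^+ k * expR (- t^-1)) =
      ((fun t : R => t^-1) ^+ k) * (fun t : R => expR (- t^-1)).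
    by apply/funext => t; rewrite !fctE.
  apply: (is_derive_eq (is_deriveM dX dE)).
  rewrite -exprVn /GRing.scale/=; case: k {E dX} => [|k] /=; rewrite fctE; first by ring.
  by rewrite !(exprS _ k.+1, exprS _ k.+2, exprS _ k); move: (_ ^+ k) k.+1%:R => X Y; ring.
- have E : {near s, (cst 0 : R -> R) =1 flat k}.
    near=> t; rewrite /flat ltNge ltW//; near: t; exact: lt_nbhsl.
  rewrite /flat ltNge (ltW s0)/= mulr0 subr0.
  exact: (near_eq_is_derive E).
- rewrite {2 3}/flat ltxx mulr0 subr0; apply: cvg_is_derive.
  rewrite {2}/flat ltxx; apply/cvgr0Pnorm_le => e e0.
  near=> h.
  have h0 : h != 0 by near: h; exact: nbhs_dnbhs_neq.
  rewrite subr0 /= addr0 [h *: 1]mulr1 normrM normfV ler_pdivrMl ?normr_gt0//.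
  rewrite ger0_norm ?flat_ge0//; apply: (le_trans (flat_le _ _)).
  rewrite expr2 mulrCA ler_wpM2l// -ler_pdivlMl ?ltr0n ?fact_gt0//.
  near: h; apply: dnbhs0_le; rewrite mulr_gt0// invr_gt0 ltr0n fact_gt0.
Unshelve. all: by end_near. Qed.

End flat_functions.

Section smooth_functions.
Context {R : realType}.

Definition bump_fun (Q p : {poly R}) k (t : R) : R := p.[t] * flat k Q.[t].

Lemma flat_succ k (s : R) : flat k s = s * flat k.+1 s.
Proof.
rewrite /flat; case: ifPn => s0; last by rewrite mulr0.
by rewrite exprS !mulrA mulfV ?gt_eqF// mul1r.
Qed.

(** The derivative has terms of index k, k+1 and k+2; [flat_succ] raises all of them to index k+2,
    so a single polynomial factor is enough and the form of the function is preserved. *)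
Lemma is_derive_bump_fun (Q p : {poly R}) k (t : R) :
  is_derive t (1 : R) (bump_fun Q p k)
    (bump_fun Q (p^`() * Q ^+ 2 + p * Q^`() * (1 - k%:R *: Q)) k.+2 t).
Proof.
have dQ := is_derive_poly Q t.
have dF := @is_derive1_comp R (flat k) (horner Q) t _ _ (is_derive_flat k Q.[t]) dQ.
apply: (is_derive_eq (is_deriveM (is_derive_poly p t) dF)).
rewrite /bump_fun /GRing.scale/= !(hornerD, hornerM, hornerZ, hornerN, hornerC, horner_exp) (flat_succ k) (flat_succ k.+1).
by ring.
Qed.

Context {n : nat}.
Local Notation V := 'rV[R]_n.

(** Smoothness by invariance: a class of continuous functions that is stable under every partial
    derivative contains all iterated derivatives of its members. *)
Lemma smooth_class (S : set (V -> R)) :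
  (forall phi, S phi -> continuous phi /\
    forall j, (forall x, derivable phi x (delta_mx 0 j)) /\ S (partial j phi)) ->
  forall phi, S phi -> smooth phi.
Proof.
move=> H phi Sphi s.
have {Sphi} : S (foldr (@partial R n) phi s).
  by elim: s => //= j s /H[_ /(_ j)[]].
by move=> /H[c d]; split=> // j x; case: (d j).
Qed.

Lemma smooth_continuous (phi : V -> R) : smooth phi -> forall x, {for x, continuous phi}.
Proof. by move=> /(_ [::])[]. Qed.

Lemma smooth_derivable (phi : V -> R) j x : smooth phi ->
  derivable phi x (delta_mx 0 j).
Proof. by move=> /(_ [::])[_]; apply. Qed.

Lemma smooth_partial (phi : V -> R) j : smooth phi -> smooth (partial j phi).
Proof. by move=> sphi s; rewrite -foldr_rcons; exact: sphi. Qed.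

Lemma smooth_linear (a : R) (phi psi : V -> R) : smooth phi -> smooth psi ->
  smooth (fun x => a * phi x + psi x).
Proof.
move=> sphi spsi.
apply: (@smooth_class [set f | exists u v, [/\ smooth u, smooth v & f = (fun x => a * u x + v x)]]);
  last by exists phi, psi.
move=> _ [u [v [su sv ->]]].
have dZ j x : derivable (fun x => a * u x) x (delta_mx 0 j).
  exact: (@derivableZ R V R u a x (delta_mx 0 j) (@smooth_derivable u j x su)).
split => [x|j].
  apply: (@continuousD _ _ _ (fun x => a * u x) v).
    exact: (@continuousM R V (cst a) u x (@cst_continuous _ _ a x) (@smooth_continuous u su x)).
  exact: smooth_continuous.
split => [x|].
  exact: (derivableD (dZ j x) (@smooth_derivable v j x sv)).
exists (partial j u), (partial j v); split; [exact: smooth_partial..|].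
apply/funext => x; rewrite /partial.
rewrite (deriveD (dZ j x) (@smooth_derivable v j x sv)).
congr (_ + _).
exact: (@deriveZ R V R u a x (delta_mx 0 j) (@smooth_derivable u j x su)).
Qed.

Let quotient_translate (phi : V -> R) (w x v : V) :
  (fun h : R => h^-1 *: (((fun x => phi (x + w)) \o shift x) (h *: v) - phi (x + w))) =
  (fun h : R => h^-1 *: ((phi \o shift (x + w)) (h *: v) - phi (x + w))).
Proof. by apply/funext => h /=; rewrite addrA. Qed.

Lemma derivable_translate (phi : V -> R) (w x v : V) :
  derivable phi (x + w) v -> derivable (fun x => phi (x + w)) x v.
Proof. by rewrite /derivable quotient_translate. Qed.

Lemma derive_translate (phi : V -> R) (w x v : V) :
  'D_v (fun x => phi (x + w)) x = 'D_v phi (x + w).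
Proof. by rewrite /derive quotient_translate. Qed.

Lemma smooth_translate (phi : V -> R) (w : V) : smooth phi ->
  smooth (fun x => phi (x + w)).
Proof.
move=> sphi.
apply: (@smooth_class [set f | exists2 u, smooth u & f = (fun x => u (x + w))]);
  last by exists phi.
move=> _ [u su ->]; split => [x|j].
  have c : {for x, continuous (fun x : V => x + w)}.
    exact: (@continuousD _ _ V id (cst w) x (@cvg_id _ _) (@cst_continuous _ _ w x)).
  exact: (@continuous_comp V V R (fun x => x + w) u x c (@smooth_continuous u su _)).
split => [x|]; first exact/derivable_translate/smooth_derivable.
exists (partial j u); first exact: smooth_partial.
by apply/funext => x; rewrite /partial derive_translate.
Qed.

Lemma is_derive_tensor (F : 'I_n -> R -> R) (x : V) j df :
  is_derive (x 0 j) (1 : R) (F j) df ->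
  is_derive x (delta_mx 0 j) (fun y : V => \prod_i F i (y 0 i))
    (df * \prod_(i | i != j) F i (x 0 i)).
Proof.
move=> [dF <-]; apply: cvg_is_derive.
set c := \prod_(i | i != j) _.
rewrite (_ : (fun h => _) = (fun h : R => h^-1 *: ((F j \o shift (x 0 j)) (h *: 1) - F j (x 0 j)) * c)).
  exact: (cvgM dF (cvg_cst c)).
apply/funext => h /=.
rewrite (bigD1 j)//= [in X in _ - X](bigD1 j)//= -/c.
rewrite !mxE !eqxx mulr1 [h *: 1]mulr1.
rewrite (_ : \prod_(i < n | i != j) _ = c).
  by rewrite /GRing.scale/= -mulrBl mulrA.
apply: eq_bigr => i ij; rewrite !mxE (negPf ij) andbF.
by rewrite mulr0 add0r.
Qed.

Lemma continuous_tensor (F : 'I_n -> R -> R) : (forall i, continuous (F i)) ->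
  continuous (fun y : V => \prod_i F i (y 0 i)).
Proof.
move=> cF x.
rewrite (_ : (fun y => _) = \prod_i (fun y : V => F i (y 0 i))); last first.
  by apply/funext => y; rewrite fct_prodE.
apply: (big_ind (fun f : V -> R => {for x, continuous f})) => [|f g cf cg|i _].
- exact: (@cst_continuous V R 1 x).
- exact: (@continuousM R V f g x cf cg).
- exact: (@continuous_comp V R R (fun y : V => y 0 i) (F i) x
    (@coord_continuous _ _ _ _ _ x) (@cF i _)).
Qed.

(** A partial derivative changes the polynomial and the index of a single factor, so these tensor
    products form a class as in [smooth_class]. *)
Lemma smooth_tensor (Q p : 'I_n -> {poly R}) (k : 'I_n -> nat) :
  smooth (fun x : V => \prod_i bump_fun (Q i) (p i) (k i) (x 0 i)).
Proof.
apply: (@smooth_class [set f | exists p k,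
  f = (fun x : V => \prod_i bump_fun (Q i) (p i) (k i) (x 0 i))]);
  last by exists p, k.
move=> _ [{}p [{}k ->]]; split => [|j].
  apply: (@continuous_tensor (fun i => bump_fun (Q i) (p i) (k i))) => i t.
  apply: differentiable_continuous; apply/derivable1_diffP.
  by have [] := is_derive_bump_fun (Q i) (p i) (k i) t.
have d (x : V) := is_derive_tensor (F := fun i => bump_fun (Q i) (p i) (k i)) (is_derive_bump_fun (Q j) (p j) (k j) (x 0 j)).
split => [x|]; first by have [] := d x.
set p' := (X in bump_fun _ X) in d.
exists (fun i => if i == j then p' else p i), (fun i => if i == j then (k j).+2 else k i).
apply/funext => x; have [_] := d x; rewrite /partial => ->.
rewrite [RHS](bigD1 j)//= eqxx; congr (_ * _).
by apply: eq_bigr => i /negPf ->.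
Qed.

End smooth_functions.

(** * Density in L^q, reduced to indicator functions *)

Section approximation_in_mean.
Context d (T : measurableType d) (R : realType) (mu : {measure set T -> \bar R}).
Variables (q : nat) (D : set T) (S : set (T -> R)).
Hypotheses (q0 : (0 < q)%N) (mD : measurable D)
  (mS : forall f, S f -> measurable_fun D f)
  (S0 : S (cst 0))
  (Slin : forall a f g, S f -> S g -> S (fun x => a * f x + g x)).
Implicit Types (f g : T -> R).
Local Notation I_ := (abs_pow_int mu q D).

Definition approximable f :=
  forall e : R, 0 < e -> exists2 g, S g & (I_ (fun x => f x - g x)%R <= e%:E)%E.

Lemma approximable_subset f : S f -> approximable f.
Proof.
move=> Sf e e0; exists f => //.
rewrite (@eq_abs_pow_int _ _ _ _ _ _ _ (cst 0)) => [|x _]; last by rewrite subrr.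
rewrite /abs_pow_int integral0_eq ?lee_fin ?ltW// => x _.
by rewrite normr0 expr0n eqn0Ngt q0.
Qed.

Lemma eq_approximable f g : (forall x, D x -> f x = g x) ->
  approximable f -> approximable g.
Proof.
move=> fg af e /af[h Sh Ih]; exists h => //.
rewrite (@eq_abs_pow_int _ _ _ _ _ _ _ (fun x => f x - h x))// => x Dx.
by rewrite fg.
Qed.

Lemma approximable_limit f : measurable_fun D f ->
  (forall e : R, 0 < e -> exists g, [/\ measurable_fun D g, approximable g &
    (I_ (fun x => f x - g x)%R <= e%:E)%E]) -> approximable f.
Proof.
move=> mf H e e0.
pose e' := e / 2 ^+ q / 2.
have q2 : 0 < 2 ^+ q :> R by rewrite exprn_gt0.
have e'0 : 0 < e' by rewrite !divr_gt0.
have [g [mg ag Ig]] := H _ e'0.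
have [h Sh Ih] := ag _ e'0.
exists h => //.
have mh := mS Sh.
rewrite (@eq_abs_pow_int _ _ _ _ _ _ _ (fun x => (f x - g x) + (g x - h x))) => [|x _];
  last by rewrite addrA subrK.
apply: le_trans.
  exact: (@abs_pow_intD _ _ _ mu q D _ _ mD (measurable_funB mf mg) (measurable_funB mg mh)).
have -> : e = 2 ^+ q * (e' + e') by rewrite /e' -splitr mulrC divfK// gt_eqF.
rewrite EFinM EFinD; apply: lee_wpmul2l; first by rewrite lee_fin ltW.
exact: leeD.
Qed.

Lemma approximable_linear a f g : measurable_fun D f -> measurable_fun D g ->
  approximable f -> approximable g -> approximable (fun x => a * f x + g x).
Proof.
move=> mf mg af ag e e0.
have q2 : 0 < 2 ^+ q :> R by rewrite exprn_gt0.
pose c := `|a| ^+ q + 1.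
have c0 : 0 < c by rewrite ltr_wpDl// exprn_ge0.
pose e' := e / 2 ^+ q / c.
have e'0 : 0 < e' by rewrite !divr_gt0.
have [h Sh Ih] := af _ e'0.
have [k Sk Ik] := ag _ e'0.
exists (fun x => a * h x + k x); first exact: Slin.
have mh := mS Sh; have mk := mS Sk.
have mfh := measurable_funB mf mh; have mgk := measurable_funB mg mk.
rewrite (@eq_abs_pow_int _ _ _ _ _ _ _ (fun x => a * (f x - h x) + (g x - k x))) => [|x _];
  last by congr Num.norm; ring.
have mafh : measurable_fun D (fun x => a * (f x - h x)).
  by apply: measurable_funM.
apply: le_trans.
  exact: (@abs_pow_intD _ _ _ mu q D _ _ mD mafh mgk).
rewrite abs_pow_intZ//.
have -> : e = 2 ^+ q * (`|a| ^+ q * e' + e').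
  rewrite -[X in _ + X]mul1r -mulrDl -/c.
  by rewrite /e' [c * _]mulrC divfK ?gt_eqF// mulrC divfK ?gt_eqF.
rewrite EFinM EFinD; apply: lee_wpmul2l; first by rewrite lee_fin ltW.
apply: leeD => //; rewrite EFinM; apply: lee_wpmul2l => //.
Qed.

Lemma approximable_dominated (f_ : nat -> T -> R) f g :
  (forall k, approximable (f_ k)) -> (forall k, measurable_fun D (f_ k)) ->
  measurable_fun D f -> measurable_fun D g ->
  (forall x, D x -> f_ k x @[k --> \oo] --> f x) ->
  (forall k x, D x -> `|f x - f_ k x| <= g x) -> (I_ g < +oo)%E ->
  approximable f.
Proof.
move=> af mf_ mf mg ff fg goo; apply: approximable_limit => // e e0.
have : (I_ (fun x => f x - f_ k x)%R @[k --> \oo] --> 0)%E.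
  apply: (abs_pow_int_dominated q0 mD _ mg) => //.
    by move=> k; exact: measurable_funB.
  move=> x Dx; rewrite -(subrr (f x)).
  by apply: cvgB; [exact: cvg_cst|exact: ff].
move=> /fine_cvgP[fin /cvgr0_norm_le/(_ _ e0) H].
have [k [kfin ke]] : exists k, I_ (fun x => f x - f_ k x)%R \is a fin_num /\
    `|fine (I_ (fun x => f x - f_ k x)%R)| <= e.
  by near \oo => k; exists k; split; near: k.
exists (f_ k); split => //.
rewrite -(fineK kfin) lee_fin.
by apply: le_trans ke; rewrite ler_norm.
Unshelve. all: by end_near. Qed.

Hypothesis indicS : forall A, measurable A -> approximable (\1_A).

Import HBNNSimple.

Let approximable_nnsfun (f : {nnsfun T >-> R}) : approximable f.
Proof.
set s := fset_set (f @` setT).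
have -> : (f : T -> R) = fun x => \sum_(i < #|`s|) (s`_i * \1_(f @^-1` [set s`_i]) x).
  by apply/funext => x; exact: fimfunEord.
elim: #|`s| => [|m IH].
  by apply: (@eq_approximable (cst 0)) => [x _|]; [rewrite big_ord0|exact: approximable_subset].
have mi i : measurable (f @^-1` [set s`_i]) by exact: measurable_sfunP.
apply: (@eq_approximable (fun x => s`_m * \1_(f @^-1` [set s`_m]) x +
    \sum_(i < m) (s`_i * \1_(f @^-1` [set s`_i]) x))).
  by move=> x _; rewrite big_ord_recr /= addrC.
apply: approximable_linear => //.
- apply: measurable_sum => i; apply: measurable_funM => //.
- exact: indicS.
Qed.

Let approximable_ge0 f : measurable_fun setT f -> (forall x, 0 <= f x) ->
  (I_ f < +oo)%E -> approximable f.
Proof.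
move=> mf f0 foo.
have mEf : measurable_fun setT (EFin \o f) by exact/measurable_EFinP.
pose f_ := nnsfun_approx measurableT mEf.
have f_le k x : f_ k x <= f x.
  rewrite -lee_fin /f_ nnsfun_approxE.
  by apply: (le_approx k (fun=> _)) => //= y _; rewrite lee_fin.
apply: (@approximable_dominated f_ f f) => //.
- by move=> k; exact: measurable_funTS.
- exact: measurable_funTS.
- exact: measurable_funTS.
- move=> x _.
  by have /(_ x I)/fine_cvgP[] := cvg_nnsfun_approx measurableT mEf (fun y _ => f0 y).
- by move=> k x _; rewrite ger0_norm ?subr_ge0// gerBl /f_.
Qed.

(** Indicators give simple functions by linearity, these give nonnegative functions by dominated
    convergence, and positive and negative parts give the rest. *)
Lemma approximable_finite f : measurable_fun setT f ->
  (I_ f < +oo)%E -> approximable f.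
Proof.
move=> mf foo.
apply: (@eq_approximable (fun x => -1 * Num.max (- f x) 0 + Num.max (f x) 0)).
  by move=> x _; rewrite mulN1r /Num.max; do 2 case: ifP => ?; lra.
have mN : measurable_fun setT (fun x => Num.max (- f x) 0).
  by apply: measurable_maxr => //; exact: measurable_funN.
have mP : measurable_fun setT (fun x => Num.max (f x) 0).
  exact: measurable_maxr.
apply: approximable_linear; [exact: measurable_funTS..| |].
- apply: approximable_ge0 => // [x|]; first by rewrite le_max lexx orbT.
  apply: le_lt_trans foo; apply: abs_pow_int_le => //; [exact: measurable_funTS..|].
  by move=> x _; rewrite /Num.max; case: ifP; rewrite ?normrN ?normr0.
- apply: approximable_ge0 => // [x|]; first by rewrite le_max lexx orbT.
  apply: le_lt_trans foo; apply: abs_pow_int_le => //; [exact: measurable_funTS..|].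
  by move=> x _; rewrite /Num.max; case: ifP; rewrite ?normr0.
Qed.

End approximation_in_mean.

(** * Density of test functions in L^q of a ball *)

Section bumps.
Context {R : realType}.

(** The constant -1 confines the support to the closed set where K(t - a)(b - t) >= 1, which lies
    inside the open interval. As K grows the bump tends to the indicator of ]a, b[. *)
Definition bump (K : nat) (a b t : R) : R :=
  bump_fun (K%:R *: (('X - a%:P) * (b%:P - 'X)) - 1) 1 0 t.

Lemma bumpE K a b t : bump K a b t = flat 0 (K%:R * ((t - a) * (b - t)) - 1).
Proof.
rewrite /bump /bump_fun !(hornerD, hornerM, hornerZ, hornerN, hornerC, hornerX).
by rewrite mul1r.
Qed.

Lemma flat0_le1 (s : R) : flat 0 s <= 1.
Proof.
rewrite /flat; case: ifPn => // s0.
by rewrite expr0 mul1r -expR0 ler_expR oppr_le0 invr_ge0 ltW.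
Qed.

Lemma bump_ge0 K a b t : 0 <= bump K a b t.
Proof. by rewrite bumpE flat_ge0. Qed.

Lemma bump_le1 K a b t : bump K a b t <= 1.
Proof. by rewrite bumpE flat0_le1. Qed.

Lemma bump_neq0 K a b t : a < b -> bump K a b t != 0 ->
  1 <= K%:R * ((t - a) * (b - t)).
Proof.
rewrite bumpE /flat; case: ifPn => [|_]; last by rewrite eqxx.
by rewrite subr_gt0 => /ltW.
Qed.

Lemma in_itv_of_mul_gt0 (a b t K : R) : a < b -> 0 <= K ->
  0 < K * ((t - a) * (b - t)) -> t \in `]a, b[.
Proof.
move=> ab K0 h; rewrite in_itv/=.
have {h} h : 0 < (t - a) * (b - t) by rewrite ltNge; apply: contraTN h => h; rewrite -leNgt; nra.
by apply/andP; split; rewrite ltNge; apply: contraTN h => h; rewrite -leNgt; nra.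
Qed.

Lemma cvg_bump (a b t : R) : a < b ->
  bump K a b t @[K --> \oo] --> (\1_(`]a, b[%classic) t : R).
Proof.
move=> ab; rewrite indicE.
have [tab|tab] := boolP (t \in _); last first.
  rewrite (_ : (fun K => _) = cst 0); first exact: cvg_cst.
  apply/funext => K; apply/eqP; apply: contraNT tab => /(bump_neq0 ab) h.
  rewrite inE/=; apply: (@in_itv_of_mul_gt0 _ _ _ K%:R) => //.
  exact: lt_le_trans h.
move: tab; rewrite inE/= in_itv/= => /andP[at_ tb].
set c := (t - a) * (b - t).
have c0 : 0 < c by rewrite mulr_gt0 // subr_gt0.
have E : \forall K \near \oo, expR (- (K%:R * c - 1)^-1) = bump K a b t.
  near=> K; rewrite bumpE /flat -/c ifT ?expr0 ?mul1r//.
  rewrite subr_gt0 -ltr_pdivrMr// mul1r.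
  by near: K; exact: nbhs_infty_gtr.
apply: cvg_trans (near_eq_cvg E) _.
suff H : expR (- (K%:R * c - 1)^-1) @[K --> \oo] --> expR (- 0 : R).
  by move: H; rewrite oppr0 expR0.
suff H0 : (fun K : nat => - (K%:R * c - 1)^-1) @ \oo --> (- 0 : R).
  exact: (cvg_comp _ _ H0 (@continuous_expR R _)).
apply: cvgN.
apply/cvgr0Pnorm_le => e e0; near=> K.
have h : e^-1 <= K%:R * c - 1.
  rewrite lerBrDr -ler_pdivrMr//; apply: ltW.
  by near: K; exact: nbhs_infty_gtr.
have h0 : 0 < K%:R * c - 1 by apply: lt_le_trans h; rewrite invr_gt0.
by rewrite gtr0_norm ?invr_gt0// invf_ple ?posrE.
Unshelve. all: by end_near. Qed.

End bumps.

Section density.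
Context {R : realType} {n : nat}.
Local Notation V := 'rV[R]_n.
Local Notation L := (lebesgue_space R n).
Local Notation mu := (@lebesgue_rV R n).
Local Notation T := (measurableTypeR R).

Definition box (a b : 'I_n -> R) : set V :=
  [set x | forall i, `]a i, b i[%classic (x 0 i)].

Lemma test_function_bump (K : nat) (a b : 'I_n -> R) : (forall i, a i < b i) ->
  test_function (box a b) (fun x => \prod_i bump K (a i) (b i) (x 0 i)).
Proof.
move=> ab.
pose C : set V := [set x | forall i, 1 <= K%:R * ((x 0 i - a i) * (b i - x 0 i))].
have C_box : C `<=` box a b.
  move=> x Cx i /=; apply: (@in_itv_of_mul_gt0 _ _ _ _ K%:R) => //.
  by apply: lt_le_trans (Cx i).
have cC : closed C.
  rewrite (_ : C = \bigcap_(i in setT)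
     ((fun x : V => K%:R * ((x 0 i - a i) * (b i - x 0 i))) @^-1` [set y | 1 <= y])).
    apply: closed_bigI => i _.
    pose P := K%:R *: (('X - (a i)%:P) * ((b i)%:P - 'X)).
    have -> : (fun x : V => K%:R * ((x 0 i - a i) * (b i - x 0 i))) =
        horner P \o (fun x : V => x 0 i).
      by apply/funext => x /=; rewrite !(hornerZ, hornerM, hornerD, hornerN, hornerC, hornerX).
    apply: (continuous_closedP _).1; last exact: closed_ge.
    move=> x.
    exact: (@continuous_comp V R R _ _ x (@coord_continuous _ _ _ _ _ x) (@continuous_horner _ P _)).
  by apply/seteqP; split => [x Cx i _|x Cx i]; [exact: Cx|exact: (Cx i I)].
have sC : closure [set x : V | \prod_i bump K (a i) (b i) (x 0 i) != 0] `<=` C.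
  have <- : closure C = C by rewrite -(closure_id C).1.
  apply: closure_subset => x /= xN0 i.
  by apply: bump_neq0 => //; apply: contraNN xN0 => /eqP h; rewrite (bigD1 i)//= h mul0r.
split.
- exact: smooth_tensor.
- apply: (@subclosed_compact _ _ [set x : V | forall i, `[a i, b i]%classic (x 0 i)]).
  + exact: closed_closure.
  + by apply: (@rV_compact R n (fun i => `[a i, b i]%classic)) => i; exact: segment_compact.
  + by move=> x /sC/C_box h i; have := h i; exact: subset_itv_oo_cc.
- exact: subset_trans C_box.
Qed.

Lemma test_function_linear (Omega : set V) (a : R) (phi psi : V -> R) :
  test_function Omega phi -> test_function Omega psi ->
  test_function Omega (fun x => a * phi x + psi x).
Proof.
move=> [s1 c1 o1] [s2 c2 o2].
have H : closure [set x | a * phi x + psi x != 0] `<=`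
    closure [set x | phi x != 0] `|` closure [set x | psi x != 0].
  rewrite -closureU; apply: closure_subset => x /=.
  have [-> h|] := eqVneq (phi x) 0; last by left.
  by right; apply: contraNN h => /eqP ->; rewrite mulr0 addr0.
split; first exact: smooth_linear.
- by apply: subclosed_compact H; [exact: closed_closure|exact: compactU].
- by move=> x /H[/o1|/o2].
Qed.

Lemma test_function0 (Omega : set V) : test_function Omega (cst 0).
Proof.
have E : [set x : V | (cst 0 x : R) != 0] = set0.
  by apply/seteqP; split => x //=; rewrite eqxx.
split; rewrite ?E ?closure0; [|exact: compact0|by []].
apply: (@smooth_class _ _ [set f | f = cst 0]) => // _ ->; split.
  by move=> x; exact: (@cst_continuous V R 0 x).
move=> j; split => [x|]; first exact: derivable_cst.
by apply/funext => x; rewrite /partial derive_cst.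
Qed.

Lemma test_function_subset (O O' : set V) phi : O `<=` O' ->
  test_function O phi -> test_function O' phi.
Proof. by move=> OO' [? ? ?]; split => //; exact: subset_trans OO'. Qed.

Lemma test_function_measurable (O : set V) phi (D : set L) : test_function O phi ->
  measurable_fun D (phi : L -> R).
Proof.
move=> [s _ _]; apply: measurable_funTS; apply: continuous_measurable_rV => x.
exact: (@smooth_continuous _ _ phi s x).
Qed.

End density.

Section density_theorem.
Context {R : realType} {n : nat}.
Local Notation V := 'rV[R]_n.
Local Notation L := (lebesgue_space R n).
Local Notation mu := (@lebesgue_rV R n).
Local Notation T := (measurableTypeR R).
Variables (q : nat) (c : V) (r : R).
Hypotheses (q0 : (0 < q)%N) (r0 : 0 < r).
Local Notation B := (ball c r).
Local Notation apx := (@approximable _ L R mu q B (test_function B)).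

Let eqapx (f g : V -> R) : (forall x, B x -> f x = g x) -> apx f -> apx g.
Proof. exact: (@eq_approximable _ L R mu q B (test_function B) f g). Qed.

Let eq_indic_at (A A' : set V) (x : V) : (A x <-> A' x) -> \1_A x = \1_A' x :> R.
Proof.
move=> AA'; rewrite !indicE; have [Ax|Ax] := pselect (A x).
  by rewrite !mem_set//; exact/AA'.
by rewrite !memNset// => /AA'.
Qed.

Let mB : measurable (B : set L).
Proof. by apply: open_measurable_rV; exact: ball_open. Qed.

Let muB : (mu B < +oo)%E.
Proof. by rewrite lebesgue_rV_ball// ltry. Qed.

Let mS f : test_function B f -> measurable_fun (B : set L) (f : L -> R).
Proof. exact: test_function_measurable. Qed.

Let S0 : test_function B (cst 0 : V -> R). Proof. exact: test_function0. Qed.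

Let Slin a f g : test_function B f -> test_function B g ->
  test_function B (fun x => a * f x + g x).
Proof. exact: test_function_linear. Qed.

Let Icst1 : (abs_pow_int mu q B (cst 1%R) < +oo)%E.
Proof.
rewrite /abs_pow_int (eq_integral (cst 1%E)) => [|x _]; last by rewrite /= normr1 expr1n.
by rewrite integral_cst// mul1e.
Qed.

Let measurable_box_rV (a b : 'I_n -> R) : measurable (box a b : set L).
Proof.
apply: measurable_row_preimage.
by apply: (@measurable_box R n (fun i => `]a i, b i[%classic)) => i; exact: measurable_itv.
Qed.

Let box_inside (a b : 'I_n -> R) : (forall i, a i < b i) ->
  box a b `<=` B -> apx \1_(box a b).
Proof.
move=> ab abB.
apply: (@approximable_dominated _ L R mu q B (test_function B) q0 mB mS
  (fun K (x : V) => \prod_i bump K (a i) (b i) (x 0 i)) _ (cst 1)).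
- move=> K; apply: approximable_subset => //.
  by apply: test_function_subset abB _; exact: test_function_bump.
- by move=> K; apply: mS; apply: test_function_subset abB _; exact: test_function_bump.
- by apply: measurable_funTS; apply: measurable_indic; exact: measurable_box_rV.
- exact: measurable_cst.
- move=> x _.
  have -> : (\1_(box a b) x : R) = \prod_i (\1_(`]a i, b i[%classic) (x 0 i)).
    rewrite indicE; have [xab|xab] := boolP (x \in _).
      rewrite big1// => i _; rewrite indicE mem_set//.
      by move: xab; rewrite inE; apply.
    apply/esym/eqP/prodf_eq0.
    have /existsNP[i h] : ~ box a b x by move=> h; rewrite mem_set in xab.
    by exists i => //; rewrite indicE memNset.
  rewrite (_ : (fun K => _) = \prod_i (fun K => bump K (a i) (b i) (x 0 i))); last first.
    by apply/funext => K; rewrite fct_prodE.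
  apply: (big_ind2 (fun (f : nat -> R) l => f @ \oo --> l)) => [|f1 l1 f2 l2 h1 h2|i _].
  + exact: cvg_cst.
  + exact: cvgM.
  + exact: cvg_bump.
- move=> K x _ /=.
  have p0 : 0 <= \prod_i bump K (a i) (b i) (x 0 i).
    by apply: prodr_ge0 => i _; exact: bump_ge0.
  have p1 : \prod_i bump K (a i) (b i) (x 0 i) <= 1.
    by apply: prodr_ile1 => i _; rewrite bump_ge0 bump_le1.
  have i0 : 0 <= (\1_(box a b) x : R) by [].
  have i1 : (\1_(box a b) x : R) <= 1 by rewrite indicE; case: (_ \in _).
  by rewrite ler_norml; apply/andP; split; lra.
- exact: Icst1.
Qed.

(** A ball of the sup norm is a box, so intersecting with it gives a box inside the ball or an empty
    one, without changing the indicator on the ball. *)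
Let box_any (a b : 'I_n -> R) : apx \1_(box a b).
Proof.
pose a' i := Num.max (a i) (c 0 i - r); pose b' i := Num.min (b i) (c 0 i + r).
have E x : B x -> box a b x <-> box a' b' x.
  move=> /(rV_ballE _ _ r0) h; split=> [h' i|h' i].
    have := h i; have := h' i; rewrite /= !in_itv/= gt_max lt_min.
    by move=> /andP[-> ->] /andP[-> ->].
  by have := h' i; rewrite /= !in_itv/= gt_max lt_min => /andP[/andP[-> _] /andP[-> _]].
have [ab|/existsNP[i /negP]] := pselect (forall i, a' i < b' i).
  apply: (@eqapx \1_(box a' b')).
    by move=> x Bx; apply: eq_indic_at; have [] := E x Bx.
  apply: box_inside => // x h; apply/(rV_ballE _ _ r0) => i.
  by have := h i; rewrite /= !in_itv/= gt_max lt_min => /andP[/andP[_ ->] /andP[_ ->]].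
rewrite -leNgt => ba.
apply: (@eqapx (cst 0)).
  move=> x Bx; rewrite indicE memNset// => /(E x Bx)/(_ i); rewrite /= in_itv/=.
  by move=> /andP[h1 h2]; have := lt_trans h1 h2; rewrite ltNge ba.
exact: approximable_subset.
Qed.

Let tbox (ab : ('I_n -> R) * ('I_n -> R)) : set (n.-tuple T) :=
  [set t | forall i, `]ab.1 i, ab.2 i[%classic (tnth t i)].

Let tboxes := range tbox.

Let tboxes_setI : setI_closed tboxes.
Proof.
move=> _ _ [[a b] _ <-] [[a' b'] _ <-].
exists (fun i => Num.max (a i) (a' i), fun i => Num.min (b i) (b' i)) => //.
apply/seteqP; split => t /=.
  move=> h; split=> i; have := h i; rewrite /= !in_itv/= gt_max lt_min;
  by move=> /andP[/andP[h1 h2] /andP[h3 h4]]; rewrite ?h1 ?h2 ?h3 ?h4.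
move=> [h h'] i; have := h i; have := h' i; rewrite /= !in_itv/= gt_max lt_min.
by move=> /andP[-> ->] /andP[-> ->].
Qed.

Let measurable_tboxes : @measurable _ (n.-tuple T) = <<s tboxes >>.
Proof.
apply/seteqP; split; last first.
  apply: smallest_sub; first exact: sigma_algebra_measurable.
  by move=> _ [[a b] _ <-]; apply: (@measurable_tuple_box R n (fun i => `]a i, b i[%classic)) => i; exact: measurable_itv.
apply: smallest_sub; first exact: smallest_sigma_algebra.
apply: (big_ind (fun X => X `<=` <<s tboxes >>)) => [//|X Y hX hY t [/hX|/hY]//|i _].
have mt : measurable_fun [set: g_sigma_algebraType tboxes]
    (fun t : n.-tuple T => tnth t i : T).
  apply: (measurability _ (RGenOInfty.measurableE R)) => //.
  move=> _ [_ [a ->] <-]; rewrite setTI.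
  (* A half-space {t_i > a} is exhausted by boxes whose sides are ]-k, k[ except for the lower end a
     in coordinate i. *)
  rewrite (_ : _ @^-1` _ = \bigcup_k tbox
     (fun j => if j == i then a else - k%:R, fun j => k%:R)).
    by apply: bigcupT_measurable => k; apply: sub_sigma_algebra; eexists.
  apply/seteqP; split => [t|t [k _ /(_ i)]]; rewrite /= in_itv/=; last first.
    by rewrite eqxx in_itv/= => /andP[->].
  rewrite andbT => ati.
  pose M := \sum_j `|tnth t j : R|.
  exists (Num.trunc M).+1 => // j /=; rewrite in_itv/=.
  have : `|tnth t j : R| < (Num.trunc M).+1%:R.
    apply: le_lt_trans (truncnS_gt M).
    by rewrite /M (bigD1 j)//= lerDl sumr_ge0.
  rewrite ltr_norml => /andP[h1 h2]; rewrite h2 andbT.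
  by case: eqP => [->|].
by move=> _ [A mA <-]; exact: mt.
Qed.

(** Open boxes form a pi-system generating the Borel sets. The approximable sets are stable under
    complements by linearity and under countable disjoint unions by dominated convergence, so
    Dynkin's theorem applies. *)
Let apx_borel (S : set (n.-tuple T)) : measurable S ->
  apx \1_(tuple_of_row @^-1` S).
Proof.
have mpre (S' : set (n.-tuple T)) : measurable S' -> measurable (tuple_of_row @^-1` S' : set L).
  move=> mS'; apply: measurable_row_preimage.
  by rewrite -comp_preimage (_ : _ \o _ = id)//; apply/funext => t /=; rewrite row_of_tupleK.
have mind (S' : set (n.-tuple T)) : measurable S' ->
    measurable_fun (B : set L) (\1_(tuple_of_row @^-1` S') : L -> R).
  by move=> mS'; apply: measurable_funTS; apply: measurable_indic; exact: mpre.
have P1 : apx (cst 1).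
  apply: (@eqapx \1_(box (fun i => c 0 i - r) (fun i => c 0 i + r))).
    by move=> x Bx; rewrite indicE mem_set// => i; have /(rV_ballE _ _ r0) := Bx; apply.
  exact: box_any.
rewrite [in X in X -> _]measurable_tboxes => sS.
apply: (dynkin_induction (P := fun S => apx \1_(tuple_of_row @^-1` S))
  measurable_tboxes tboxes_setI _ _ _ _ sS).
- by apply: eq_approximable P1 => x _; rewrite preimage_setT indicT.
- move=> _ [[a b] _ <-]; apply: (@eqapx \1_(box a b)).
    by move=> x _; apply: eq_indic_at; split=> h i; have := h i; rewrite /= tnth_mktuple.
  exact: box_any.
- move=> A mA PA.
  apply: (@eqapx (fun x => -1 * \1_(tuple_of_row @^-1` A) x + cst 1 x)).
    move=> x _; rewrite preimage_setC !indicE in_setC /=; case: (_ \in _) => /=; ring.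
  apply: approximable_linear => //; exact: mind.
- move=> F mF tF PF.
  pose G k := \big[setU/set0]_(i < k) F i.
  have mG k : measurable (G k) by apply: bigsetU_measurable.
  have PG k : apx \1_(tuple_of_row @^-1` (G k)).
    elim: k => [|k IH].
      apply: (@eqapx (cst 0)); last exact: approximable_subset.
      by move=> x _; rewrite /G big_ord0 preimage_set0 indic0.
    apply: (@eqapx
      (fun x => 1 * \1_(tuple_of_row @^-1` (G k)) x + \1_(tuple_of_row @^-1` (F k)) x)).
      move=> x _; rewrite /G big_ord_recr/= preimage_setU mul1r.
      have GF : ~ (G k (tuple_of_row x) /\ F k (tuple_of_row x)).
        rewrite /G -bigcup_mkord => -[[i /= ik Fi] Fk].
        have /trivIsetP/(_ i k I I) := tF.
        rewrite ltn_eqF// => /(_ isT) h.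
        by have : (F i `&` F k) (tuple_of_row x) by []; rewrite h.
      rewrite !indicE in_setU.
      have [Gx|Gx] := pselect (G k (tuple_of_row x)).
        by rewrite (mem_set (A := tuple_of_row @^-1` G k) Gx) memNset ?addr0// => Fx; apply: GF.
      by rewrite (memNset (A := tuple_of_row @^-1` G k) Gx) add0r.
    apply: approximable_linear => //; exact: mind.
  have mU : measurable (\bigcup_k F k) by exact: bigcupT_measurable.
  apply: (@approximable_dominated _ L R mu q B (test_function B) q0 mB mS
    (fun k => \1_(tuple_of_row @^-1` (G k))) _ (cst 1)).
  + exact: PG.
  + by move=> k; exact: mind.
  + exact: mind.
  + exact: measurable_cst.
  + move=> x _; set t := tuple_of_row x.
    have [[k _ Fk]|h] := pselect ((\bigcup_k F k) t).
      have E : \forall j \near \oo, (1 : R) = \1_(tuple_of_row @^-1` (G j)) x.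
        near=> j; rewrite indicE mem_set//= /G -bigcup_mkord.
        by exists k => //=; near: j; exact: nbhs_infty_gt.
      apply: cvg_trans (near_eq_cvg E) _.
      by rewrite indicE mem_set; [exact: cvg_cst|exists k].
    rewrite (_ : (fun j => _) = cst 0); last first.
      apply/funext => j; rewrite indicE memNset//= /G -bigcup_mkord => -[k _ Fk].
      by apply: h; exists k.
    by rewrite indicE memNset//; exact: cvg_cst.
  + move=> k x _; rewrite !indicE.
    by case: (_ \in _); case: (_ \in _); rewrite ?subrr ?subr0 ?sub0r ?normrN ?normr1 ?normr0.
  + exact: Icst1.
Unshelve. all: by end_near. Qed.

(** By the definition of the outer measure, the part of A in the ball has a Borel superset of
    measure larger by at most e; inside the ball the two indicators differ only on this excess. *)
Let apx_indic (A : set L) : measurable A -> apx \1_A.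
Proof.
move=> mA; apply: (@approximable_limit _ L R mu q B (test_function B) mB mS).
  by apply: measurable_funTS; exact: measurable_indic.
move=> e e0.
pose X : set L := A `&` B.
have mX : measurable X by exact: measurableI.
have Xoo : (mu X < +oo)%E.
  by apply: le_lt_trans muB; apply: le_measure; rewrite ?inE//; exact: subIsetr.
have Xfin : mu X \is a fin_num by rewrite ge0_fin_numE.
have [_ [F [mF XF] <-] Fe] := lb_ereal_inf_adherent e0 Xfin.
pose S := \bigcup_k F k.
have mS' : measurable S by exact: bigcupT_measurable.
pose A' : set L := tuple_of_row @^-1` S.
have SA' : @row_of_tuple R n @^-1` A' = S.
  by rewrite -comp_preimage (_ : _ \o _ = id)//; apply/funext => t /=; rewrite row_of_tupleK.
have mA' : measurable A' by apply: measurable_row_preimage; rewrite SA'.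
have XA' : X `<=` A'.
  move=> x Xx; rewrite /A' /=; apply: XF => /=.
  by rewrite tuple_of_rowK.
have A'le : (mu A' <= mu X + e%:E)%E.
  apply: (@le_trans _ _ (\sum_(k <oo) tuple_lebesgue R n (F k))%E).
    rewrite lebesgue_rVE SA'//.
    exact: measure_sigma_subadditive.
  exact: ltW.
exists \1_A'; split.
- by apply: measurable_funTS; exact: measurable_indic.
- exact: apx_borel.
- have -> : abs_pow_int mu q B (fun x => \1_A x - \1_A' x)%R =
     (\int[mu]_(x in B) (\1_(A' `\` X) x)%:E)%E.
    apply: eq_integral => x /set_mem Bx; congr EFin.
    have qq : (0 ^+ q = 0 :> R)%R by rewrite expr0n eqn0Ngt q0.
    have [Ax|Ax] := pselect (A x).
      have A'x : A' x by apply: XA'.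
      rewrite !indicE (mem_set Ax) (mem_set A'x) subrr normr0 qq memNset//.
      by move=> -[_]; apply.
    rewrite (_ : \1_(A' `\` X) x = \1_A' x).
      rewrite !indicE (memNset Ax) sub0r normrN.
      by case: (_ \in _); rewrite ?normr1 ?expr1n ?normr0 ?qq.
    by apply: eq_indic_at; split => [[]//|A'x]; split => // -[].
  rewrite integral_indic//; last exact: measurableD.
  apply: (@le_trans _ _ (mu (A' `\` X))).
    by apply: le_measure; rewrite ?inE//; [apply: measurableI => //; exact: measurableD|exact: measurableD].
  have A'oo : (mu A' < +oo)%E by apply: le_lt_trans A'le _; rewrite lte_add_pinfty// ltry.
  rewrite measureD// (_ : A' `&` X = X); last by apply/setIidPr.
  by rewrite leeBlDr// addeC.
Qed.

Lemma approximable_test_function (f : V -> R) : measurable_fun [set: L] f ->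
  (abs_pow_int mu q B f < +oo)%E -> apx f.
Proof.
exact: (@approximable_finite _ L R mu q B (test_function B) q0 mB mS S0 Slin apx_indic).
Qed.

End density_theorem.

(** * Continuity of translations in L^q *)

Lemma abs_pow_int_support d (T : measurableType d) (R : realType)
    (mu : {measure set T -> \bar R}) q (D : set T) (f : T -> R) : (0 < q)%N ->
  (forall x, ~ D x -> f x = 0) ->
  abs_pow_int mu q setT f = abs_pow_int mu q D f.
Proof.
move=> q0 f0; rewrite /abs_pow_int [RHS]integral_mkcond.
apply: eq_integral => x _; rewrite /patch.
have [//|/negP xD] := boolP (x \in D).
by rewrite f0 ?normr0 ?expr0n ?eqn0Ngt ?q0// => Dx; apply: xD; rewrite inE.
Qed.

Section translations.
Context {R : realType} {n : nat}.
Local Notation V := 'rV[R]_n.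
Local Notation L := (lebesgue_space R n).
Local Notation mu := (@lebesgue_rV R n).

Lemma abs_pow_int_support_rV q (B : set V) (f : V -> R) : (0 < q)%N ->
  (forall x, ~ B x -> f x = 0) ->
  abs_pow_int mu q setT f = abs_pow_int mu q B f.
Proof. by move=> q0 f0; exact: (@abs_pow_int_support _ L R mu q B f q0 f0). Qed.

Lemma measurable_translate (v : V) (f : V -> R) : measurable_fun [set: L] (f : L -> R) ->
  measurable_fun [set: L] ((fun x => f (x + v)) : L -> R).
Proof. by move=> mf; exact: (measurableT_comp (T2 := L) mf (measurable_shift v)). Qed.

Lemma abs_pow_int_translate q (v : V) (f : V -> R) :
  measurable_fun [set: L] (f : L -> R) ->
  abs_pow_int mu q setT (fun x => f (x + v)) = abs_pow_int mu q setT f.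
Proof.
move=> mf; apply: (@ge0_integral_shift R n v (fun x => (`|f x| ^+ q)%:E)).
  exact: measurable_abs_pow.
by move=> x; rewrite lee_fin exprn_ge0.
Qed.

(** Uniform continuity on a compact box containing [ball c (r + 1)]. From a point outside this box,
    a shift shorter than 1 cannot reach the support. *)
Lemma uniform_translate (g : V -> R) (c : V) (r : R) : 0 < r ->
  continuous g -> (forall x, ~ ball c r x -> g x = 0) ->
  forall e : R, 0 < e -> exists2 d : R, 0 < d &
    forall v x, `|v| < d -> `|g (x + v) - g x| < e.
Proof.
move=> r0 cg g0 e e0.
pose K : set V := [set x | forall i, `[c 0 i - (r + 1), c 0 i + (r + 1)]%classic (x 0 i)].
have cK : compact K.
  apply: (@rV_compact R n (fun i => `[c 0 i - (r + 1), c 0 i + (r + 1)]%classic)) => i.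
  exact: segment_compact.
have BK : ball c (r + 1) `<=` K.
  move=> x /rV_ballE h i; rewrite /=; apply: subset_itv_oo_cc; apply: h.
  by rewrite addr_gt0.
have H : \forall v \near nbhs (0 : V), K `<=` (fun x => `|g (x + v) - g x| < e).
  apply: ((compact_near_coveringP K).1 cK _ (nbhs (0 : V)) (fun v x => `|g (x + v) - g x| < e)).
  move=> x Kx.
  have e20 : 0 < e / 2 by rewrite divr_gt0.
  have /cvgrPdist_lt/(_ _ e20) := cg x.
  move=> /nbhs_ballP[d /= d0 hd].
  exists (ball x (d / 2), ball (0 : V) (d / 2)).
    by split; apply: nbhsx_ballx; rewrite divr_gt0.
  move=> [y v] /= [xy]; rewrite -ball_normE/= sub0r normrN => vd.
  have h1 : `|g x - g y| < e / 2.
    by apply: hd; apply: le_ball xy; rewrite ler_pdivrMr// ler_pMr// ler1n.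
  have h2 : `|g x - g (y + v)| < e / 2.
    apply: hd; move: xy; rewrite -!ball_normE/= => xy.
    rewrite opprD addrA [d]splitr (le_lt_trans (ler_normB _ _))// ltrD//.
  rewrite [e]splitr -(subrKA (g x)) (le_lt_trans (ler_normD _ _))//.
  by rewrite ltrD// distrC.
have /nbhs_ballP[d /= d0 hd] := H.
exists (Num.min d 1); first by rewrite lt_min d0/=.
move=> v x; rewrite lt_min => /andP[vd v1].
have [Kx|nKx] := pselect (K x).
  by apply: hd => //; rewrite -ball_normE/= sub0r normrN.
have nB1 : ~ ball c (r + 1) x by move/BK.
rewrite !g0 ?subrr ?normr0//.
  by apply: contra_not nB1; apply: le_ball; rewrite lerDl.
apply: contra_not nB1; rewrite -!ball_normE/= => h.
have -> : c - x = c - (x + v) + v by rewrite opprD addrA subrK.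
by rewrite (le_lt_trans (ler_normD _ _))// ltrD.
Qed.

(** G is replaced by a nearby test function, for which translation is uniformly small on a ball of
    fixed radius; the replacement error is translation invariant. *)
Lemma translation_continuity q (c : V) (r : R) (G : V -> R) : (0 < q)%N -> 0 < r ->
  measurable_fun [set: L] (G : L -> R) -> (forall x, ~ ball c r x -> G x = 0) ->
  (abs_pow_int mu q setT G < +oo)%E ->
  forall e : R, 0 < e -> exists2 d : R, 0 < d & forall v, `|v| < d ->
    (abs_pow_int mu q setT (fun x => G (x + v) - G x)%R <= e%:E)%E.
Proof.
move=> q0 r0 mG G0 Goo e e0.
(* Three errors of size [e1] are combined by two uses of [abs_pow_intD], which gives 2^q (e1 + 2^q
   (e1 + e1)) <= e. *)
pose e1 := e / (2 ^+ q * 2 ^+ q * 3).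
have P0 : 0 < 2 ^+ q * 2 ^+ q * 3 :> R by rewrite !mulr_gt0 ?exprn_gt0.
have e10 : 0 < e1 by rewrite divr_gt0.
have mB : measurable (ball c r : set L).
  by apply: open_measurable_rV; exact: ball_open.
have GB : (abs_pow_int mu q (ball c r) G < +oo)%E.
  by rewrite -(abs_pow_int_support_rV q0 G0).
have [phi tphi Iphi] := approximable_test_function q0 r0 mG GB e10.
have phi0 x : ~ ball c r x -> phi x = 0.
  move=> nB; apply/eqP/negPn/negP => h; apply: nB.
  by have [_ _] := tphi; apply; apply: subset_closure.
have mphi := test_function_measurable (D := [set: L]) tphi.
have cphi : continuous phi.
  by have [sphi _ _] := tphi; move=> x; exact: (@smooth_continuous _ _ phi sphi x).
have r10 : 0 < r + 1 by rewrite addr_gt0.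
pose M := (2 * (r + 1)) ^+ n.
have M0 : 0 < M by rewrite exprn_gt0// mulr_gt0.
(* With h <= 1 the q-th power of the increment is at most the increment, and e1 / M integrates to
   [e1] over a ball of measure M. *)
pose h := Num.min 1 (e1 / M).
have h0 : 0 < h by rewrite lt_min ltr01 divr_gt0.
have [d d0 hd] := uniform_translate r0 cphi phi0 h0.
exists (Num.min d 1); first by rewrite lt_min d0/=.
move=> v; rewrite lt_min => /andP[vd v1].
have mGp : measurable_fun [set: L] ((fun x => G x - phi x) : L -> R).
  exact: measurable_funB.
have I1 : (abs_pow_int mu q setT (fun x => G (x + v) - phi (x + v))%R <= e1%:E)%E.
  rewrite (abs_pow_int_translate q v (f := fun x => G x - phi x))//.
  rewrite (@abs_pow_int_support_rV q (ball c r))// => x nB.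
  by rewrite G0// phi0// subrr.
have I2 : (abs_pow_int mu q setT (fun x => phi x - G x)%R <= e1%:E)%E.
  rewrite (@eq_abs_pow_int _ L R mu q setT _ (fun x => G x - phi x)) => [|x _]; last exact: distrC.
  rewrite (@abs_pow_int_support_rV q (ball c r))// => x nB.
  by rewrite G0// phi0// subrr.
have mpv := measurable_translate v mphi.
have I3 : (abs_pow_int mu q setT (fun x => phi (x + v) - phi x)%R <= e1%:E)%E.
  rewrite (@abs_pow_int_support_rV q (ball c (r + 1)))//; last first.
    move=> x nB; rewrite !phi0 ?subrr//.
      by apply: contra_not nB; apply: le_ball; rewrite lerDl.
    apply: contra_not nB; rewrite -!ball_normE/= => h'.
    have -> : c - x = c - (x + v) + v by rewrite opprD addrA subrK.
    by rewrite (le_lt_trans (ler_normD _ _))// ltrD.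
  have mB1 : measurable (ball c (r + 1) : set L).
    by apply: open_measurable_rV; exact: ball_open.
  apply: (@le_trans _ _ (\int[mu]_(x in ball c (r + 1)) (cst (e1 / M)%:E x))%E).
    apply: ge0_le_integral.
    - exact: mB1.
    - by move=> x _; rewrite lee_fin exprn_ge0.
    - apply: measurable_abs_pow; apply: measurable_funTS; exact: measurable_funB.
    - exact: measurable_cst.
    - move=> x _; rewrite lee_fin.
      have := hd v x vd; rewrite lt_min => /andP[/ltW a1 /ltW a2].
      apply: le_trans a2; case: q q0 {e1 P0 e10 Iphi h h0 hd I1 I2 Goo GB} a1 => // k _ a1.
      by rewrite exprS ler_piMr// exprn_ile1.
  rewrite integral_cst//= lebesgue_rV_ball// -EFinM lee_fin.
  by rewrite -/M divfK// gt_eqF.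
rewrite (@eq_abs_pow_int _ L R mu q setT _ (fun x => (G (x + v) - phi (x + v)) +
   ((phi (x + v) - phi x) + (phi x - G x)))); last by move=> x _; congr Num.norm; ring.
have mGpv : measurable_fun [set: L] ((fun x => G (x + v) - phi (x + v)) : L -> R).
  exact: (measurable_translate v mGp).
have mpp : measurable_fun [set: L] ((fun x => phi (x + v) - phi x) : L -> R).
  exact: measurable_funB.
have mpG : measurable_fun [set: L] ((fun x => phi x - G x) : L -> R).
  exact: measurable_funB.
apply: le_trans.
  exact: (@abs_pow_intD _ _ _ mu q setT _ _ measurableT mGpv (measurable_funD mpp mpG)).
have I4 : (abs_pow_int mu q setT
    (fun x => (phi (x + v) - phi x) + (phi x - G x))%R <= (2 ^+ q)%:E * (e1%:E + e1%:E))%E.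
  apply: le_trans.
    exact: (@abs_pow_intD _ _ _ mu q setT _ _ measurableT mpp mpG).
  by apply: lee_wpmul2l; [rewrite lee_fin exprn_ge0|exact: leeD].
apply: (@le_trans _ _ ((2 ^+ q)%:E * (e1%:E + (2 ^+ q)%:E * (e1%:E + e1%:E)))%E).
  by apply: lee_wpmul2l; [rewrite lee_fin exprn_ge0|exact: leeD].
rewrite -!EFinD -!EFinM lee_fin.
have p1 : 1 <= 2 ^+ q :> R by rewrite exprn_ege1// ler1n.
have -> : e = e1 * (2 ^+ q * 2 ^+ q * 3) by rewrite divfK ?gt_eqF.
move: (2 ^+ q) p1 e1 e10 {P0 Iphi h h0 hd I1 I2 I3 I4} => t t1 e1 e10.
have : 0 <= t * e1 * (t - 1) by rewrite !mulr_ge0 ?subr_ge0// ltW// (lt_le_trans ltr01).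
rewrite -subr_ge0 => h; rewrite -subr_ge0; apply: le_trans h _; rewrite -subr_ge0.
by rewrite (_ : _ - _ = 0)//; ring.
Qed.

End translations.

(** * Test functions, weak derivatives and increments *)

Section difference_quotients.
Context {R : realType} {n : nat}.
Local Notation V := 'rV[R]_n.
Local Notation L := (lebesgue_space R n).
Local Notation mu := (@lebesgue_rV R n).

Lemma test_function_out (O : set V) phi x : test_function O phi -> ~ O x -> phi x = 0.
Proof.
move=> [_ _ h] Ox; apply/eqP/negPn/negP => hx; apply: Ox.
by apply: h; apply: subset_closure.
Qed.

Lemma test_function_continuous (O : set V) phi : test_function O phi -> continuous phi.
Proof. by move=> [sphi _ _] x; exact: (@smooth_continuous _ _ phi sphi x). Qed.

Lemma test_function_partial (O : set V) phi j : test_function O phi ->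
  test_function O (partial j phi).
Proof.
move=> [sphi cphi ophi].
have sub : closure [set x | partial j phi x != 0] `<=` closure [set x | phi x != 0].
  rewrite [X in _ `<=` X](closure_id _).1; last exact: closed_closure.
  apply: closure_subset => x /= hx; apply: contrapT => nx.
  have oC : open (~` closure [set x | phi x != 0]).
    by rewrite openC; exact: closed_closure.
  have near0 : \forall y \near x, cst 0 y = phi y.
    have := open_nbhs_nbhs (conj oC nx); apply: filterS => y hy /=.
    by apply/esym/eqP/negPn/negP => h; apply: hy; exact: subset_closure.
  by move: hx; rewrite /partial -(near_eq_derive _ near0) derive_cst eqxx.
split; first exact: smooth_partial.
  by apply: subclosed_compact sub => //; exact: closed_closure.
exact: subset_trans ophi.
Qed.

Lemma translation_continuous (w : V) : continuous (fun x : V => x + w).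
Proof.
move=> x.
exact: (@continuousD _ _ V id (cst w) x (@cvg_id _ _) (@cst_continuous _ _ w x)).
Qed.

Lemma test_function_translate (O O' : set V) phi (w : V) :
  (forall x, O (x + w) -> O' x) -> test_function O phi ->
  test_function O' (fun x => phi (x + w)).
Proof.
move=> OO' [sphi cphi ophi].
pose K := closure [set x | phi x != 0].
have sub : closure [set x | phi (x + w) != 0] `<=` (fun x => x + w) @^-1` K.
  have cl : closed ((fun x => x + w) @^-1` K).
    by apply: (continuous_closedP _).1 (@translation_continuous w) _ _; exact: closed_closure.
  rewrite [X in _ `<=` X](closure_id _).1//.
  by apply: closure_subset => x /= h; exact: subset_closure.
split; first exact: smooth_translate.
- apply: (@subclosed_compact _ _ ((fun x => x - w) @` K)).
  + exact: closed_closure.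
  + apply: continuous_compact => //; apply: continuous_subspaceT.
    exact: translation_continuous.
  + by move=> x /sub h; exists (x + w) => //; rewrite addrK.
- by move=> x /sub /ophi /OO'.
Qed.

Lemma is_derive_translate (phi : V -> R) (x e : V) (t : R) :
  derivable phi (x + t *: e) e ->
  is_derive t (1 : R) (fun t => phi (x + t *: e)) ('D_e phi (x + t *: e)).
Proof.
move=> d; apply: cvg_is_derive.
rewrite (_ : (fun h => _) =
  (fun h : R => h^-1 *: ((phi \o shift (x + t *: e)) (h *: e) - phi (x + t *: e)))).
  exact: d.
apply/funext => h /=; rewrite [h *: 1]mulr1 scalerDl addrCA.
by [].
Qed.

Lemma continuous_ball_bounded (g : V -> R) (c : V) (r : R) :
  continuous g -> exists2 M : R, 0 < M & forall x, ball c r x -> `|g x| <= M.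
Proof.
move=> cg.
pose K : set V := [set x | forall i, `[c 0 i - r, c 0 i + r]%classic (x 0 i)].
have cK : compact K.
  apply: (@rV_compact R n (fun i => `[c 0 i - r, c 0 i + r]%classic)) => i.
  exact: segment_compact.
have /compact_bounded[M [_ hM]] : compact (g @` K).
  by apply: continuous_compact => //; exact: continuous_subspaceT.
exists (Num.max 1 (M + 1)); first by rewrite lt_max ltr01.
move=> x [r0 h]; rewrite le_max (hM (M + 1)) ?orbT ?ltrDl//; exists x => // i /=.
have := h 0 i; rewrite /ball/= ltr_distlC => /andP[a b].
by rewrite in_itv/= !ltW.
Qed.

Lemma continuous_supp_bounded (g : V -> R) (c : V) (r : R) :
  continuous g -> (forall x, ~ ball c r x -> g x = 0) ->
  exists2 M : R, 0 < M & forall x, `|g x| <= M.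
Proof.
move=> /(continuous_ball_bounded c r)[M M0 gM] g0; exists M => // x.
by have [/gM//|/g0 ->] := pselect (ball c r x); rewrite normr0 ltW.
Qed.

Lemma bounded_supp_integrable (g : V -> R) (c : V) (r M : R) : 0 < r ->
  measurable_fun [set: L] (g : L -> R) -> (forall x, ~ ball c r x -> g x = 0) ->
  (forall x, `|g x| <= M) -> mu.-integrable [set: L] (EFin \o g).
Proof.
move=> r0 mg g0 gM.
have mB : measurable (ball c r : set L).
  by apply: open_measurable_rV; exact: ball_open.
have M0 : 0 <= M by apply: le_trans (gM 0).
apply: (@le_integrable _ L R mu setT measurableT _ (fun x : L => (M * \1_(ball c r : set L) x)%:E)).
- exact/measurable_EFinP.
- move=> x _ /=; rewrite lee_fin indicE.
  have [Bx|nB] := pselect (ball c r x).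
    by rewrite mem_set// mulr1 (ger0_norm M0).
  by rewrite g0// normr0.
- apply/integrableP; split.
    apply/measurable_EFinP; apply: measurable_funM; first exact: measurable_cst.
    exact: measurable_indic.
  rewrite (eq_integral (fun x : L => M%:E * (\1_(ball c r : set L) x)%:E))%E => [|x _]; last first.
    by rewrite gee0_abs ?EFinM// lee_fin mulr_ge0.
  have m1 : measurable_fun [set: L] (fun x : L => (\1_(ball c r : set L) x : R)%:E).
    by apply/measurable_EFinP; exact: measurable_indic.
  have i0 x : [set: L] x -> (0 <= (\1_(ball c r : set L) x : R)%:E)%E.
    by move=> _; rewrite lee_fin.
  rewrite (@ge0_integralZl_EFin _ L R mu setT measurableT _ i0 m1 M M0).
  have -> : (\int[mu]_x (\1_(ball c r : set L) x : R)%:E = mu (ball c r))%E.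
    by rewrite integral_indic// setIT.
  by rewrite lebesgue_rV_ball// -EFinM ltry.
Qed.

Lemma continuous_supp_integrable (g : V -> R) (c : V) (r : R) : 0 < r ->
  continuous g -> (forall x, ~ ball c r x -> g x = 0) ->
  mu.-integrable [set: L] (EFin \o g).
Proof.
move=> r0 cg g0; have [M M0 gM] := continuous_supp_bounded cg g0.
by apply: (bounded_supp_integrable r0 _ g0 gM); exact: continuous_measurable_rV.
Qed.

Lemma abs_pow_int_supp_integrable q (c : V) (r : R) (G : V -> R) : (0 < q)%N -> 0 < r ->
  measurable_fun [set: L] (G : L -> R) -> (forall x, ~ ball c r x -> G x = 0) ->
  (abs_pow_int mu q setT G < +oo)%E -> mu.-integrable [set: L] (EFin \o G).
Proof.
move=> q0 r0 mG G0 Goo.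
have mB : measurable (ball c r : set L).
  by apply: open_measurable_rV; exact: ball_open.
have muB : (mu (ball c r) < +oo)%E by rewrite lebesgue_rV_ball// ltry.
apply/integrableP; split; first exact/measurable_EFinP.
have -> : (\int[mu]_x `|(EFin \o G) x| = abs_pow_int mu 1 setT G)%E.
  by apply: eq_integral => x _; rewrite expr1.
rewrite (@abs_pow_int_support_rV _ _ 1 (ball c r))//.
apply: (@abs_pow_int_lower _ L R mu 1 q) => //.
  exact: measurable_funTS.
by rewrite -(@abs_pow_int_support_rV _ _ q (ball c r)).
Qed.

End difference_quotients.

Section weak_difference.
Context {R : realType} {n : nat}.
Local Notation V := 'rV[R]_n.
Local Notation L := (lebesgue_space R n).
Local Notation mu := (@lebesgue_rV R n).

Lemma integral_support_rV (D : set V) (f : V -> R) : (forall x, ~ D x -> f x = 0) ->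
  (\int[mu]_x (f x)%:E = \int[mu]_(x in D) (f x)%:E)%E.
Proof.
move=> f0; rewrite [RHS]integral_mkcond.
apply: eq_integral => x _; rewrite /patch.
have [//|/negP xD] := boolP (x \in D).
by rewrite f0// => Dx; apply: xD; rewrite inE.
Qed.

Lemma ball_delta (x0 x : V) (s d t : R) (j : 'I_n) : 0 < s -> `|t| < d ->
  ball x0 s (x + t *: delta_mx 0 j) -> ball x0 (s + d) x.
Proof.
move=> s0 td [_ h]; have d0 : 0 < d by apply: le_lt_trans td.
split; first by rewrite addr_gt0.
move=> i k; have := h i k; rewrite !mxE /ball/= (ord1 i) eqxx/= => hk.
have -> : x0 0 k - x 0 k = x0 0 k - (x 0 k + t * (k == j)%:R) + t * (k == j)%:R.
  by rewrite opprD addrA subrK.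
rewrite (le_lt_trans (ler_normD _ _))// ltrD//.
by case: eqP => _; rewrite ?mulr1 ?mulr0 ?normr0.
Qed.

(** W need not be differentiable, so the translation is moved onto phi: the mean value theorem is
    applied to the function t -> int W(x) phi(x + t e), whose derivative is -int G(x) phi(x + t e)
    by the definition of the weak derivative. *)
Lemma weak_difference (Omega : set V) (j : 'I_n) (W G phi : V -> R) (x0 : V) (s d h : R) :
  0 < s -> 0 < d -> ball x0 (s + d) `<=` Omega -> continuous W ->
  mu.-integrable [set: L] (EFin \o G) ->
  weak_partial Omega j W G -> test_function (ball x0 s) phi -> 0 < h -> h < d ->
  exists2 xi, 0 < xi < h &
    \int[mu]_x ((W (x + h *: delta_mx 0 j) - W x) * phi x) =
    h * \int[mu]_x (G (x + xi *: delta_mx 0 j) * phi x).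
Proof.
set e := delta_mx 0 j.
move=> s0 d0 BO cW iG [_ _ wp] tphi h0 hd.
have sd0 : 0 < s + d by rewrite addr_gt0.
have cphi := test_function_continuous tphi.
have tdphi := test_function_partial j tphi.
have phit0 t x : `|t| < d -> ~ ball x0 (s + d) x -> phi (x + t *: e) = 0.
  by move=> td nB; apply: (test_function_out tphi) => /(ball_delta s0 td).
have dphit0 t x : `|t| < d -> ~ ball x0 (s + d) x -> partial j phi (x + t *: e) = 0.
  by move=> td nB; apply: (test_function_out tdphi) => /(ball_delta s0 td).
have [M1 M10 hM1] := continuous_supp_bounded (test_function_continuous tdphi)
  (fun x => @test_function_out _ _ _ _ x tdphi).
have [M M0 hM] := continuous_ball_bounded x0 (s + d) cW.
have ctphi t : continuous (fun x : V => phi (x + t *: e)).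
  move=> x; exact: (@continuous_comp V V R _ phi x (@translation_continuous _ _ (t *: e) x) (@cphi _)).
pose f t (x : V) := W x * phi (x + t *: e).
have If t : `]- d, d[%classic t -> mu.-integrable [set: L] (EFin \o f t).
  rewrite /= in_itv/= -ltr_norml => td.
  apply: (@continuous_supp_integrable _ _ (f t) x0 (s + d) sd0).
    by move=> x; exact: (@continuousM R V W _ x (@cW x) (@ctphi t x)).
  by move=> x nB; rewrite /f (phit0 _ _ td nB) mulr0.
have df t x : is_derive t (1 : R) (fun t => f t x) (W x * partial j phi (x + t *: e)).
  apply: (@is_deriveZ R R R (fun t => phi (x + t *: e)) (W x) t 1).
  apply: is_derive_translate.
  by have [sphi _ _] := tphi; exact: (@smooth_derivable _ _ phi j _ sphi).
have dE t x : partial1of2 f t x = W x * partial j phi (x + t *: e).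
  by rewrite partial1of2E; have [_] := df t x.
pose Gb (x : L) : R := M * M1 * \1_(ball x0 (s + d) : set L) x.
have MM0 : 0 <= M * M1 by rewrite ltW// mulr_gt0.
have Gb0 x : 0 <= Gb x by apply: mulr_ge0.
have iGb : mu.-integrable [set: L] (EFin \o Gb).
  apply: (@bounded_supp_integrable _ _ Gb x0 (s + d) (M * M1) sd0).
  - apply: measurable_funM; first exact: measurable_cst.
    by apply: measurable_indic; apply: open_measurable_rV; exact: ball_open.
  - by move=> x nB; rewrite /Gb indicE memNset// mulr0.
  - move=> x; rewrite /Gb indicE; case: (_ \in _); rewrite ?mulr1 ?mulr0 ?normr0.
      by rewrite ger0_norm.
    exact: MM0.
have ub t x : `]- d, d[%classic t -> [set: L] x -> `|partial1of2 f t x| <= Gb x.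
  rewrite /= in_itv/= -ltr_norml => td _; rewrite dE /Gb indicE.
  have [Bx|nB] := pselect (ball x0 (s + d) x); last by rewrite (dphit0 _ _ td nB) mulr0 normr0 -/(Gb x).
  by rewrite mem_set// mulr1 normrM ler_pM// hM.
have derf t x : `]- d, d[%classic t -> [set: L] x -> derivable (f^~ x) t 1.
  by move=> _ _; have [] := df t x.
pose a t := \int[mu]_x f t x.
(* For |t| < d the translate of phi is still a test function for Omega, so after differentiation
   under the integral the weak derivative may be used. *)
have da t : t \in `]- d, d[ -> is_derive t (1 : R) a (- \int[mu]_x (G x * phi (x + t *: e))).
  move=> td.
  apply: DeriveDef.
    exact: (@derivable_under_integral R _ L mu f setT measurableT t (- d) d td If derf Gb Gb0 iGb ub).
  rewrite -derive1E.
  rewrite (@differentiation_under_integral R _ L mu f setT measurableT t (- d) d td If derf Gb Gb0 iGb ub).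
  have ttphi : test_function Omega (fun x : V => phi (x + t *: e)).
    apply: test_function_translate tphi => x.
    move: td; rewrite in_itv/= -ltr_norml => td /(ball_delta s0 td).
    exact: BO.
  have H := wp _ ttphi.
  rewrite /Rintegral.
  rewrite [in LHS](eq_integral (fun x : L => (W x * partial j (fun x : V => phi (x + t *: e)) x)%:E)); last first.
    by move=> x _; congr EFin; rewrite /partial derive_translate; exact: dE.
  rewrite (@integral_support_rV Omega (fun x => W x * partial j (fun x : V => phi (x + t *: e)) x)).
    rewrite H fineN (@integral_support_rV Omega (fun x => G x * phi (x + t *: e)))// => x nO.
    by rewrite (test_function_out ttphi)// mulr0.
  by move=> x nO; rewrite (test_function_out (test_function_partial j ttphi))// mulr0.
have hN0 : - h < 0 by rewrite oppr_lt0.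
pose a' t := - \int[mu]_x (G x * phi (x + t *: e)).
have da' t : t \in `]- h, 0[ -> is_derive t (1 : R) a (a' t).
  rewrite in_itv/= => /andP[t1 t2]; apply: da.
  by rewrite in_itv/= (lt_trans _ t1) ?ltrN2// (lt_trans t2).
have ca : {within `[- h, 0], continuous a}.
  apply: derivable_within_continuous => t; rewrite in_itv/= => /andP[t1 t2].
  have /da[]// : t \in `]- d, d[.
  by rewrite in_itv/= (lt_le_trans _ t1) ?ltrN2// (le_lt_trans t2).
(* The interval is [-h, 0] because a change of variable turns a(-h) into the integral of W(x + h e)
   phi(x); the intermediate point is negated accordingly. *)
have [xi xih E] := MVT hN0 da' ca.
exists (- xi).
  by move: xih; rewrite in_itv/= => /andP[h1 h2]; rewrite oppr_gt0 h2 ltrNl.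
have hI : `]- d, d[%classic (- h) by rewrite /= in_itv/= ltrN2 hd (lt_trans hN0).
have I0 : `]- d, d[%classic (0 : R) by rewrite /= in_itv/= oppr_lt0 d0.
have E1 : \int[mu]_x f (- h) x = \int[mu]_x (W (x + h *: e) * phi x).
  rewrite /Rintegral -(integral_shift (h *: e) (If _ hI)); congr fine.
  by apply: eq_integral => x _; rewrite /f /= scaleNr addrK.
have iWh : mu.-integrable [set: L] (fun x => (W (x + h *: e) * phi x)%:E).
  have := integrable_shift (h *: e) (If _ hI).
  by apply: eq_integrable => // x _; rewrite /= /f scaleNr addrK.
have iW0 : mu.-integrable [set: L] (fun x => (W x * phi x)%:E).
  by apply: eq_integrable (If _ I0) => // x _; rewrite /= /f scale0r addr0.
have xihI : `|xi| < d.
  move: xih; rewrite in_itv/= => /andP[h1 h2].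
  by rewrite ltr0_norm// ltrNl (lt_trans _ h1)// ltrN2.
have [Mp Mp0 hMp] := continuous_supp_bounded cphi
  (fun x => @test_function_out _ _ _ _ x tphi).
have iGp : mu.-integrable [set: L] (fun x => (G x * phi (x + xi *: e))%:E).
  have mG : measurable_fun [set: L] (G : L -> R) by apply/measurable_EFinP; exact: measurable_int iG.
  apply: (@le_integrable _ L R mu setT measurableT _ (fun x => (Mp * G x)%:E)).
  - apply/measurable_EFinP; apply: measurable_funM; first exact: mG.
    by apply: continuous_measurable_rV; exact: ctphi.
  - move=> x _ /=; rewrite lee_fin !normrM mulrC ler_wpM2r//.
    by rewrite (ger0_norm (ltW Mp0)).
  - by under eq_fun do rewrite EFinM; exact: integrableZl.
have E2 : \int[mu]_x (G x * phi (x + xi *: e)) = \int[mu]_x (G (x + (- xi) *: e) * phi x).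
  rewrite /Rintegral -(integral_shift ((- xi) *: e) iGp); congr fine.
  by apply: eq_integral => x _; rewrite scaleNr subrK.
have -> : \int[mu]_x ((W (x + h *: e) - W x) * phi x) = a (- h) - a 0.
  rewrite /a E1.
  rewrite -[X in _ - X](_ : \int[mu]_x (W x * phi x) = _); last first.
    by apply: eq_Rintegral => x _; rewrite /f scale0r addr0.
  rewrite -RintegralB//.
  by apply: eq_Rintegral => x _; rewrite mulrBl.
by rewrite -[LHS]opprB E /a' E2 sub0r opprK mulNr opprK mulrC.
Qed.

End weak_difference.

(** * The duality estimate for difference quotients *)

Section clipping.
Context {R : realType}.
Implicit Types (a b : R).

Definition clip (N a : R) : R := Num.max (- N) (Num.min a N).

Lemma clip_norm_le N a : 0 <= N -> `|clip N a| <= N.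
Proof.
by move=> N0; rewrite ler_norml /clip le_max lexx/= ge_max ge_min lexx orbT andbT; lra.
Qed.

Lemma clip_id N a : `|a| <= N -> clip N a = a.
Proof. by rewrite ler_norml => /andP[h1 h2]; rewrite /clip min_l// max_r. Qed.

Lemma clip_norm_le_norm N a : 0 <= N -> `|clip N a| <= `|a|.
Proof.
move=> N0; have [aN|Na] := leP `|a| N; first by rewrite clip_id.
exact: le_trans (clip_norm_le a N0) (ltW Na).
Qed.

Lemma clip_mul N a : 0 <= N -> `|clip N a| ^+ 2 <= a * clip N a.
Proof.
move=> N0; rewrite -normrX ger0_norm ?sqr_ge0// /clip.
by have [h1|h1] := leP a N; [have [h2|h2] := leP (- N) a|have [h2|h2] := leP (- N) N]; nra.
Qed.

(* Young's inequality with the bad constant that survives without logarithms. *)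
Lemma young_half k a b : 0 <= a -> 0 <= b ->
  a * b ^+ k <= 2 ^+ k * a ^+ k.+1 + b ^+ k.+1 / 2.
Proof.
move=> a0 b0; have [ba|ab] := leP b (2 * a).
  have : b ^+ k <= (2 * a) ^+ k by rewrite lerXn2r ?nnegrE ?mulr_ge0.
  rewrite exprMn => h.
  have : a * b ^+ k <= a * (2 ^+ k * a ^+ k) by exact: ler_wpM2l.
  have : 0 <= b ^+ k.+1 by exact: exprn_ge0.
  by rewrite [a ^+ k.+1]exprS; lra.
have : a * b ^+ k <= b / 2 * b ^+ k by apply: ler_wpM2r; [exact: exprn_ge0|lra].
have : 0 <= 2 ^+ k * a ^+ k.+1 by rewrite mulr_ge0 ?exprn_ge0.
by rewrite [b ^+ k.+1]exprS; lra.
Qed.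

(* With d the deviation and kk = r - d, testing against psi = c |c|^m is
   replaced, up to small errors, by testing kk against phi. *)
Lemma duality_pointwise m (r d N phi l : R) : 0 < l -> 0 <= N ->
  `|clip N r| ^+ m.+2 / 2 <= (r - d) * phi + (2 ^+ m.+1 * `|d| ^+ m.+2 +
    (l * (2 * `|r| ^+ 2 + 2 * (1 + `|d| ^+ m.+2)) +
     l^-1 * `|clip N r * `|clip N r| ^+ m - phi| ^+ 2)).
Proof.
move=> l0 N0; set c := clip N r; set psi := c * _.
have h1 : `|c| ^+ m.+2 <= r * psi.
  rewrite /psi mulrA -addn2 exprD mulrC ler_wpM2r ?exprn_ge0//.
  exact: clip_mul.
have h2 : d * psi <= 2 ^+ m.+1 * `|d| ^+ m.+2 + `|c| ^+ m.+2 / 2.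
  apply: le_trans (@young_half m.+1 `|d| `|c| (normr_ge0 _) (normr_ge0 _)).
  rewrite (le_trans (ler_norm _))// /psi !normrM normrX normr_id ler_wpM2l//.
  by rewrite exprS.
have h3 : (r - d) * (psi - phi) <= l * (r - d) ^+ 2 + l^-1 * `|psi - phi| ^+ 2.
  rewrite -[(`|psi - phi| ^+ 2)]normrX [(`|(_ - _) ^+ 2|)]ger0_norm ?sqr_ge0//.
  move: (r - d) (psi - phi) => a b.
  have h : l * (a * b) <= l * (l * a ^+ 2 + l^-1 * b ^+ 2).
    by rewrite mulrDr (mulrA l l^-1) mulfV ?gt_eqF// mul1r; nra.
  by rewrite ler_pM2l in h.
have h4 : (r - d) ^+ 2 <= 2 * `|r| ^+ 2 + 2 * (1 + `|d| ^+ m.+2).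
  have hd : `|d| ^+ 2 <= 1 + `|d| ^+ m.+2.
    have [d1|d1] := leP `|d| 1.
      by rewrite ler_wpDr ?exprn_ge0// exprn_ile1.
    by rewrite ler_wpDl// ler_weXn2l// ltW.
  have : (r - d) ^+ 2 <= 2 * `|r| ^+ 2 + 2 * `|d| ^+ 2.
    rewrite -!normrX !ger0_norm ?sqr_ge0//; have := sqr_ge0 (r + d).
    by rewrite !expr2 !mulrDl !mulrDr !mulNr !mulrN; lra.
  lra.
have h5 : l * (r - d) ^+ 2 <= l * (2 * `|r| ^+ 2 + 2 * (1 + `|d| ^+ m.+2)).
  by rewrite ler_pM2l.
lra.
Qed.

End clipping.

Section integral_bounds.
Context d (T : measurableType d) (R : realType) (mu : {measure set T -> \bar R}).
Variable D : set T.
Hypothesis mD : measurable D.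
Implicit Types (f g : T -> R) (a x y : R).

Definition int_le f x := [/\ measurable_fun D f, forall t, 0 <= f t &
  (\int[mu]_(t in D) (f t)%:E <= x%:E)%E].

Lemma int_leD f g x y : int_le f x -> int_le g y -> int_le (fun t => f t + g t) (x + y).
Proof.
move=> [mf f0 fx] [mg g0 gy]; split; first exact: measurable_funD.
  by move=> t; exact: addr_ge0.
under eq_integral do rewrite EFinD.
rewrite ge0_integralD//.
- by rewrite EFinD leeD.
- by move=> t _; rewrite lee_fin.
- exact/measurable_EFinP.
- by move=> t _; rewrite lee_fin.
- exact/measurable_EFinP.
Qed.

Lemma int_leZ a f x : 0 <= a -> int_le f x -> int_le (fun t => a * f t) (a * x).
Proof.
move=> a0 [mf f0 fx]; split; first exact: measurable_funM.
  by move=> t; exact: mulr_ge0.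
under eq_integral do rewrite EFinM.
rewrite ge0_integralZl_EFin//.
- by rewrite EFinM lee_wpmul2l.
- by move=> t _; rewrite lee_fin.
- exact/measurable_EFinP.
Qed.

Lemma int_le_cst a x : 0 <= a -> (mu D <= x%:E)%E -> int_le (cst a) (a * x).
Proof.
move=> a0 Dx; split => //.
have -> : (\int[mu]_(t in D) (cst a t)%:E = a%:E * mu D)%E.
  exact: (integral_cst mu mD a%:E).
by rewrite EFinM lee_wpmul2l.
Qed.

Lemma int_le_abs_pow q f x : measurable_fun D f ->
  (abs_pow_int mu q D f <= x%:E)%E -> int_le (fun t => `|f t| ^+ q) x.
Proof.
move=> mf fx; split => //.
  by apply: measurable_funX; exact: measurableT_comp.
Qed.

Lemma int_le_integrable f x : int_le f x -> mu.-integrable D (EFin \o f).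
Proof.
move=> [mf f0 fx]; apply/integrableP; split; first exact/measurable_EFinP.
rewrite (eq_integral (fun t => (f t)%:E)).
  by apply: le_lt_trans fx _; rewrite ltry.
by move=> t _; rewrite gee0_abs// lee_fin.
Qed.

Lemma abs_pow_int_bounded q f M : (mu D < +oo)%E -> measurable_fun D f ->
  (forall t, D t -> `|f t| <= M) -> (abs_pow_int mu q D f < +oo)%E.
Proof.
move=> Doo mf fM.
apply: (@le_lt_trans _ _ (abs_pow_int mu q D (cst M))).
  apply: abs_pow_int_le => // t Dt; apply: le_trans (fM t Dt) _; exact: ler_norm.
have -> : abs_pow_int mu q D (cst M) = ((`|M| ^+ q)%:E * mu D)%E.
  exact: (integral_cst mu mD (`|M| ^+ q)%:E).
apply: lte_mul_pinfty => //.
Qed.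

Lemma abs_pow_int_clip q f : (0 < q)%N -> measurable_fun D f ->
  (abs_pow_int mu q D f < +oo)%E -> forall e : R, 0 < e ->
  exists2 N : R, 0 <= N & (abs_pow_int mu q D (fun t => f t - clip N (f t))%R <= e%:E)%E.
Proof.
move=> q0 mf foo e e0.
have mc N : measurable_fun D (fun t => clip N (f t)).
  by apply: measurable_maxr => //; exact: measurable_minr.
have m2 : measurable_fun D (fun t => 2 * `|f t|).
  by apply: measurable_funM => //; exact: measurableT_comp.
have : (abs_pow_int mu q D (fun t => f t - clip k%:R (f t))%R @[k --> \oo] --> 0)%E.
  apply: (abs_pow_int_dominated q0 mD _ m2).
  - by move=> k; exact: measurable_funB.
  - move=> t _.
    have E : \forall k \near \oo, 0 = f t - clip k%:R (f t).
      near=> k; rewrite clip_id ?subrr//.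
      near: k; exact: nbhs_infty_ger.
    by apply: cvg_trans (near_eq_cvg E) _; exact: cvg_cst.
  - move=> k t _; apply: le_trans (ler_normB _ _) _.
    have := @clip_norm_le_norm R k%:R (f t) (ler0n _ _); lra.
  - rewrite abs_pow_intZ//; last exact: measurableT_comp.
    rewrite (@eq_abs_pow_int _ _ _ mu q D _ f) => [|t _]; last exact: normr_id.
    by rewrite lte_mul_pinfty// lee_fin exprn_ge0.
move=> /fine_cvgP[fin /cvgr0_norm_le/(_ _ e0) H].
have [k [kfin ke]] : exists k, abs_pow_int mu q D (fun t => f t - clip k%:R (f t))%R \is a fin_num /\
    `|fine (abs_pow_int mu q D (fun t => f t - clip k%:R (f t))%R)| <= e.
  by near \oo => k; exists k; split; near: k.
exists k%:R => //.
rewrite -(fineK kfin) lee_fin.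
by apply: le_trans ke; rewrite ler_norm.
Unshelve. all: by end_near. Qed.

End integral_bounds.

Section difference_quotient_close.
Context {R : realType} {n : nat}.
Local Notation V := 'rV[R]_n.
Local Notation L := (lebesgue_space R n).
Local Notation mu := (@lebesgue_rV R n).

Definition diffq (h : R) (j : 'I_n) (w : V -> R) (x : V) : R :=
  h^-1 * (w (x + h *: delta_mx 0 j) - w x).

Lemma continuous_translate (w : V -> R) (v : V) : continuous w ->
  continuous (fun x : V => w (x + v)).
Proof.
move=> cw x.
exact: (@continuous_comp V V R _ w x (@translation_continuous _ _ v x) (@cw _)).
Qed.

Lemma continuous_diffq h j w : continuous w -> continuous (diffq h j w).
Proof.
move=> cw x.
have c1 := @continuous_translate w (h *: delta_mx 0 j) cw.
have c2 : {for x, continuous (fun x : V => w (x + h *: delta_mx 0 j) - w x)}.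
  exact: (@continuousB _ _ _ _ _ x (@c1 x) (@cw x)).
exact: (@continuousM R V (cst h^-1) _ x (@cst_continuous _ _ h^-1 x) c2).
Qed.

(** Let r be the error DW - G and let G move by little under translations by at most h. By
    [weak_difference], the integral of DW against a test function equals that of some translate of
    G. Choosing the test function close to r |r|^m then bounds the integral of |r|^(m+2) by the
    translation error. As r may be unbounded, it is first clipped at a level N with small
    remainder. *)
Lemma diffq_close m (Omega : set V) (j : 'I_n) (W G : V -> R) (x0 c0 : V) (s d h r0 eps : R) :
  0 < s -> 0 < d -> ball x0 (s + d) `<=` Omega -> continuous W ->
  measurable_fun [set: L] (G : L -> R) ->
  0 < r0 -> (forall x, ~ ball c0 r0 x -> G x = 0) ->
  (abs_pow_int mu m.+2 setT G < +oo)%E ->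
  weak_partial Omega j W G -> 0 < h -> h < d -> 0 < eps ->
  (forall xi, 0 < xi < h ->
    (abs_pow_int mu m.+2 setT (fun x : V => G (x + xi *: delta_mx 0 j) - G x)%R <= eps%:E)%E) ->
  (abs_pow_int mu m.+2 (ball x0 s) (fun x => diffq h j W x - G x)%R <=
    (2 ^+ m.+2 * (2 ^+ m.+2 + 3) * eps)%:E)%E.
Proof.
set e := delta_mx 0 j.
move=> s0 d0 BO cW mG r00 G0 Goo wp h0 hd eps0 HG.
set B := ball x0 s.
have mB : measurable (B : set L) by apply: open_measurable_rV; exact: ball_open.
have muB : mu B = ((2 * s) ^+ n)%:E by exact: lebesgue_rV_ball.
have Boo : (mu B < +oo)%E by rewrite muB ltry.
have iG : mu.-integrable [set: L] (EFin \o G).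
  exact: (@abs_pow_int_supp_integrable _ _ m.+2 c0 r0).
pose DW := diffq h j W.
have cDW : continuous DW by exact: continuous_diffq.
have mDW : measurable_fun [set: L] (DW : L -> R) by exact: continuous_measurable_rV.
pose r (x : V) := DW x - G x.
have mr : measurable_fun [set: L] (r : L -> R) by exact: measurable_funB.
have mrB : measurable_fun (B : set L) (r : L -> R) by exact: measurable_funTS.
have GB : (abs_pow_int mu m.+2 B G < +oo)%E.
  apply: le_lt_trans Goo; apply: abs_pow_int_subset => //.
have roo : (abs_pow_int mu m.+2 B r < +oo)%E.
  have [M M0 hM] := continuous_ball_bounded x0 s cDW.
  apply: (@le_lt_trans _ _ ((2 ^+ m.+2)%:E * (abs_pow_int mu m.+2 B DW + abs_pow_int mu m.+2 B G))%E).
    have mN : measurable_fun (B : set L) ((fun x : V => - G x) : L -> R).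
      by apply: measurable_funN; exact: measurable_funTS.
    have -> : abs_pow_int mu m.+2 B G = abs_pow_int mu m.+2 B (fun x : V => - G x).
      by apply: eq_abs_pow_int => x _; rewrite normrN.
    exact: (abs_pow_intD _ _ mB (measurable_funTS mDW) mN).
  apply: lte_mul_pinfty; [by rewrite lee_fin exprn_ge0|by []|].
  apply: lte_add_pinfty => //.
  exact: (@abs_pow_int_bounded _ L R mu B mB m.+2 DW M Boo (measurable_funTS mDW) hM).
have r2oo : (abs_pow_int mu 2 B r < +oo)%E by exact: (@abs_pow_int_lower _ L R mu 2 m.+2 B r isT mB Boo mrB roo).
(* Clipping makes [psi] below bounded on B, hence approximable by test functions in L^2. *)
have [N N0 hN] := @abs_pow_int_clip _ L R mu B mB m.+2 r isT mrB roo eps eps0.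
pose c (x : V) := clip N (r x).
have mc : measurable_fun [set: L] (c : L -> R).
  by apply: measurable_maxr; [exact: measurable_cst|apply: measurable_minr => //; exact: measurable_cst].
pose psi (x : V) := c x * `|c x| ^+ m.
have mpsi : measurable_fun [set: L] (psi : L -> R).
  apply: measurable_funM; first exact: mc.
  apply: measurable_funX.
  exact: measurableT_comp.
have hpsi x : B x -> `|psi x| <= N ^+ m.+1.
  move=> _; rewrite /psi normrM normrX normr_id -exprS.
  by rewrite lerXn2r ?nnegrE// clip_norm_le.
have psioo : (abs_pow_int mu 2 B psi < +oo)%E.
  exact: (@abs_pow_int_bounded _ L R mu B mB 2 psi _ Boo (measurable_funTS mpsi) hpsi).
pose Cr := fine (abs_pow_int mu 2 B r).
have CrE : abs_pow_int mu 2 B r = Cr%:E.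
  by rewrite fineK// ge0_fin_numE// abs_pow_int_ge0.
have Cr0 : 0 <= Cr by rewrite -lee_fin -CrE abs_pow_int_ge0.
pose b := (2 * s) ^+ n.
have b0 : 0 < b by rewrite exprn_gt0// mulr_gt0.
(* [D0] bounds the integral of the factor of [l] in [duality_pointwise]; [l] and [kap] make both
   [l * D0] and [l^-1 * kap] equal to [eps / 2]. *)
pose D0 := 2 * Cr + 2 * (1 * b + eps).
have D00 : 0 < D0 by rewrite ltr_wpDl ?mulr_ge0// mulr_gt0// addr_gt0// mul1r.
pose l := eps / (2 * D0).
have l0 : 0 < l by rewrite divr_gt0// mulr_gt0.
pose kap := l * (eps / 2).
have kap0 : 0 < kap by rewrite mulr_gt0// divr_gt0.
have [phi tphi hphi] := approximable_test_function (ltn0Sn 1) s0 mpsi psioo kap0.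
(* The point [xi] depends on [phi], hence on all constants chosen above; the bound [HG] is uniform
   in [xi], so no circularity arises. *)
have [xi xih E] := weak_difference s0 d0 BO cW iG wp tphi h0 hd.
pose de (x : V) := G (x + xi *: e) - G x.
have mGx := measurable_translate (xi *: e) mG.
have mde : measurable_fun [set: L] (de : L -> R) by exact: measurable_funB.
have cphi := test_function_continuous tphi.
have mphi : measurable_fun [set: L] (phi : L -> R) by exact: continuous_measurable_rV.
have phi0 x : ~ B x -> phi x = 0 by move=> nB; exact: (test_function_out tphi).
have [Mp Mp0 hMp] := continuous_supp_bounded cphi phi0.
have iDp : mu.-integrable [set: L] (EFin \o (fun x => DW x * phi x)).
  apply: (@continuous_supp_integrable _ _ (fun x => DW x * phi x) x0 s s0).
    by move=> x; exact: (@continuousM R V DW phi x (@cDW x) (@cphi x)).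
  by move=> x nB; rewrite phi0// mulr0.
have iGp : mu.-integrable [set: L] (EFin \o (fun x => G (x + xi *: e) * phi x)).
  apply: (@le_integrable _ L R mu setT measurableT _ (fun x => (Mp * G (x + xi *: e))%:E)).
  - by apply/measurable_EFinP; apply: measurable_funM; [exact: mGx|exact: mphi].
  - move=> x _ /=; rewrite lee_fin !normrM mulrC ler_wpM2r//.
    by rewrite (ger0_norm (ltW Mp0)).
  - by under eq_fun do rewrite EFinM; apply: integrableZl => //; exact: (integrable_shift (xi *: e) iG).
pose k (x : V) := (r x - de x) * phi x.
have kE x : k x = DW x * phi x - G (x + xi *: e) * phi x.
  by rewrite /k /r /de; ring.
have ik : mu.-integrable [set: L] (EFin \o k).
  rewrite (_ : EFin \o k = fun x => ((DW x * phi x)%:E - (G (x + xi *: e) * phi x)%:E)%E).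
    exact: integrableB.
  by apply/funext => x; rewrite /= kE EFinB.
(* Here r - de = DW - G(. + xi e), and [E] says that DW and this translate have the same integral
   against [phi]. *)
have k0 : (\int[mu]_(x in B) (k x)%:E = 0)%E.
  rewrite -(@integral_support_rV _ _ B k) => [|x nB]; last by rewrite /k phi0// mulr0.
  have fk : (\int[mu]_x (k x)%:E)%E \is a fin_num by exact: (integrable_fin_num measurableT ik).
  rewrite -(fineK fk); congr EFin.
  rewrite -[fine _]/(\int[mu]_x k x).
  rewrite (@eq_Rintegral _ L R mu setT (fun x => DW x * phi x - G (x + xi *: e) * phi x)) => [|x _]; last exact: kE.
  rewrite RintegralB//.
  rewrite (@eq_Rintegral _ L R mu setT (fun x : L => h^-1 * ((W (x + h *: e) - W x) * phi x))) => [|x _]; last first.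
    by rewrite mulrA.
  rewrite RintegralZl//.
    by rewrite E mulrA mulVf ?gt_eqF// mul1r subrr.
  rewrite (_ : EFin \o _ = (fun x => h%:E * (DW x * phi x)%:E)%E).
    exact: integrableZl.
  by apply/funext => x; rewrite -EFinM /DW /diffq -/e !mulrA mulfV ?gt_eqF// mul1r.
pose A (x : V) := 2 ^+ m.+1 * `|de x| ^+ m.+2 +
    (l * (2 * `|r x| ^+ 2 + 2 * (1 + `|de x| ^+ m.+2)) + l^-1 * `|psi x - phi x| ^+ 2).
have deB : int_le mu (B : set L) (fun x => `|de x| ^+ m.+2) eps.
  apply: (int_le_abs_pow (measurable_funTS mde)).
  apply: le_trans (HG xi xih).
  exact: (abs_pow_int_subset _ _ mB measurableT mde).
have muBle : (mu B <= b%:E)%E by rewrite muB.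
have h20 : 0 <= 2 :> R by [].
have AB : int_le mu (B : set L) A (2 ^+ m.+1 * eps + (l * D0 + l^-1 * kap)).
  apply: (int_leD mB).
    by apply: (int_leZ mB) deB; exact: exprn_ge0.
  apply: (int_leD mB).
    apply: (int_leZ mB); first exact: ltW.
    apply: (int_leD mB).
      apply: (int_leZ mB h20).
      by apply: (int_le_abs_pow mrB); rewrite CrE.
    apply: (int_leZ mB h20).
    apply: (int_leD mB) deB.
    exact: (int_le_cst mB ler01 muBle).
  apply: (int_leZ mB); first by rewrite invr_ge0 ltW.
  apply: int_le_abs_pow hphi; apply: measurable_funTS; exact: measurable_funB.
have cB : (abs_pow_int mu m.+2 B c < +oo)%E.
  apply: (@abs_pow_int_bounded _ L R mu B mB m.+2 c N Boo (measurable_funTS mc)) => x _.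
  exact: clip_norm_le.
pose Cc := fine (abs_pow_int mu m.+2 B c).
have CcE : abs_pow_int mu m.+2 B c = Cc%:E.
  by rewrite fineK// ge0_fin_numE// abs_pow_int_ge0.
have cle : int_le mu (B : set L) (fun x => `|c x| ^+ m.+2) Cc.
  by apply: (int_le_abs_pow (measurable_funTS mc)); rewrite CcE.
have icN : mu.-integrable (B : set L) (fun x => (2^-1 * `|c x| ^+ m.+2)%:E).
  have h2 : 0 <= 2^-1 :> R by rewrite invr_ge0.
  exact: (int_le_integrable (int_leZ mB h2 cle)).
(* Integration of [duality_pointwise]: the term [k] contributes 0 and the remainder [A] is
   controlled by [AB]. *)
have S : (\int[mu]_(x in B) (2^-1 * `|c x| ^+ m.+2)%:E <= (2 ^+ m.+1 * eps + (l * D0 + l^-1 * kap))%:E)%E.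
  apply: (@le_trans _ _ (\int[mu]_(x in B) ((k x)%:E + (A x)%:E))%E).
    apply: (@le_integral _ L R mu _ mB).
    - exact: icN.
    - apply: (integrableD mB); last exact: (int_le_integrable AB).
      exact: (integrableS measurableT mB (@subsetT _ _) ik).
    - by move=> x _; rewrite -EFinD lee_fin /k /A mulrC; exact: duality_pointwise.
  rewrite integralD//; [|exact: (integrableS measurableT mB (@subsetT _ _) ik)|exact: (int_le_integrable AB)].
  by rewrite k0 add0e; case: AB.
have S' : (abs_pow_int mu m.+2 B c <= (2 * (2 ^+ m.+1 * eps + eps))%:E)%E.
  move: S; under eq_integral do rewrite EFinM.
  rewrite (@ge0_integralZl_EFin _ L R mu (B : set L) mB (fun x => (`|c x| ^+ m.+2)%:E)).
  - rewrite -/(abs_pow_int mu m.+2 B c) CcE -EFinM !lee_fin.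
    rewrite (_ : l * D0 + l^-1 * kap = eps); first by rewrite ler_pdivrMl.
    rewrite /kap mulKf ?gt_eqF// /l invfM mulrA divfK ?gt_eqF//.
    by rewrite -splitr.
  - by move=> x _; rewrite lee_fin exprn_ge0.
  - exact: measurable_abs_pow (measurable_funTS mc).
  - by rewrite invr_ge0.
rewrite (@eq_abs_pow_int _ L R mu m.+2 B _ (fun x => c x + (r x - c x))) => [|x _]; last by congr Num.norm; rewrite [RHS]addrC subrK.
apply: le_trans.
  exact: (abs_pow_intD _ _ mB (measurable_funTS mc) (measurable_funTS (measurable_funB mr mc))).
apply: (@le_trans _ _ ((2 ^+ m.+2)%:E * ((2 * (2 ^+ m.+1 * eps + eps))%:E + eps%:E))%E).
  by apply: lee_wpmul2l; [rewrite lee_fin exprn_ge0|exact: leeD].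
rewrite -EFinD -EFinM lee_fin -mulrA ler_pM2l ?exprn_gt0//.
by rewrite [2 ^+ m.+2]exprS; lra.
Qed.

End difference_quotient_close.

(** * Local convergence of difference quotients in L^q *)

Section mean_convergence.
Context d (T : measurableType d) (R : realType) (mu : {measure set T -> \bar R}).
Implicit Types (D : set T) (F : R -> T -> R) (g : T -> R) (q : nat).

Definition mean_cvg q D F g := forall e : R, 0 < e -> exists2 dt : R, 0 < dt &
  forall h, 0 < h -> h < dt -> (abs_pow_int mu q D (fun x => F h x - g x)%R <= e%:E)%E.

Lemma abs_pow_intU q D D' f : measurable D -> measurable D' ->
  measurable_fun [set: T] f ->
  (abs_pow_int mu q (D `|` D') f <= abs_pow_int mu q D f + abs_pow_int mu q D' f)%E.
Proof.
move=> mD mD' mf.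
have mDD : measurable (D' `\` D) by exact: measurableD.
have -> : D `|` D' = D `|` (D' `\` D).
  apply/seteqP; split => x; last by move=> [|[]]; [left|right].
  by have [Dx|nD] := pselect (D x); [left|case=> // D'x; right].
rewrite /abs_pow_int ge0_integral_setU//.
- apply: leeD => //; apply: abs_pow_int_subset => //; exact: measurable_funTS.
- by apply: measurable_funTS; exact: measurable_abs_pow.
- by rewrite disj_set2E setDIK.
Qed.

Lemma mean_cvgU q D D' F g : measurable D -> measurable D' ->
  (forall h, measurable_fun [set: T] (F h)) -> measurable_fun [set: T] g ->
  mean_cvg q D F g -> mean_cvg q D' F g -> mean_cvg q (D `|` D') F g.
Proof.
move=> mD mD' mF mg c c' e e0.
have e20 : 0 < e / 2 by rewrite divr_gt0.
have [d0 d00 H] := c _ e20; have [d1 d10 H'] := c' _ e20.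
exists (Num.min d0 d1); first by rewrite lt_min d00.
move=> h h0; rewrite lt_min => /andP[hd0 hd1].
apply: le_trans.
  by apply: (abs_pow_intU _ mD mD'); exact: measurable_funB.
by rewrite [e]splitr EFinD leeD ?H ?H'.
Qed.

Lemma mean_cvg0 q F g : mean_cvg q set0 F g.
Proof.
by move=> e e0; exists 1 => // h _ _; rewrite /abs_pow_int integral_set0 lee_fin ltW.
Qed.

End mean_convergence.

Section sobolev_quotients.
Context {R : realType} {n : nat}.
Local Notation V := 'rV[R]_n.
Local Notation L := (lebesgue_space R n).
Local Notation mu := (@lebesgue_rV R n).

Lemma norm_delta_le (h : R) (j : 'I_n) : `|h *: (delta_mx 0 j : V)| <= `|h|.
Proof.
rewrite normrZ ler_piMr// [leLHS]/Num.norm/= mx_normrE.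
apply: bigmax_le => // -[a b] _ /=; rewrite mxE.
by case: (_ && _); rewrite ?normr1 ?normr0.
Qed.

Lemma diffq_cvg_ball m (Omega : set V) (j : 'I_n) (W G : V -> R) (x0 c0 : V) (s d r0 : R) :
  0 < s -> 0 < d -> ball x0 (s + d) `<=` Omega -> continuous W ->
  measurable_fun [set: L] (G : L -> R) ->
  0 < r0 -> (forall x, ~ ball c0 r0 x -> G x = 0) ->
  (abs_pow_int mu m.+2 setT G < +oo)%E ->
  weak_partial Omega j W G ->
  @mean_cvg _ L R mu m.+2 (ball x0 s) (fun h => diffq h j W) G.
Proof.
move=> s0 d0 BO cW mG r00 G0 Goo wp e e0.
pose C : R := 2 ^+ m.+2 * (2 ^+ m.+2 + 3).
have C0 : 0 < C by rewrite mulr_gt0 ?exprn_gt0// addr_gt0// exprn_gt0.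
have eC0 : 0 < e / C by rewrite divr_gt0.
have [dt dt0 H] := translation_continuity (ltn0Sn _) r00 mG G0 Goo eC0.
exists (Num.min d dt); first by rewrite lt_min d0.
move=> h h0; rewrite lt_min => /andP[hd hdt].
have -> : e = C * (e / C) by rewrite mulrC divfK// gt_eqF.
apply: (diffq_close s0 d0 BO cW mG r00 G0 Goo wp h0 hd eC0) => xi /andP[x1 x2].
apply: H; apply: le_lt_trans (norm_delta_le xi j) _.
by rewrite gtr0_norm// (lt_trans x2).
Qed.

(** Convergence on small balls is additive over finite unions. Around each point of Omega a ball is
    taken whose double is still in Omega, and finitely many of these cover K. *)
Lemma compact_mean_cvg q (Omega K : set V) (I : finType) (F : I -> R -> V -> R) (g : I -> V -> R) :
  open Omega -> compact K -> K `<=` Omega ->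
  (forall i h, measurable_fun [set: L] (F i h : L -> R)) ->
  (forall i, measurable_fun [set: L] (g i : L -> R)) ->
  (forall x0 s d, 0 < s -> 0 < d -> ball x0 (s + d) `<=` Omega ->
     forall i, @mean_cvg _ L R mu q (ball x0 s) (F i) (g i)) ->
  exists U : set V, [/\ open U, K `<=` U, U `<=` Omega &
    forall i, @mean_cvg _ L R mu q U (F i) (g i)].
Proof.
move=> oO cK KO mF mg H.
have /(_ _)/cid-/all_sig[s sP] : forall x : V, exists s : R, 0 < s /\
    (Omega x -> ball x (s + s) `<=` Omega).
  move=> x; have [Ox|nOx] := pselect (Omega x); last by exists 1.
  have /nbhs_ballP[s /= s0 sO] : nbhs x Omega by apply: open_nbhs_nbhs; split.
  by exists (s / 2); split => [|_]; [rewrite divr_gt0|rewrite -splitr].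
have cov : cover_compact K by rewrite -compact_cover.
have [||l lO Kl] := cov V Omega (fun x => ball x (s x)).
- by move=> x _; apply: ball_open; have [] := sP x.
- by move=> x Kx; exists x; [exact: KO|apply: ballxx; have [] := sP x].
have {}lO x : x \in enum_fset l -> Omega x by move=> /lO; rewrite inE.
have {}Kl : K `<=` \big[setU/set0]_(x <- (enum_fset l)) ball x (s x).
  by rewrite -bigcup_fset.
elim: (enum_fset l) K {cK KO cov} lO Kl => [|x l' IH] K lO Kl.
  exists set0; split; [exact: open0|by move: Kl; rewrite big_nil|exact: sub0set|].
  by move=> i; exact: mean_cvg0.
have [s0 /(_ (lO x (mem_head _ _))) sO] := sP x.
have [||U [oU U1 U2 U3]] := IH (\big[setU/set0]_(x <- l') ball x (s x)).
- by move=> y yl; apply: lO; rewrite in_cons yl orbT.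
- by [].
have oB : open (ball x (s x)) by exact: ball_open.
exists (ball x (s x) `|` U); split.
- exact: openU.
- by move=> y /Kl; rewrite big_cons => -[?|/U1 ?]; [left|right].
- move=> y [By|/U2//]; apply: sO; apply: le_ball By.
  by rewrite lerDl ltW.
- move=> i; apply: (@mean_cvgU _ L R mu q (ball x (s x)) U).
  + exact: open_measurable_rV.
  + exact: open_measurable_rV.
  + exact: mF.
  + exact: mg.
  + exact: (H x (s x) (s x)).
  + exact: U3.
Qed.

End sobolev_quotients.

(** * Truncation near zero and its chain rule *)

Section truncation.
Context {R : realType}.
Implicit Types (e a b t : R).

Definition hinge2 t : R := Num.max t 0 ^+ 2.

Lemma hinge2_taylor a b :
  `|hinge2 b - hinge2 a - 2 * Num.max a 0 * (b - a)| <= (b - a) ^+ 2.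
Proof.
have sq := sqr_ge0 (b - a); have sqb := sqr_ge0 b; have sqa := sqr_ge0 a.
rewrite /hinge2 ler_norml !expr2 in sq sqa sqb *.
have [a0|a0] := leP a 0; have [b0|b0] := leP b 0.
- by rewrite !mulr0 !mul0r !subr0; apply/andP; split; lra.
- have ab : a * b <= 0 by rewrite mulr_le0_ge0 // ltW.
  by apply/andP; split; nra.
- have ab : a * b <= 0 by rewrite mulr_ge0_le0 // ltW.
  by apply/andP; split; nra.
- by apply/andP; split; nra.
Qed.

(** An odd C^1 function with Lipschitz derivative [dtrunc e]: it is 0 on [-e, e], quadratic for e <=
    |t| <= 2e, and has slope 1 beyond. *)
Definition trunc e t : R :=
  (hinge2 (t - e) - hinge2 (t - 2 * e) - hinge2 (- t - e) + hinge2 (- t - 2 * e)) / (2 * e).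

Definition dtrunc e t : R :=
  (Num.max (t - e) 0 - Num.max (t - 2 * e) 0 + Num.max (- t - e) 0
   - Num.max (- t - 2 * e) 0) / e.

(** The quadratic remainder bound gives a chain rule directly for difference quotients. The four
    hinges contribute 4 (b - a)^2, divided by 2e. *)
Lemma trunc_taylor e a b : 0 < e ->
  `|trunc e b - trunc e a - dtrunc e a * (b - a)| <= 2 / e * (b - a) ^+ 2.
Proof.
move=> e0.
have := hinge2_taylor (a - e) (b - e); have := hinge2_taylor (a - 2 * e) (b - 2 * e).
have := hinge2_taylor (- a - e) (- b - e); have := hinge2_taylor (- a - 2 * e) (- b - 2 * e).
rewrite /trunc /dtrunc.
move: (hinge2 (a - e)) (hinge2 (b - e)) (hinge2 (a - 2 * e)) (hinge2 (b - 2 * e))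
  (hinge2 (- a - e)) (hinge2 (- b - e)) (hinge2 (- a - 2 * e)) (hinge2 (- b - 2 * e))
  (Num.max (a - e) 0) (Num.max (a - 2 * e) 0) (Num.max (- a - e) 0) (Num.max (- a - 2 * e) 0).
move=> A1 B1 A2 B2 A3 B3 A4 B4 M1 M2 M3 M4 h4 h3 h2 h1.
have E1 : - b - 2 * e - (- a - 2 * e) = - (b - a) by ring.
have E2 : - b - e - (- a - e) = - (b - a) by ring.
have E3 : b - 2 * e - (a - 2 * e) = b - a by ring.
have E4 : b - e - (a - e) = b - a by ring.
rewrite {}E1 sqrrN in h4; rewrite {}E2 sqrrN in h3; rewrite {}E3 in h2; rewrite {}E4 in h1.
move: (b - a) h1 h2 h3 h4 => d h1 h2 h3 h4.
have -> : (B1 - B2 - B3 + B4) / (2 * e) - (A1 - A2 - A3 + A4) / (2 * e)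
    - (M1 - M2 + M3 - M4) / e * d =
  (2 * e)^-1 * ((B1 - A1 - 2 * M1 * d) - (B2 - A2 - 2 * M2 * d)
   - (B3 - A3 - 2 * M3 * - d) + (B4 - A4 - 2 * M4 * - d)).
  by field; rewrite gt_eqF.
have -> : 2 / e * d ^+ 2 = (2 * e)^-1 * (4 * d ^+ 2) by field; rewrite gt_eqF.
have p : 0 < (2 * e)^-1 by rewrite invr_gt0 mulr_gt0.
rewrite normrM (gtr0_norm p) ler_pM2l//.
move: h1 h2 h3 h4; rewrite !ler_norml.
by move=> /andP[? ?] /andP[? ?] /andP[? ?] /andP[? ?]; apply/andP; split; lra.
Qed.

Lemma trunc_small e t : 0 < e -> `|t| <= e -> trunc e t = 0 /\ dtrunc e t = 0.
Proof.
move=> e0; rewrite ler_norml => /andP[h1 h2].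
by rewrite /trunc /dtrunc /hinge2 !max_r ?expr0n/=; [split; ring|lra..].
Qed.


Lemma dtrunc_norm_le1 e t : 0 < e -> `|dtrunc e t| <= 1.
Proof.
move=> e0; rewrite /dtrunc normrM normfV (gtr0_norm e0) ler_pdivrMr// mul1r.
rewrite ler_norml.
by have [?|?] := leP (t - e) 0; have [?|?] := leP (t - 2 * e) 0;
  have [?|?] := leP (- t - e) 0; have [?|?] := leP (- t - 2 * e) 0;
  apply/andP; split; lra.
Qed.

Lemma cvg_dtrunc t : dtrunc k.+1%:R^-1 t @[k --> \oo] --> ((t != 0)%:R : R).
Proof.
have [->|t0] := eqVneq t 0.
  rewrite (_ : (fun k => _) = cst 0); first exact: cvg_cst.
  by apply/funext => k; rewrite (trunc_small _ _).2 ?normr0 ?invr_ge0// invr_gt0.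
have E : \forall k \near \oo, 1 = dtrunc k.+1%:R^-1 t.
  near=> k.
  have e0 : 0 < k.+1%:R^-1 :> R by rewrite invr_gt0.
  have : 2 * k.+1%:R^-1 <= `|t|.
    rewrite ler_pdivrMr// mulrC -ler_pdivrMr ?normr_gt0//.
    apply: (@le_trans _ _ k%:R); last by rewrite ler_nat.
    by near: k; exact: nbhs_infty_ger.
  move: (k.+1%:R^-1) e0 => e e0 h; rewrite /dtrunc.
  have [tp|tn] := leP 0 t.
    rewrite (ger0_norm tp) in h.
    rewrite (max_l (x := t - e)) ?(max_l (x := t - 2 * e)) ?max_r; [|lra..].
    by field; rewrite gt_eqF.
  rewrite (ltr0_norm tn) in h.
  rewrite (max_l (x := - t - e)) ?(max_l (x := - t - 2 * e)) ?max_r; [|lra..].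
  by field; rewrite gt_eqF.
by apply: cvg_trans (near_eq_cvg E) _; exact: cvg_cst.
Unshelve. all: by end_near. Qed.

Lemma measurable_trunc d (T : measurableType d) e (f : T -> R) :
  measurable_fun setT f -> measurable_fun setT (fun x => trunc e (f x)).
Proof.
move=> mf.
have mN : measurable_fun setT (fun x => - f x) by exact: measurable_funN.
have mh (g : T -> R) (c : R) : measurable_fun setT g -> measurable_fun setT (fun x => hinge2 (g x - c : R)).
  move=> mg; apply: measurable_funX; apply: measurable_maxr => //.
  exact: measurable_funB.
apply: measurable_funM => //; apply: measurable_funD; last exact: mh.
by do 2?apply: measurable_funB; exact: mh.
Qed.

Lemma measurable_dtrunc d (T : measurableType d) e (f : T -> R) :
  measurable_fun setT f -> measurable_fun setT (fun x => dtrunc e (f x)).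
Proof.
move=> mf.
have mN : measurable_fun setT (fun x => - f x) by exact: measurable_funN.
have mh (g : T -> R) (c : R) : measurable_fun setT g -> measurable_fun setT (fun x => Num.max (g x - c : R) 0).
  by move=> mg; apply: measurable_maxr => //; exact: measurable_funB.
apply: measurable_funM => //; apply: measurable_funB; last exact: mh.
by apply: measurable_funD; last exact: mh; apply: measurable_funB; exact: mh.
Qed.

End truncation.

Section chain_rule.
Context {R : realType} {n : nat}.
Local Notation V := 'rV[R]_n.
Local Notation L := (lebesgue_space R n).
Local Notation mu := (@lebesgue_rV R n).

(** Outside U the truncation vanishes at x and at x + v, so there is nothing to estimate. In U,
    Taylor's formula bounds the error by that of the quotients of u plus a remainder proportional to
    |u(x + v) - u(x)|, small by uniform continuity. *)
Lemma trunc_diffq_cvg q (U : set V) (j : 'I_n) (u g : V -> R) (c : V) (r e : R) :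
  (0 < q)%N -> 0 < r -> continuous u -> (forall x, ~ ball c r x -> u x = 0) ->
  measurable_fun [set: L] (g : L -> R) -> (abs_pow_int mu q setT g < +oo)%E ->
  open U -> 0 < e -> (forall x, e / 2 <= `|u x| -> U x) ->
  @mean_cvg _ L R mu q U (fun h => diffq h j u) g ->
  @mean_cvg _ L R mu q setT (fun h => diffq h j (fun x => trunc e (u x)))
    (fun x => dtrunc e (u x) * g x).
Proof.
move=> q0 r0 cu u0 mg goo oU e0 eU H e' e'0.
have mU : measurable (U : set L) by exact: open_measurable_rV.
pose Cg := fine (abs_pow_int mu q U g).
have gU : (abs_pow_int mu q U g < +oo)%E.
  by apply: le_lt_trans goo; exact: (abs_pow_int_subset _ _ mU measurableT mg).
have CgE : abs_pow_int mu q U g = Cg%:E by rewrite fineK// ge0_fin_numE// abs_pow_int_ge0.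
have Cg0 : 0 <= Cg by rewrite -lee_fin -CgE abs_pow_int_ge0.
pose P : R := 2 ^+ q.
have P0 : 0 < P by rewrite exprn_gt0.
(* [th] bounds the relative size of the Taylor remainder; th <= 1 gives th^q <= th, and the second
   bound makes its contribution at most e' / 2. *)
pose th := Num.min 1 (e' / (2 * P * (Cg + 1))).
have th0 : 0 < th by rewrite lt_min ltr01/= divr_gt0// !mulr_gt0// ltr_wpDl.
have th1 : th <= 1 by rewrite ge_min lexx.
have thC : P * (th * Cg) <= e' / 2.
  have : th <= e' / (2 * P * (Cg + 1)) by rewrite ge_min lexx orbT.
  rewrite ler_pdivlMr ?mulr_gt0 ?ltr_wpDl// => h; rewrite ler_pdivlMr//.
  have pt : 0 <= P * th by rewrite mulr_ge0 // ltW.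
  by apply: le_trans h; lra.
pose kap := e' / (2 * P * P).
have kap0 : 0 < kap by rewrite divr_gt0// !mulr_gt0.
have [d1 d10 H1] := H _ kap0.
have w0 : 0 < Num.min (e / 2) (th * (e / 2)).
  by rewrite lt_min divr_gt0//= mulr_gt0// divr_gt0.
have [d2 d20 H2] := uniform_translate r0 cu u0 w0.
exists (Num.min d1 d2); first by rewrite lt_min d10.
move=> h h0; rewrite lt_min => /andP[hd1 hd2].
set v := h *: (delta_mx 0 j : V).
have vd2 : `|v| < d2 by apply: le_lt_trans (norm_delta_le _ _) _; rewrite gtr0_norm.
pose Q (x : V) := diffq h j (fun x => trunc e (u x)) x - dtrunc e (u x) * g x.
pose du (x : V) := diffq h j u x - g x.
have mu_ : measurable_fun [set: L] (u : L -> R) by exact: continuous_measurable_rV.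
have mdu : measurable_fun [set: L] (du : L -> R).
  apply: measurable_funB mg; apply: continuous_measurable_rV; exact: continuous_diffq.
have mt : measurable_fun [set: L] ((fun x => trunc e (u x)) : L -> R).
  exact: measurable_trunc.
have mQ : measurable_fun [set: L] (Q : L -> R).
  apply: measurable_funB.
    apply: measurable_funM; first exact: measurable_cst.
    by apply: (measurable_funB _ mt); exact: (measurable_translate v mt).
  apply: measurable_funM mg; exact: measurable_dtrunc.
(* Here |u x| < e / 2 and the increment is below e / 2, so both values lie in [-e, e], where the
   truncation is zero. *)
have Q0 x : ~ U x -> Q x = 0.
  move=> nU.
  have ux : `|u x| < e / 2 by rewrite ltNge; apply/negP => /eU.
  have uxv : `|u (x + v)| <= e.
    have := H2 v x vd2; rewrite lt_min => /andP[h1 _].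
    rewrite -[u (x + v)](subrK (u x)) (le_trans (ler_normD _ _))// [e]splitr.
    by rewrite lerD // ltW.
  have ux' : `|u x| <= e by rewrite (le_trans (ltW ux))// ler_pdivrMr// ler_pMr// ler1n.
  rewrite /Q /diffq -/v (trunc_small e0 ux').1 (trunc_small e0 ux').2 (trunc_small e0 uxv).1.
  by rewrite mul0r !subr0 mulr0.
have QU x : `|Q x| <= `|th * `|g x| + 2 * `|du x| |.
  have nn : 0 <= th * `|g x| + 2 * `|du x|.
    by apply: addr_ge0; apply: mulr_ge0 => //; exact: ltW.
  rewrite [leRHS](ger0_norm nn).
  have hw : 2 / e * `|u (x + v) - u x| <= th.
    have := H2 v x vd2; rewrite lt_min => /andP[_ /ltW h1].
    have -> : th = 2 / e * (th * (e / 2)) by field; rewrite gt_eqF.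
    by rewrite ler_pM2l// divr_gt0.
  have E : Q x = h^-1 * (trunc e (u (x + v)) - trunc e (u x) - dtrunc e (u x) * (u (x + v) - u x))
      + dtrunc e (u x) * du x.
    by rewrite /Q /du /diffq -/v; ring.
  have T1 : `|h^-1 * (trunc e (u (x + v)) - trunc e (u x) - dtrunc e (u x) * (u (x + v) - u x))|
      <= th * `|diffq h j u x|.
    rewrite /diffq -/v !normrM mulrCA ler_wpM2l//.
    apply: le_trans (trunc_taylor _ _ e0) _.
    rewrite -[X in _ * X]ger0_norm ?sqr_ge0// normrX expr2 mulrA.
    exact: ler_wpM2r.
  have T2 : `|dtrunc e (u x) * du x| <= `|du x|.
    by rewrite normrM ler_piMl// dtrunc_norm_le1.
  have T3 : `|diffq h j u x| <= `|g x| + `|du x|.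
    by rewrite -[diffq h j u x](subrKC (g x)) ler_normD.
  have T4 : th * `|diffq h j u x| <= th * `|g x| + `|du x|.
    apply: (@le_trans _ _ (th * (`|g x| + `|du x|))); first by rewrite ler_wpM2l// ltW.
    by rewrite mulrDr lerD2l ler_piMl.
  by rewrite E (le_trans (ler_normD _ _))//; lra.
rewrite -/Q (abs_pow_int_support_rV q0 Q0).
have mag : measurable_fun (U : set L) ((fun x => `|g x|) : L -> R).
  by apply: measurable_funTS; exact: measurableT_comp.
have madu : measurable_fun (U : set L) ((fun x => `|du x|) : L -> R).
  by apply: measurable_funTS; exact: measurableT_comp.
have m1 : measurable_fun (U : set L) ((fun x => th * `|g x|) : L -> R).
  by apply: measurable_funM mag; exact: measurable_cst.
have m2 : measurable_fun (U : set L) ((fun x => 2 * `|du x|) : L -> R).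
  by apply: measurable_funM madu; exact: measurable_cst.
apply: le_trans.
  apply: (@abs_pow_int_le _ L R mu q U Q (fun x => th * `|g x| + 2 * `|du x|) mU).
  - exact: measurable_funTS.
  - exact: measurable_funD.
  - by move=> x _; exact: QU.
apply: le_trans; first exact: (abs_pow_intD _ _ mU m1 m2).
rewrite (abs_pow_intZ _ _ _ mU mag) (abs_pow_intZ _ _ _ mU madu).
rewrite (@eq_abs_pow_int _ L R mu q U _ g) => [|x _]; last exact: normr_id.
rewrite (@eq_abs_pow_int _ L R mu q U (fun x => `|du x|) du) => [|x _]; last exact: normr_id.
rewrite CgE (gtr0_norm th0) ger0_norm//.
have I1 := H1 h h0 hd1.
apply: (@le_trans _ _ (P%:E * ((th ^+ q)%:E * Cg%:E + P%:E * kap%:E))%E).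
  apply: lee_wpmul2l; first by rewrite lee_fin ltW.
  by apply: leeD => //; apply: lee_wpmul2l => //; rewrite lee_fin ltW.
rewrite -(EFinM (th ^+ q)) -(EFinM P kap) -EFinD -EFinM lee_fin [e']splitr mulrDr lerD//.
  apply: le_trans thC; rewrite ler_pM2l// ler_wpM2r//.
  by case: (q) q0 => // k _; rewrite exprS ler_piMr ?exprn_ile1// ltW.
have -> : P * (P * kap) = e' / 2 by rewrite /kap; field; rewrite gt_eqF.
exact: lexx.
Qed.

(** The derivative vanishes almost everywhere on the zero set Z of w. At x in Z, either x + v is in
    Z and the difference quotient is 0, so |g(x)| is the error of the quotient; or x + v is outside
    Z and |g(x)| is the increment of 1_Z g. Both are small in L^q, the second by continuity of
    translations. *)
Lemma zero_level q (B : set V) (j : 'I_n) (w g : V -> R) (c : V) (r : R) :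
  (0 < q)%N -> 0 < r -> open B -> continuous w ->
  measurable_fun [set: L] (g : L -> R) -> (forall x, ~ ball c r x -> g x = 0) ->
  (abs_pow_int mu q setT g < +oo)%E ->
  @mean_cvg _ L R mu q B (fun h => diffq h j w) g ->
  abs_pow_int mu q B (fun x => \1_[set x | w x = 0] x * g x) = 0%E.
Proof.
move=> q0 r0 oB cw mg g0 goo H.
have mB : measurable (B : set L) by exact: open_measurable_rV.
have mw : measurable_fun [set: L] (w : L -> R) by exact: continuous_measurable_rV.
pose Z := [set x | w x = 0].
have mZ : measurable (Z : set L).
  apply: closed_measurable_rV; apply: ((continuous_closedP w).1 cw [set y | y = 0]).
  exact: closed_eq.
pose k (x : V) : R := \1_Z x * g x.
have mk : measurable_fun [set: L] (k : L -> R).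
  by apply: measurable_funM mg; exact: measurable_indic.
have k0 x : ~ ball c r x -> k x = 0 by move=> nB; rewrite /k g0// mulr0.
have kg x : `|k x| <= `|g x|.
  by rewrite normrM ler_piMl// indicE; case: (_ \in _); rewrite ?normr1 ?normr0.
have koo : (abs_pow_int mu q setT k < +oo)%E.
  by apply: le_lt_trans goo; exact: (@abs_pow_int_le _ L R mu q setT k g measurableT mk mg (fun x _ => kg x)).
rewrite -/k.
suff S e : 0 < e -> (abs_pow_int mu q B k <= e%:E)%E.
  apply/eqP; rewrite eq_le abs_pow_int_ge0 andbT.
  by apply/lee_addgt0Pr => e e0; rewrite add0e S.
move=> e0.
pose kap := e / (2 ^+ q * 2).
have kap0 : 0 < kap by rewrite divr_gt0// mulr_gt0// exprn_gt0.
have [d1 d10 H1] := H _ kap0.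
have [d2 d20 H2] := translation_continuity q0 r0 mk k0 koo kap0.
pose h := Num.min d1 d2 / 2.
have m0 : 0 < Num.min d1 d2 by rewrite lt_min d10.
have h0 : 0 < h by rewrite divr_gt0.
have hm : h < Num.min d1 d2 by rewrite ltr_pdivrMr// ltr_pMr// ltr1n.
have [hd1 hd2] : h < d1 /\ h < d2 by move: hm; rewrite lt_min => /andP.
pose v := h *: (delta_mx 0 j : V).
have vd2 : `|v| < d2 by apply: le_lt_trans (norm_delta_le _ _) _; rewrite gtr0_norm.
pose f1 (x : V) := `|diffq h j w x - g x|.
pose f2 (x : V) := `|k (x + v) - k x|.
have md : measurable_fun [set: L] ((fun x : V => diffq h j w x - g x) : L -> R).
  by apply: (measurable_funB _ mg); apply: continuous_measurable_rV; exact: continuous_diffq.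
have mkv : measurable_fun [set: L] ((fun x : V => k (x + v) - k x) : L -> R).
  by apply: (measurable_funB _ mk); exact: (measurable_translate v mk).
have m1 : measurable_fun (B : set L) (f1 : L -> R).
  by apply: measurable_funTS; exact: measurableT_comp.
have m2 : measurable_fun (B : set L) (f2 : L -> R).
  by apply: measurable_funTS; exact: measurableT_comp.
apply: le_trans.
  apply: (@abs_pow_int_le _ L R mu q B k (fun x => f1 x + f2 x) mB).
  - exact: measurable_funTS.
  - exact: measurable_funD.
  - move=> x _.
    have f10 : 0 <= f1 x by exact: normr_ge0.
    have f20 : 0 <= f2 x by exact: normr_ge0.
    rewrite [leRHS](ger0_norm (addr_ge0 f10 f20)).
    have [Zx|nZx] := pselect (Z x); last first.
      by rewrite {1}/k indicE memNset// mul0r normr0 addr_ge0.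
    have kx : k x = g x by rewrite /k indicE mem_set// mul1r.
    have [Zxv|nZxv] := pselect (Z (x + v)).
      rewrite kx; apply: (ler_wpDr f20); rewrite /f1 /diffq -/v.
      by rewrite (Zxv : w _ = 0) (Zx : w _ = 0) subrr mulr0 sub0r normrN.
    by apply: (ler_wpDl f10); rewrite /f2 {2}/k indicE memNset// mul0r sub0r normrN.
apply: le_trans; first exact: (abs_pow_intD _ _ mB m1 m2).
apply: (@le_trans _ _ ((2 ^+ q)%:E * (kap%:E + kap%:E))%E); last first.
  rewrite -EFinD -EFinM lee_fin.
  have -> : kap + kap = e / 2 ^+ q by rewrite /kap; field; rewrite gt_eqF// exprn_gt0.
  by rewrite mulrC divfK// gt_eqF// exprn_gt0.
apply: lee_wpmul2l; first by rewrite lee_fin exprn_ge0.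
apply: leeD.
  rewrite (@eq_abs_pow_int _ L R mu q B _ (fun x => diffq h j w x - g x)) => [|x _]; last exact: normr_id.
  exact: H1.
rewrite (@eq_abs_pow_int _ L R mu q B _ (fun x => k (x + v) - k x)) => [|x _]; last exact: normr_id.
apply: le_trans (H2 v vd2).
exact: (abs_pow_int_subset _ _ mB measurableT mkv).
Qed.

End chain_rule.

(** * The discrete determinant as an exact null Lagrangian *)

Section telescoping.
Context {R : comNzRingType}.

Lemma prod_telescope m (a b : 'I_m -> R) :
  \prod_i b i - \prod_i a i =
  \sum_(l < m) \prod_(i < m) (if (i < l)%N then a i
    else if i == l then b i - a i else b i).
Proof.
pose f (l : nat) := \prod_(i < m) (if (i < l)%N then a i else b i).
have -> : \prod_i b i = f 0 by [].
have -> : \prod_i a i = f m by apply: eq_bigr => i _; rewrite ltn_ord.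
rewrite -opprB -(telescope_sumr _ (leq0n m)) -sumrN big_mkord.
apply: eq_bigr => l _; rewrite opprB /f (bigD1 l)//= [X in _ - X](bigD1 l)//=.
rewrite [RHS](bigD1 l)//= ltnn eqxx leqnn mulrBl.
congr (_ * _ - _ * _); apply: eq_bigr => i il; rewrite (negbTE il)//.
by rewrite ltnS leq_eqVlt (negbTE (il : val i != val l)).
Qed.

End telescoping.

Section alternating.
Context {R : numDomainType}.

(** Composition with the transposition pairs permutations of opposite sign with equal F. *)
Lemma alternating_sum0 m (l p : 'I_m) (F : {perm 'I_m} -> R) : l != p ->
  (forall s, F (tperm l p * s)%g = F s) -> \sum_(s : 'S_m) (-1) ^+ s * F s = 0.
Proof.
move=> lp FE; set S := LHS.
have : S = - S.
  rewrite {1}/S (reindex_inj (mulgI (tperm l p))) /= -sumrN.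
  by apply: eq_bigr => s _; rewrite FE odd_mul_tperm lp signr_addb mulN1r mulNr.
by move/eqP; rewrite -addr_eq0 -mulr2n mulrn_eq0 => /eqP.
Qed.

End alternating.

Section discrete_determinant.
Context {R : numFieldType} {V : zmodType} {m : nat}.
Variables (c : R) (e : 'I_m -> V) (w : 'I_m -> V -> R).
Implicit Types (s : 'S_m) (x : V) (a b : nat) (i j k l p : 'I_m).

(** The displacement along steps a, ..., b - 1 of the lattice path that moves by e(s 0), then e(s
    1), and so on. *)
Definition step_sum a b s : V := \sum_(k < m | (a <= k < b)%N) e (s k).

Definition id_diff k j x : R := (k == j)%:R + c * (w k (x + e j) - w k x).

(** The cubical cup product of the discrete differentials of x_i + w_i, when c = 1/h and e j is h
    times a basis vector: the i-th factor is read at the point reached after the first i steps of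
    the path of s. This staggering makes the discrete product rule exact. *)
Definition discrete_det x : R :=
  \sum_(s : 'S_m) (-1) ^+ s * \prod_i id_diff i (s i) (x + step_sum 0 i s).

(** The factor multiplying the difference of w_l when rows before l are already those of the
    identity. The index a records where the path starts: a = l includes step l, a = l + 1 omits
    it. *)
Definition discrete_cofactor l a s x : R :=
  \prod_(i < m) (if (i < l)%N then (i == s i)%:R else if i == l then 1
           else id_diff i (s i) (x + step_sum a i s)).

Lemma step_sum_cat a b d s : (a <= b)%N -> (b <= d)%N ->
  step_sum a d s = step_sum a b s + step_sum b d s.
Proof.
move=> ab bd; rewrite /step_sum (bigID (fun k : 'I_m => (k < b)%N)) /=.
by congr (_ + _); apply: eq_bigl => k; lia.
Qed.

Lemma step_sumS k s : step_sum k k.+1 s = e (s k).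
Proof.
rewrite /step_sum (big_pred1 k)// => i.
by rewrite ltnS -eqn_leq eq_sym.
Qed.

Lemma step_sum_tperm a b l p s :
  (a <= l < b)%N = (a <= p < b)%N ->
  step_sum a b (tperm l p * s)%g = step_sum a b s.
Proof.
move=> lp; rewrite /step_sum [RHS](reindex_inj (@perm_inj _ (tperm l p))) /=.
apply: eq_big => [k|k _]; last by rewrite permM.
by case: tpermP => [->|->|]//.
Qed.

(** The discrete form of d d w = 0. Telescoping the effect of step l over the later rows p produces
    mixed second differences, symmetric in the two directions, which the alternating sum cancels. *)
Lemma discrete_cofactor_alternating l x :
  \sum_(s : 'S_m) (-1) ^+ s *
    (discrete_cofactor l l s x - discrete_cofactor l l.+1 s x) = 0.
Proof.
under eq_bigr => s _ do rewrite /discrete_cofactor prod_telescope mulr_sumr.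
rewrite exchange_big big1 //= => p _.
have [pl|lp] := leqP p l.
  apply: big1 => s _; rewrite (bigD1 p)//= ltnn eqxx.
  case: ltnP => [_|lp]; first by rewrite subrr mul0r mulr0.
  (* Not reached for p > l; for p = l the two factors are both 1. *)
  have -> : p == l by apply/eqP/val_inj/eqP; rewrite eqn_leq pl.
  by rewrite subrr mul0r mulr0.
apply: (alternating_sum0 (l := l) (p := p)) => [|s].
  by rewrite neq_ltn lp.
apply: eq_bigr => i _.
have [il|li|/val_inj ->] := ltngtP i l.
- rewrite (ltn_trans il lp) permM tpermD//.
    by rewrite -val_eqE /= neq_ltn il orbT.
  by rewrite -val_eqE /= neq_ltn (ltn_trans il lp) orbT.
- have -> : (i == l) = false by apply/negbTE; rewrite -val_eqE /= neq_ltn li orbT.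
  have [ip|pi|/val_inj ->] := ltngtP i p.
  + rewrite permM tpermD; last 2 first.
      by rewrite -val_eqE /= neq_ltn li.
      by rewrite -val_eqE /= neq_ltn ip orbT.
    rewrite step_sum_tperm => [//|]; lia.
  + have -> : (i == p) = false by apply/negbTE; rewrite -val_eqE /= neq_ltn pi orbT.
    rewrite permM tpermD; last 2 first.
      by rewrite -val_eqE /= neq_ltn li.
      by rewrite -val_eqE /= neq_ltn pi.
    rewrite step_sum_tperm => [//|]; lia.
  rewrite eqxx !permM !tpermR !(step_sum_cat _ (leqnSn l) lp) !step_sumS.
  rewrite step_sum_tperm; last lia.
  rewrite permM tpermL /id_diff ![_ + (e _ + _)]addrCA ![e _ + _]addrC.
  by rewrite (addrAC _ (e (s p)) (e (s l))); ring.
- by rewrite lp eqxx.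
Qed.

Lemma discrete_cofactor_shift l a s x : (l <= a <= l.+1)%N ->
  discrete_cofactor l a s (x + step_sum 0 a s) = discrete_cofactor l 0 s x.
Proof.
move=> la; apply: eq_bigr => i _; case: ifPn => // il; case: ifPn => // il'.
rewrite -addrA -step_sum_cat//; have := il'; rewrite -val_eqE /=; lia.
Qed.

Definition cofactor_term l a s x : R := w l x * discrete_cofactor l a s x.

(** The rows are turned into identity rows one at a time; at stage l, row l is a pure difference of
    w_l. The discrete product rule turns w_l-difference times cofactor into increments of
    [cofactor_term], up to w_l(x) times the difference of the cofactors started at l and l + 1,
    whose alternating sum is 0. Only increments F(x + v) - F(x) remain, which integrate to 0. *)
Lemma discrete_det_sub1 x : discrete_det x - 1 =
  \sum_l \sum_(s : 'S_m) (-1) ^+ s * (c *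
    ((cofactor_term l l.+1 s (x + step_sum 0 l.+1 s) - cofactor_term l l.+1 s x) -
     (cofactor_term l l s (x + step_sum 0 l s) - cofactor_term l l s x))).
Proof.
rewrite -[X in _ - X = _](det1 R m) /determinant /discrete_det -sumrB.
under eq_bigr => s _.
  rewrite -mulrBr [X in _ * (_ - X)](eq_bigr (fun i : 'I_m => (i == s i)%:R : R)); last first.
    by move=> i _; rewrite mxE.
  rewrite prod_telescope mulr_sumr; over.
rewrite exchange_big; apply: eq_bigr => l _ /=.
apply/eqP; rewrite -subr_eq0 -sumrB; apply/eqP.
have alt : (0 : R) = - (c * w l x) * \sum_(s : 'S_m) (-1) ^+ s *
    (discrete_cofactor l l s x - discrete_cofactor l l.+1 s x).
  by rewrite discrete_cofactor_alternating mulr0.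
rewrite [RHS]alt mulr_sumr.
apply: eq_bigr => s _.
rewrite /cofactor_term !discrete_cofactor_shift ?leqnn ?leqnSn//.
rewrite (step_sum_cat s (leq0n l) (leqnSn l)) step_sumS.
have -> : \prod_(i < m) (if (i < l)%N then (i == s i)%:R else if i == l
    then id_diff i (s i) (x + step_sum 0 i s) - (i == s i)%:R
    else id_diff i (s i) (x + step_sum 0 i s)) =
    c * (w l (x + step_sum 0 l s + e (s l)) - w l (x + step_sum 0 l s)) *
    discrete_cofactor l 0 s x.
  rewrite /discrete_cofactor [LHS](bigD1 l)//= [X in _ = _ * X](bigD1 l)//= ltnn eqxx mul1r {1}/id_diff addrAC subrr add0r.
  by congr (_ * _); apply: eq_bigr => i /negbTE ->.
rewrite -addrA; move: ((-1) ^+ _) (w l (x + (_ + _))) (w l (x + _)) (w l x).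
move: (discrete_cofactor l 0 s x) (discrete_cofactor l l s x)
  (discrete_cofactor l l.+1 s x) => D0 D1 D2 S A B C.
ring.
Qed.

End discrete_determinant.

Section discrete_null_lagrangian.
Context {R : realType} {n : nat}.
Local Notation V := 'rV[R]_n.
Local Notation L := (lebesgue_space R n).
Local Notation mu := (@lebesgue_rV R n).

Definition bounded_measurable (g : V -> R) :=
  measurable_fun [set: L] (g : L -> R) /\ exists M, forall x, `|g x| <= M.

Lemma bounded_measurable_cst (a : R) : bounded_measurable (fun _ => a).
Proof. by split; [exact: measurable_cst|exists `|a|]. Qed.

Lemma bounded_measurableD (f g : V -> R) : bounded_measurable f ->
  bounded_measurable g -> bounded_measurable (fun x => f x + g x).
Proof.
move=> [mf [M fM]] [mg [N gN]]; split; first exact: (measurable_funD mf mg).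
by exists (M + N) => x; apply: le_trans (ler_normD _ _) _; exact: lerD.
Qed.

Lemma bounded_measurableM (f g : V -> R) : bounded_measurable f ->
  bounded_measurable g -> bounded_measurable (fun x => f x * g x).
Proof.
move=> [mf [M fM]] [mg [N gN]]; split; first exact: (measurable_funM mf mg).
by exists (M * N) => x; rewrite normrM; exact: ler_pM.
Qed.

Lemma bounded_measurable_translate (v : V) (f : V -> R) : bounded_measurable f ->
  bounded_measurable (fun x => f (x + v)).
Proof.
move=> [mf [M fM]]; split; first exact: (measurable_translate v mf).
by exists M => x.
Qed.

Lemma bounded_measurable_prod (I : Type) (s : seq I) (f : I -> V -> R) :
  (forall i, bounded_measurable (f i)) ->
  bounded_measurable (fun x => \prod_(i <- s) f i x).
Proof.
move=> bf; elim: s => [|i s ih].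
  rewrite (_ : (fun _ => _) = (fun _ => 1)); first exact: bounded_measurable_cst.
  by apply/funext => x; rewrite big_nil.
rewrite (_ : (fun _ => _) = (fun x => f i x * \prod_(j <- s) f j x)).
  by apply: bounded_measurableM.
by apply/funext => x; rewrite big_cons.
Qed.

Definition null_integral (g : V -> R) :=
  mu.-integrable [set: L] (EFin \o g) /\ (\int[mu]_x (g x)%:E = 0)%E.

Lemma null_integral0 : null_integral (fun _ => 0).
Proof. by split; [exact: integrable0|exact: integral0]. Qed.

Lemma null_integralD (f g : V -> R) : null_integral f -> null_integral g ->
  null_integral (fun x => f x + g x).
Proof.
move=> [If f0] [Ig g0]; split.
  exact: (@integrableD _ L R mu setT measurableT _ _ If Ig).
have := @integralD_EFin _ L R mu setT measurableT f g If Ig.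
by rewrite f0 g0 adde0.
Qed.

Lemma null_integralZ (a : R) (f : V -> R) : null_integral f ->
  null_integral (fun x => a * f x).
Proof.
move=> [If f0]; split.
  exact: (@integrableZl _ L R mu setT measurableT a _ If).
have := @integralZl _ L R mu setT measurableT _ If a.
by rewrite f0 mule0.
Qed.

Lemma null_integral_sum (I : Type) (s : seq I) (f : I -> V -> R) :
  (forall i, null_integral (f i)) -> null_integral (fun x => \sum_(i <- s) f i x).
Proof.
move=> bf; elim: s => [|i s ih].
  rewrite (_ : (fun _ => _) = (fun _ => 0)); first exact: null_integral0.
  by apply/funext => x; rewrite big_nil.
rewrite (_ : (fun _ => _) = (fun x => f i x + \sum_(j <- s) f j x)).
  by apply: null_integralD.
by apply/funext => x; rewrite big_cons.
Qed.

Lemma null_integral_translate (v : V) (f : V -> R) :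
  mu.-integrable [set: L] (EFin \o f) -> null_integral (fun x => f (x + v) - f x).
Proof.
move=> If.
have Ifv : mu.-integrable [set: L] (EFin \o (fun x => f (x + v))).
  exact: (integrable_shift v If).
split; first exact: (@integrableB _ L R mu setT measurableT _ _ Ifv If).
have -> : (\int[mu]_x (f (x + v) - f x)%:E =
    \int[mu]_x (f (x + v))%:E - \int[mu]_x (f x)%:E)%E.
  exact: (@integralB_EFin _ L R mu setT (fun x : V => f (x + v)) f measurableT Ifv If).

rewrite (integral_shift v If) subee//.
exact: (integrable_fin_num measurableT If).
Qed.

(** Each cofactor term is bounded, measurable and supported where w_l is, hence integrable; its
    increments have integral 0 by translation invariance. *)
Lemma discrete_det_integral m (c : R) (e : 'I_m -> V) (w : 'I_m -> V -> R)
    (c0 : V) (r : R) : 0 < r ->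
  (forall k, bounded_measurable (w k)) ->
  (forall k x, ~ ball c0 r x -> w k x = 0) ->
  null_integral (fun x => discrete_det c e w x - 1).
Proof.
move=> r0 bw w0.
rewrite (funext (discrete_det_sub1 c e w)).
apply: null_integral_sum => l; apply: null_integral_sum => s.
have bd k j : bounded_measurable (id_diff c e w k j).
  apply: bounded_measurableD; first exact: bounded_measurable_cst.
  apply: bounded_measurableM; first exact: bounded_measurable_cst.
  apply: bounded_measurableD; first exact: bounded_measurable_translate.
  rewrite (_ : (fun x => - w k x) = (fun x => (-1) * w k x)).
    by apply: bounded_measurableM; [exact: bounded_measurable_cst|exact: bw].
  by apply/funext => x; rewrite mulN1r.
have bt a : mu.-integrable [set: L] (EFin \o cofactor_term c e w l a s).
  have [mt [M tM]] : bounded_measurable (cofactor_term c e w l a s).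
    apply: bounded_measurableM; first exact: bw.
    apply: bounded_measurable_prod => i.
    case: (i < l)%N; first exact: bounded_measurable_cst.
    case: (i == l); first exact: bounded_measurable_cst.
    exact: bounded_measurable_translate.
  apply: (bounded_supp_integrable (c := c0) r0 mt _ tM) => x nx.
  by rewrite /cofactor_term (w0 _ _ nx) mul0r.
do 2 apply: null_integralZ.
apply: null_integralD; first exact: (null_integral_translate _ (bt _)).
rewrite (_ : (fun x => - _) = (fun x => (-1) *
  (cofactor_term c e w l l s (x + step_sum e 0 l s) - cofactor_term c e w l l s x))).
  apply: null_integralZ; exact: (null_integral_translate _ (bt _)).
by apply/funext => x; rewrite mulN1r.
Qed.

End discrete_null_lagrangian.

(** * Stability of products and determinants in the mean *)

Section product_bounds.
Context {R : realType}.

(** Takes the place of Hoelder's inequality for m + 1 factors: compare every factor with the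
    largest. *)
Lemma prod_le_sum_pow m (z : 'I_m.+1 -> R) : (forall i, 0 <= z i) ->
  \prod_i z i <= \sum_i z i ^+ m.+1.
Proof.
move=> z0; pose k := [arg max_(i > ord0) z i]%O.
have zk i : z i <= z k by rewrite /k; case: arg_maxP => // j _; exact.
apply: (@le_trans _ _ (z k ^+ m.+1)).
  rewrite -[X in _ <= _ ^+ X](card_ord m.+1) -prodr_const.
  by apply: ler_prod => i _; rewrite z0 zk.
rewrite (bigD1 k)//= lerDl; apply: sumr_ge0 => i _; exact: exprn_ge0.
Qed.

(** In each telescoped term the perturbed factor gets the weight t^-m and the m others the weight t,
    so the weights multiply to 1 before [prod_le_sum_pow] is applied. A small t controls the first
    sum, and then small d the second. *)
Lemma prod_diff_le m (b d : 'I_m.+1 -> R) (t : R) : 0 < t ->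
  `|\prod_i (b i + d i) - \prod_i b i| <=
  m.+1%:R * (t ^+ m.+1 * \sum_i 2 ^+ m.+1 * (`|b i| ^+ m.+1 + `|d i| ^+ m.+1))
  + (t ^- m) ^+ m.+1 * \sum_i `|d i| ^+ m.+1.
Proof.
move=> t0; rewrite prod_telescope; apply: le_trans (ler_norm_sum _ _ _) _.
pose S := t ^+ m.+1 * \sum_i 2 ^+ m.+1 * (`|b i| ^+ m.+1 + `|d i| ^+ m.+1).
rewrite -/S; have -> : m.+1%:R * S = \sum_(l < m.+1) S.
  by rewrite sumr_const card_ord mulr_natl.
rewrite [X in _ + X]mulr_sumr -big_split/=.
apply: ler_sum => l _; rewrite normr_prod.
pose z i := if i == l then t ^- m * `|d l| else t * (`|b i| + `|d i|).
have tm : 0 < t ^- m by rewrite invr_gt0 exprn_gt0.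
have z0 i : 0 <= z i.
  by rewrite /z; case: ifP => _; rewrite mulr_ge0// ?addr_ge0// ltW.
apply: (@le_trans _ _ (\prod_i z i)).
  rewrite (bigD1 l)//= [leRHS](bigD1 l)//= ltnn eqxx /z eqxx addrAC subrr add0r.
  rewrite [t ^- m * _]mulrC -[leRHS]mulrA ler_wpM2l//.
  rewrite [X in _ <= _ * X](eq_bigr (fun i : 'I_m.+1 => t * (`|b i| + `|d i|))); last first.
    by move=> i /negbTE ->.
  rewrite big_split/= prodr_const mulrA.
  have -> : #|[pred i : 'I_m.+1 | i != l]| = m.
    by have := cardC1 l; rewrite card_ord /= => ->.
  rewrite mulVf ?mul1r ?expf_neq0 ?gt_eqF//.
  apply: ler_prod => i il; rewrite normr_ge0/= (negbTE il).
  by case: ifP => _; rewrite ?ler_normD// lerDl.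
apply: le_trans (prod_le_sum_pow z0) _.
rewrite (bigD1 l)//= /z eqxx exprMn addrC lerD2r.
rewrite /S mulr_sumr [leRHS](bigD1 l)//=.
apply: ler_wpDl.
  by rewrite !mulr_ge0 ?addr_ge0 ?exprn_ge0// ltW.
apply: ler_sum => i /negbTE ->; rewrite exprMn ler_wpM2l ?exprn_ge0 ?(ltW t0)//.
have := normD_pow_le m.+1 `|b i| `|d i|.
by rewrite !normr_id (ger0_norm (addr_ge0 _ _)).
Qed.

End product_bounds.

Section product_integrals.
Context d (T : measurableType d) (R : realType) (mu : {measure set T -> \bar R}).
Variable D : set T.
Hypothesis mD : measurable D.

Lemma int_le_mono (f g : T -> R) (x y : R) : measurable_fun D f ->
  (forall t, 0 <= f t) -> (forall t, f t <= g t) -> x <= y ->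
  int_le mu D g x -> int_le mu D f y.
Proof.
move=> mf f0 fg xy [mg g0 gx]; split => //.
apply: (@le_trans _ _ x%:E); last by rewrite lee_fin.
apply: le_trans gx; apply: ge0_le_integral => //; try exact/measurable_EFinP.
all: by move=> t _; rewrite lee_fin.
Qed.

Lemma int_le_sum (I : Type) (s : seq I) (f : I -> T -> R) (x : I -> R) :
  (forall i, int_le mu D (f i) (x i)) ->
  int_le mu D (fun t => \sum_(i <- s) f i t) (\sum_(i <- s) x i).
Proof.
move=> fx; elim: s => [|i s ih].
  rewrite big_nil (_ : (fun _ => _) = (fun _ => 0)).
    by split => //; rewrite integral0.
  by apply/funext => t; rewrite big_nil.
rewrite big_cons (_ : (fun _ => _) = (fun t => f i t + \sum_(j <- s) f j t)).
  exact: int_leD.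
by apply/funext => t; rewrite big_cons.
Qed.

Lemma prod_integrable m (b : 'I_m.+1 -> T -> R) :
  (forall i, measurable_fun D (b i)) ->
  (forall i, abs_pow_int mu m.+1 D (b i) < +oo)%E ->
  mu.-integrable D (EFin \o (fun t => \prod_i b i t)).
Proof.
move=> mb boo; apply: (@le_integrable _ T R mu D mD _
  (EFin \o (fun t => \sum_i `|b i t| ^+ m.+1))).
- by apply/measurable_EFinP; exact: measurable_prod.
- move=> t _ /=; rewrite lee_fin normr_prod ger0_norm.
    by apply: prod_le_sum_pow => i.
  by apply: sumr_ge0 => i _; exact: exprn_ge0.
- apply: (@int_le_integrable _ _ _ _ _ _ (\sum_i fine (abs_pow_int mu m.+1 D (b i)))).
  apply: int_le_sum => i; apply: int_le_abs_pow => //.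
  by rewrite fineK// ge0_fin_numE// abs_pow_int_ge0.
Qed.

Lemma prod_close m (b : 'I_m.+1 -> T -> R) (e : R) : 0 < e ->
  (forall i, measurable_fun D (b i)) ->
  (forall i, abs_pow_int mu m.+1 D (b i) < +oo)%E ->
  exists2 dt, 0 < dt & forall c : 'I_m.+1 -> T -> R,
    (forall i, measurable_fun D (c i)) ->
    (forall i, abs_pow_int mu m.+1 D (c i) <= dt%:E)%E ->
    int_le mu D (fun t => `|\prod_i (b i t + c i t) - \prod_i b i t|) e.
Proof.
move=> e0 mb boo.
pose B := \sum_i fine (abs_pow_int mu m.+1 D (b i)).
have B0 : 0 <= B.
  by apply: sumr_ge0 => i _; apply: fine_ge0; exact: abs_pow_int_ge0.
have M0 : 0 < m.+1%:R :> R by [].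
pose K := m.+1%:R * (2 ^+ m.+1 * (B + m.+1%:R)).
have K0 : 0 < K by rewrite !mulr_gt0 ?exprn_gt0 ?ltr_wpDl.
(* This gives t <= 1 and K t <= e / 2 at once; [dt] is then chosen against the large factor [C]. *)
pose t := e / (2 * K + e).
have den0 : 0 < 2 * K + e by rewrite addr_gt0// mulr_gt0.
have t0 : 0 < t by rewrite divr_gt0.
have t1 : t <= 1 by rewrite ler_pdivrMr// mul1r lerDr mulr_ge0 ?ltW.
have Kt : K * t <= e / 2.
  rewrite /t mulrCA ler_pM2l// ler_pdivrMr//; lra.
pose C := (t ^- m) ^+ m.+1.
have C0 : 0 < C by rewrite exprn_gt0// invr_gt0 exprn_gt0.
pose dt := Num.min 1 (e / 2 / (C * m.+1%:R)).
have dt0 : 0 < dt by rewrite lt_min ltr01 !divr_gt0// mulr_gt0.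
have dt1 : dt <= 1 by rewrite ge_min lexx.
have Cdt : C * (m.+1%:R * dt) <= e / 2.
  rewrite mulrA mulrC -ler_pdivlMr ?mulr_gt0//.
  by rewrite ge_min lexx orbT.
exists dt => // c mc cd.
pose x i := 2 ^+ m.+1 * (fine (abs_pow_int mu m.+1 D (b i)) + dt).
have bx i : int_le mu D
    (fun t => 2 ^+ m.+1 * (`|b i t| ^+ m.+1 + `|c i t| ^+ m.+1)) (x i).
  apply: int_leZ => //; apply: int_leD => //; apply: int_le_abs_pow => //.
  by rewrite fineK// ge0_fin_numE// abs_pow_int_ge0.
have cx i : int_le mu D (fun t => `|c i t| ^+ m.+1) dt by exact: int_le_abs_pow.
have t0' : 0 <= t ^+ m.+1 by rewrite exprn_ge0 ?ltW.
have H := int_leD mD (int_leZ mD (ltW M0) (int_leZ mD t0' (int_le_sum (index_enum 'I_m.+1) bx)))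
  (int_leZ mD (ltW C0) (int_le_sum (index_enum 'I_m.+1) cx)).
apply: int_le_mono H => //.
- apply: measurableT_comp => //; apply: measurable_funB.
    by apply: measurable_prod => i _; exact: measurable_funD.
  exact: measurable_prod.
- by move=> y; exact: prod_diff_le.
- rewrite sumr_const card_ord -[dt *+ _]mulr_natl -/C.
  suff : m.+1%:R * (t ^+ m.+1 * \sum_i x i) <= K * t.
    by move=> H1; rewrite [leRHS](splitr e) lerD// (le_trans H1).
  have -> : \sum_i x i = 2 ^+ m.+1 * (B + m.+1%:R * dt).
    by rewrite /x -mulr_sumr big_split/= sumr_const card_ord mulr_natl.
  rewrite /K -[leRHS]mulrA ler_wpM2l// mulrC ler_pM//.
  + by have := ltW dt0 => dt0'; rewrite mulr_ge0 ?exprn_ge0 ?addr_ge0 ?mulr_ge0.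
  + by rewrite ler_wpM2l ?exprn_ge0// lerD2l ler_piMr.
  + by have := ltW t0 => t0''; rewrite exprS ler_piMr// exprn_ile1.
Qed.

End product_integrals.

Section finite_thresholds.
Context {R : realType}.

Lemma finite_threshold (I : finType) (P : I -> R -> Prop) :
  (forall i, exists2 d, 0 < d & forall h, 0 < h -> h < d -> P i h) ->
  exists2 d, 0 < d & forall h, 0 < h -> h < d -> forall i, P i h.
Proof.
move=> ex.
have ex' i : exists d, 0 < d /\ forall h, 0 < h -> h < d -> P i h.
  by have [d d0 dP] := ex i; exists d.
have [D DP] := choice ex'.
exists (\big[Num.min/1]_i D i) => [|h h0 hd i].
  by apply: lt_bigmin => // i _; have [] := DP i.
by apply: (DP i).2 => //; apply: lt_le_trans hd _; exact: bigmin_le_cond.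
Qed.

End finite_thresholds.

Section determinant_integrals.
Context d (T : measurableType d) (R : realType) (mu : {measure set T -> \bar R}).
Variable D : set T.
Hypotheses (mD : measurable D) (Doo : (mu D < +oo)%E).

Lemma integral_close0 (f : T -> R) : mu.-integrable D (EFin \o f) ->
  (forall e, 0 < e -> exists g : T -> R, [/\ mu.-integrable D (EFin \o g),
     (\int[mu]_(x in D) (g x)%:E = 0)%E & int_le mu D (fun x => `|f x - g x|) e]) ->
  (\int[mu]_(x in D) (f x)%:E = 0)%E.
Proof.
move=> If close; apply/eqP; rewrite -abse_eq0; apply/eqP/le_anti.
rewrite abse_ge0 andbT; apply/lee_addgt0Pr => e e0; rewrite add0e.
have [g [Ig g0 [_ _ fge]]] := close _ e0.
have ID := @integrableB _ T R mu D mD _ _ If Ig.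
rewrite -[X in (`|X|)%E]sube0 -g0.
rewrite -(@integralB_EFin _ T R mu D f g mD If Ig).
exact: le_trans (le_abse_integral mu mD (measurable_int _ ID)) fge.
Qed.

Lemma abs_pow_int_cstD q (a : R) (f : T -> R) : measurable_fun D f ->
  (abs_pow_int mu q D f < +oo)%E -> (abs_pow_int mu q D (fun x => a + f x)%R < +oo)%E.
Proof.
move=> mf foo.
apply: le_lt_trans (@abs_pow_intD _ T R mu q D (fun _ => a) f mD (measurable_cst _) mf) _.
apply: lte_mul_pinfty; [by rewrite lee_fin exprn_ge0|by []|].
apply: lte_add_pinfty foo.
exact: (@abs_pow_int_bounded _ T R mu D mD q _ `|a| Doo (measurable_cst _)).
Qed.

Lemma integrable_det m (b : 'I_m.+1 -> 'I_m.+1 -> T -> R) :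
  (forall k j, measurable_fun D (b k j)) ->
  (forall k j, abs_pow_int mu m.+1 D (b k j) < +oo)%E ->
  mu.-integrable D (EFin \o (fun x => \det (\matrix_(k, j) b k j x) - 1)).
Proof.
move=> mb boo.
have I1 : mu.-integrable D (EFin \o (fun _ : T => 1 : R)).
  apply: (@int_le_integrable _ T R mu D _ (1 * fine (mu D))).
  apply: (@int_le_cst _ T R mu D mD 1 _ ler01).
  by rewrite fineK// ge0_fin_numE// measure_ge0.
suff Idet : mu.-integrable D (EFin \o (fun x => \det (\matrix_(k, j) b k j x))).
  exact: (@integrableB _ T R mu D mD _ _ Idet I1).
rewrite (_ : EFin \o _ =
  (fun x : T => \sum_(s : {perm 'I_m.+1}) ((-1) ^+ s * \prod_k b k (s k) x)%:E)%E).
  apply: (@integrable_sum _ T R mu D mD) => s _.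
  have Ip := @prod_integrable _ T R mu D mD m (fun k => b k (s k))
    (fun k => mb k (s k)) (fun k => boo k (s k)).
  exact: (@integrableZl _ T R mu D mD ((-1) ^+ s) _ Ip).
apply/funext => x /=; rewrite sumEFin; congr EFin; apply: eq_bigr => s _.
by congr (_ * _); apply: eq_bigr => k _; rewrite mxE.
Qed.

(** The perturbation [c] may depend on the permutation, because the discrete determinant reads its
    entries at points that depend on it. *)
Lemma det_close m (b : 'I_m.+1 -> 'I_m.+1 -> T -> R) (e : R) : 0 < e ->
  (forall k j, measurable_fun D (b k j)) ->
  (forall k j, abs_pow_int mu m.+1 D (b k j) < +oo)%E ->
  exists2 dt, 0 < dt & forall c : {perm 'I_m.+1} -> 'I_m.+1 -> T -> R,
    (forall s k, measurable_fun D (c s k)) ->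
    (forall s k, abs_pow_int mu m.+1 D (c s k) <= dt%:E)%E ->
    int_le mu D (fun x => `|\det (\matrix_(k, j) b k j x) -
      \sum_(s : {perm 'I_m.+1}) (-1) ^+ s * \prod_k (b k (s k) x + c s k x)|) e.
Proof.
move=> e0 mb boo; pose K : R := #|{perm 'I_m.+1}|%:R + 1.
have K0 : 0 < K by rewrite ltr_wpDl.
have eK0 : 0 < e / K by rewrite divr_gt0.
have [dt dt0 H] : exists2 dt, 0 < dt & forall h, 0 < h -> h < dt ->
    forall s : {perm 'I_m.+1}, forall c : 'I_m.+1 -> T -> R,
    (forall k, measurable_fun D (c k)) ->
    (forall k, abs_pow_int mu m.+1 D (c k) <= h%:E)%E ->
    int_le mu D (fun x => `|\prod_k (b k (s k) x + c k x) - \prod_k b k (s k) x|) (e / K).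
  apply: finite_threshold => s.
  have [dt dt0 dP] := @prod_close _ T R mu D mD m (fun k => b k (s k)) _ eK0
    (fun k => mb k (s k)) (fun k => boo k (s k)).
  exists dt; first exact: dt0.
  move=> h _ hd c mc ch; apply: dP => [|k]; first exact: mc.
  by apply: le_trans (ch k) _; rewrite lee_fin ltW.
exists (dt / 2); first by rewrite divr_gt0.
move=> c mc cd.
have hd : dt / 2 < dt by rewrite ltr_pdivrMr// ltr_pMr// ltr1n.
have Hs := int_le_sum mD (index_enum {perm 'I_m.+1})
  (fun s => H _ (divr_gt0 dt0 (ltr0n R 2)) hd s (c s) (mc s) (cd s)).
apply: int_le_mono Hs => //.
- apply: measurableT_comp => //.
  have -> : (fun x => \det (\matrix_(k, j) b k j x) -
      \sum_(s : {perm 'I_m.+1}) (-1) ^+ s * \prod_k (b k (s k) x + c s k x)) =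
    (fun x => \sum_(s : {perm 'I_m.+1}) (-1) ^+ s * \prod_k b k (s k) x -
      \sum_(s : {perm 'I_m.+1}) (-1) ^+ s * \prod_k (b k (s k) x + c s k x)).
    apply/funext => x; congr (_ - _); apply: eq_bigr => s _.
    by congr (_ * _); apply: eq_bigr => k _; rewrite mxE.
  apply: measurable_funB; apply: measurable_sum => s; apply: measurable_funM => //.
    exact: measurable_prod.
  by apply: measurable_prod => k _; exact: measurable_funD.
- move=> x; rewrite /determinant distrC -sumrB; apply: le_trans (ler_norm_sum _ _ _) _.
  apply: ler_sum => s _; rewrite -mulrBr normrM normrX normrN1 expr1n mul1r.
  by rewrite [X in _ - X](eq_bigr (fun k => b k (s k) x)) => [//|k _]; rewrite mxE.
- rewrite sumr_const -[_ *+ _]mulr_natr mulrAC ler_pdivrMr//.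
  by rewrite ler_wpM2l ?(ltW e0)// /K lerDl.
Qed.

End determinant_integrals.

(** * The determinant identity when quotients converge on the whole space *)

Section determinant_limit.
Context {R : realType} {n : nat}.
Local Notation V := 'rV[R]_n.
Local Notation L := (lebesgue_space R n).
Local Notation mu := (@lebesgue_rV R n).

Lemma norm_step_sum_le m (h : R) (i : 'I_m -> 'I_n) a b s : 0 <= h ->
  `|step_sum (fun j => h *: (delta_mx 0 (i j) : V)) a b s| <= m%:R * h.
Proof.
move=> h0; rewrite /step_sum; apply: le_trans (ler_norm_sum _ _ _) _.
apply: (@le_trans _ _ (\sum_(k < m | (a <= k < b)%N) h)).
  by apply: ler_sum => k _; apply: le_trans (norm_delta_le _ _) _; rewrite ger0_norm.
rewrite [leRHS]mulr_natl -[X in _ *+ X](card_ord m) -sumr_const [leRHS](bigID (fun k : 'I_m => (a <= k < b)%N)) /=.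
by rewrite lerDl; apply: sumr_ge0.
Qed.

Lemma ball_norm_sub (c x v : V) (r s : R) : `|v| <= s ->
  ball c r (x + v) -> ball c (r + s) x.
Proof.
rewrite -!ball_normE /ball_ /= => vs cr.
have -> : c - x = (c - (x + v)) + v by rewrite opprD addrA subrK.
by apply: le_lt_trans (ler_normD _ _) _; exact: ltr_leD.
Qed.

Variables (m : nat) (c0 : V) (r : R) (i_ : 'I_m.+1 -> 'I_n).
Variables (w : 'I_m.+1 -> V -> R) (G : 'I_m.+1 -> 'I_m.+1 -> V -> R).
Hypothesis r0 : 0 < r.
Hypothesis bw : forall k, bounded_measurable (w k).
Hypothesis w0 : forall k x, ~ ball c0 r x -> w k x = 0.
Hypothesis mG : forall k j, measurable_fun [set: L] (G k j : L -> R).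
Hypothesis G0 : forall k j x, ~ ball c0 r x -> G k j x = 0.
Hypothesis Goo : forall k j, (abs_pow_int mu m.+1 setT (G k j) < +oo)%E.
Hypothesis wG : forall k j,
  @mean_cvg _ L R mu m.+1 setT (fun h => diffq h (i_ j) (w k)) (G k j).

Let e_ (h : R) (j : 'I_m.+1) : V := h *: delta_mx 0 (i_ j).
Let b k j x : R := (k == j)%:R + G k j x.
Let c h (s : {perm 'I_m.+1}) k x : R :=
  id_diff h^-1 (e_ h) w k (s k) (x + step_sum (e_ h) 0 k s) - b k (s k) x.

Let measurable_diff h k j : measurable_fun [set: L] (diffq h (i_ j) (w k) : L -> R).
Proof.
apply: (measurable_funM (measurable_cst _)).
apply: measurable_funB; last exact: (bw k).1.
exact: (measurable_translate _ (bw k).1).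
Qed.

Let cE h s k x : c h s k x =
  (diffq h (i_ (s k)) (w k) (x + step_sum (e_ h) 0 k s)
     - G k (s k) (x + step_sum (e_ h) 0 k s))
  + (G k (s k) (x + step_sum (e_ h) 0 k s) - G k (s k) x).
Proof. by rewrite /c /b /id_diff /diffq /e_; ring. Qed.

Let measurable_c h s k : measurable_fun [set: L] (c h s k : L -> R).
Proof.
rewrite (funext (cE h s k : forall x, _ = _)).
apply: measurable_funD.
  apply: measurable_funB; last exact: (measurable_translate _ (mG _ _)).
  exact: (measurable_translate _ (measurable_diff _ _ _)).
apply: measurable_funB; last exact: mG.
exact: (measurable_translate _ (mG _ _)).
Qed.

(** An entry errs in two ways: the quotient differs from G, measured at a shifted point at no cost,
    and G itself is shifted by at most (m + 1) h. *)
Let c_small (e : R) : 0 < e -> exists2 d, 0 < d & forall h, 0 < h -> h < d ->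
  forall s k, (abs_pow_int mu m.+1 setT (c h s k) <= e%:E)%E.
Proof.
move=> e0; pose e' := e / 2 ^+ m.+1 / 2.
have e'0 : 0 < e' by rewrite !divr_gt0.
have [d1 d10 H1] : exists2 d, 0 < d & forall h, 0 < h -> h < d ->
    forall kj : 'I_m.+1 * 'I_m.+1, (abs_pow_int mu m.+1 setT
      (fun x => diffq h (i_ kj.2) (w kj.1) x - G kj.1 kj.2 x)%R <= e'%:E)%E.
  apply: finite_threshold => -[k j] /=.
  have [d d0 dP] := wG k j e'0.
  exists d; [exact: d0|move=> h; exact: dP].
have [d2 d20 H2] : exists2 d, 0 < d & forall h, 0 < h -> h < d ->
    forall kj : 'I_m.+1 * 'I_m.+1, forall v, `|v| <= h -> (abs_pow_int mu m.+1 setT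
      (fun x => G kj.1 kj.2 (x + v) - G kj.1 kj.2 x)%R <= e'%:E)%E.
  apply: finite_threshold => -[k j] /=.
  have [d d0 dP] := translation_continuity (ltn0Sn m) r0 (mG k j) (G0 k j) (Goo k j) e'0.
  exists d; [exact: d0|move=> h h0 hd v vh; apply: dP; exact: le_lt_trans vh hd].
exists (Num.min d1 (d2 / m.+1%:R)).
  by rewrite lt_min d10 divr_gt0.
move=> h h0; rewrite lt_min => /andP[hd1 hd2] s k.
rewrite (funext (cE h s k : forall x, _ = _)).
have mD : measurable_fun [set: L] ((fun x : V => diffq h (i_ (s k)) (w k) x - G k (s k) x) : L -> R).
  by apply: measurable_funB; [exact: measurable_diff|exact: mG].
have mE : measurable_fun [set: L] ((fun x : V =>
    G k (s k) (x + step_sum (e_ h) 0 k s) - G k (s k) x) : L -> R).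
  by apply: measurable_funB; [exact: (measurable_translate _ (mG _ _))|exact: mG].
have := @abs_pow_intD _ L R mu m.+1 setT _ _ measurableT
  (measurable_translate (step_sum (e_ h) 0 k s) mD) mE.
move=> /le_trans; apply.
have -> : e%:E = ((2 ^+ m.+1)%:E * (e'%:E + e'%:E))%E.
  rewrite -EFinD -EFinM; congr EFin; rewrite -splitr mulrCA divff ?mulr1//.
apply: lee_wpmul2l; first by rewrite lee_fin exprn_ge0.
apply: leeD.
  by rewrite (abs_pow_int_translate m.+1 _ mD); exact: (H1 h h0 hd1 (k, s k)).
apply: (H2 (m.+1%:R * h) _ _ (k, s k)).
- by rewrite mulr_gt0.
- by rewrite mulrC -ltr_pdivlMr.
- exact: (norm_step_sum_le _ _ _ _ (ltW h0)).
Qed.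

Let Q : set L := ball c0 (r + 1).

Let mQ : measurable Q.
Proof. by apply: open_measurable_rV; exact: ball_open. Qed.

Let Qoo : (mu Q < +oo)%E.
Proof. by rewrite lebesgue_rV_ball ?ltry// addr_gt0. Qed.

Let measurable_b k j : measurable_fun [set: L] (b k j : L -> R).
Proof. exact: (measurable_funD (measurable_cst _) (mG k j)). Qed.

Let boo k j : (abs_pow_int mu m.+1 Q (b k j) < +oo)%E.
Proof.
have mGQ : measurable_fun Q (G k j : L -> R).
  exact: (@measurable_funS _ _ L _ setT Q _ measurableT (@subsetT _ _) (mG k j)).
apply: (@abs_pow_int_cstD _ L R mu Q mQ Qoo m.+1 _ _ mGQ).
apply: le_lt_trans (Goo k j).
exact: (@abs_pow_int_subset _ L R mu m.+1 Q setT _ mQ measurableT (mG k j) (@subsetT _ _)).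
Qed.

Let discrete_detE h x : discrete_det h^-1 (e_ h) w x =
  \sum_(s : {perm 'I_m.+1}) (-1) ^+ s * \prod_k (b k (s k) x + c h s k x).
Proof.
apply: eq_bigr => s _; congr (_ * _); apply: eq_bigr => k _.
by rewrite /c [RHS]addrC subrK.
Qed.

(** For such h no lattice path from a point outside Q enters the ball of radius r, so only identity
    rows remain. *)
Let discrete_det_out h x : 0 < h -> m.+1%:R * h <= 1 -> ~ Q x ->
  discrete_det h^-1 (e_ h) w x = 1.
Proof.
move=> h0 h1 nQ; rewrite -[RHS](det1 R m.+1) /determinant.
apply: eq_bigr => s _; congr (_ * _); apply: eq_bigr => k _.
have out a : (a <= m.+1)%N -> w k (x + step_sum (e_ h) 0 a s) = 0.
  move=> am; apply: w0; apply: contra_not nQ; apply: ball_norm_sub.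
  exact: le_trans (norm_step_sum_le _ _ _ _ (ltW h0)) h1.
rewrite mxE /id_diff -addrA -(step_sumS (e_ h)) -step_sum_cat//.
by rewrite !out ?subrr ?mulr0 ?addr0// ltnW.
Qed.

(** The discrete determinants minus 1 have integral 0 over Q, and by [c_small] and [det_close] they
    approximate the limit integrand in L^1(Q). *)
Lemma det_integral0 :
  (\int[mu]_(x in Q) (\det (\matrix_(k, j) ((k == j)%:R + G k j x)) - 1)%:E = 0)%E.
Proof.
have measurable_restr (g : V -> R) : measurable_fun [set: L] (g : L -> R) ->
    measurable_fun Q (g : L -> R).
  exact: (@measurable_funS _ _ L _ setT Q _ measurableT (@subsetT _ _)).
have mbQ k j := measurable_restr _ (measurable_b k j).
apply: (@integral_close0 _ L R mu Q mQ) => [|e e0].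
  exact: (@integrable_det _ L R mu Q mQ Qoo m b mbQ boo).
have [d d0 close] := @det_close _ L R mu Q mQ m b e e0 mbQ boo.
have [dt dt0 cd] := c_small d0.
pose h := Num.min (dt / 2) m.+1%:R^-1.
have h0 : 0 < h by rewrite lt_min divr_gt0//= invr_gt0.
have hd : h < dt by rewrite gt_min ltr_pdivrMr// ltr_pMr// ltr1n.
have h1 : m.+1%:R * h <= 1 by rewrite mulrC -ler_pdivlMr// mul1r ge_min lexx orbT.
exists (fun x => discrete_det h^-1 (e_ h) w x - 1).
have [IXh Xh0] := discrete_det_integral h^-1 (e_ h) r0 bw w0.
split.
- exact: (@integrableS _ L R mu setT Q _ measurableT mQ (@subsetT _ _) IXh).
- rewrite -Xh0; apply/esym/integral_support_rV => x nQ.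
  by rewrite discrete_det_out// subrr.
have -> : (fun x => `|\det (\matrix_(k, j) ((k == j)%:R + G k j x)) - 1 -
      (discrete_det h^-1 (e_ h) w x - 1)|) =
    (fun x => `|\det (\matrix_(k, j) b k j x) -
      \sum_(s : {perm 'I_m.+1}) (-1) ^+ s * \prod_k (b k (s k) x + c h s k x)|).
  by apply/funext => x; rewrite opprB addrA subrK discrete_detE.
apply: close => s k; first exact: (measurable_restr _ (measurable_c _ _ _)).
apply: le_trans (cd h h0 hd s k).
exact: (@abs_pow_int_subset _ L R mu m.+1 Q setT _ mQ measurableT (measurable_c _ _ _) (@subsetT _ _)).
Qed.

End determinant_limit.

(** * Removing the truncation: the identity for the zero extension *)

Section countable_cover.
Context d (T : measurableType d) (R : realType) (mu : {measure set T -> \bar R}).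

Lemma abs_pow_int_cover0 q (D : set T) (B : nat -> set T) (f : T -> R) :
  measurable D -> (forall k, measurable (B k)) -> measurable_fun setT f ->
  D `<=` \bigcup_k B k -> (forall k, abs_pow_int mu q (B k) f = 0%E) ->
  abs_pow_int mu q D f = 0%E.
Proof.
move=> mD mB mf DB B0.
have absE (E : set T) : abs_pow_int mu q E f = (\int[mu]_(x in E) `|(`|f x| ^+ q)%:E|)%E.
  by apply: eq_integral => x _; rewrite gee0_abs// lee_fin exprn_ge0.
have mp (E : set T) : measurable E -> measurable_fun E (fun x => (`|f x| ^+ q)%:E).
  by move=> mE; apply: measurable_abs_pow; exact: measurable_funS mf.
rewrite absE; apply/(ae_eq_integral_abs mu mD (mp _ mD)).
have : \forall x \ae mu, forall k, B k x -> (`|f x| ^+ q)%:E = 0%E.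
  apply: ae_foralln => k.
  by apply/(ae_eq_integral_abs mu (mB k) (mp _ (mB k))); rewrite -absE.
by apply: filterS => x H /DB[k _ /H].
Qed.

End countable_cover.

Section level_sets.
Context {R : realType} {n : nat}.
Local Notation V := 'rV[R]_n.
Local Notation L := (lebesgue_space R n).
Local Notation mu := (@lebesgue_rV R n).

(** Countably many rational balls with doubles inside Omega cover Omega; [zero_level] applies on
    each, and a countable union of null sets is null. *)
Lemma zero_level_open q (Omega : set V) (j : 'I_n) (w g : V -> R) (c : V) (r : R) :
  (0 < q)%N -> 0 < r -> open Omega -> continuous w ->
  measurable_fun [set: L] (g : L -> R) -> (forall x, ~ ball c r x -> g x = 0) ->
  (abs_pow_int mu q setT g < +oo)%E ->
  (forall x0 s d, 0 < s -> 0 < d -> ball x0 (s + d) `<=` Omega ->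
    @mean_cvg _ L R mu q (ball x0 s) (fun h => diffq h j w) g) ->
  abs_pow_int mu q Omega (fun x => \1_[set x | w x = 0] x * g x) = 0%E.
Proof.
move=> q0 r0 oO cw mg g0 goo H.
pose J := [set p : 'rV[rat]_n * nat |
    ball (map_mx ratr p.1 : V) (p.2.+1%:R^-1 + p.2.+1%:R^-1) `<=` Omega].
pose B (k : nat) : set L := if choice.unpickle k is Some p then
  (if p \in J then ball (map_mx ratr p.1 : V) p.2.+1%:R^-1 else set0) else set0.
have mB k : measurable (B k).
  rewrite /B; case: (choice.unpickle k) => [p|]; last exact: measurable0.
  case: ifP => _; last exact: measurable0.
  by apply: open_measurable_rV; apply: ball_open; rewrite invr_gt0.
have mZ : measurable ([set x | w x = 0] : set L).
  apply: closed_measurable_rV; apply: ((continuous_closedP w).1 cw [set y | y = 0]).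
  exact: closed_eq.
apply: (@abs_pow_int_cover0 _ L R mu q Omega B).
- exact: open_measurable_rV.
- exact: mB.
- by apply: measurable_funM mg; exact: measurable_indic.
- rewrite [X in X `<=` _](open_rational_cover oO) => x [p Jp px].
  exists (choice.pickle p); first by [].
  by rewrite /B choice.pickleK; rewrite mem_set.
- move=> k; rewrite /B; case: (choice.unpickle k) => [p|]; last exact: integral_set0.
  case: ifP => [|_]; last exact: integral_set0.
  rewrite inE => Jp.
  have k0 : 0 < p.2.+1%:R^-1 :> R by rewrite invr_gt0.
  apply: (zero_level q0 r0 _ cw mg g0 goo (H _ _ _ k0 k0 Jp)).
  exact: ball_open.
Qed.

End level_sets.

Section sobolev_determinant.
Context {R : realType} {n : nat}.
Local Notation V := 'rV[R]_n.
Local Notation L := (lebesgue_space R n).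
Local Notation mu := (@lebesgue_rV R n).

Lemma superlevel_compact (u : V -> R) (c : V) (r e : R) : 0 < r -> continuous u ->
  (forall x, ~ ball c r x -> u x = 0) -> 0 < e -> compact [set x | e <= `|u x|].
Proof.
move=> r0 cu u0 e0.
apply: (@subclosed_compact _ _ [set x : V | forall i, `[c 0 i - r, c 0 i + r]%classic (x 0 i)]).
- have cn : continuous (fun x : V => `|u x|).
    by move=> x; apply: (@continuous_comp _ _ _ u Num.norm x (cu x)); exact: norm_continuous.
  apply: ((continuous_closedP _).1 cn [set y | e <= y]); exact: closed_ge.
- by apply: (@rV_compact R n (fun i => `[c 0 i - r, c 0 i + r]%classic)) => i; exact: segment_compact.
- move=> x /= ex i.
  have : ball c r x.
    by apply: contrapT => nB; move: ex; rewrite u0// normr0 leNgt e0.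
  by move/rV_ballE => h; apply: subset_itv_oo_cc; exact: h.
Qed.

Lemma trunc_bounded_measurable (u : V -> R) (c : V) (r e : R) : 0 < e ->
  continuous u -> (forall x, ~ ball c r x -> u x = 0) ->
  bounded_measurable (fun x => trunc e (u x)).
Proof.
move=> e0 cu u0; split.
  by apply: measurable_trunc; exact: continuous_measurable_rV.
have [M M0 uM] := continuous_supp_bounded cu u0.
exists (2 / e * M ^+ 2) => x.
have := trunc_taylor 0 (u x) e0.
have [-> ->] := trunc_small (t := 0) e0 (eq_ind_r (fun z => z <= e) (ltW e0) (normr0 _)).
rewrite subr0 mul0r !subr0 => /le_trans; apply.
rewrite ler_wpM2l ?divr_ge0 ?(ltW e0)//.
by rewrite -[u x ^+ 2]real_normK ?num_real// lerXn2r ?nnegrE// ltW.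
Qed.

Variables (m : nat) (Omega : set V) (c0 : V) (r : R) (i_ : 'I_m.+1 -> 'I_n).
Variables (u : 'I_m.+1 -> V -> R) (g : 'I_m.+1 -> 'I_m.+1 -> V -> R).
Hypothesis r0 : 0 < r.
Hypothesis openO : open Omega.
Hypothesis Or : Omega `<=` ball c0 r.
Hypothesis cu : forall k, continuous (u k).
Hypothesis u0 : forall k x, ~ Omega x -> u k x = 0.
Hypothesis mg : forall k j, measurable_fun [set: L] (g k j : L -> R).
Hypothesis g0 : forall k j x, ~ Omega x -> g k j x = 0.
Hypothesis goo : forall k j, (abs_pow_int mu m.+1 setT (g k j) < +oo)%E.
Hypothesis ug : forall x0 s d, 0 < s -> 0 < d -> ball x0 (s + d) `<=` Omega ->
  forall k j, @mean_cvg _ L R mu m.+1 (ball x0 s) (fun h => diffq h (i_ j) (u k)) (g k j).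

Let u0r k x : ~ ball c0 r x -> u k x = 0.
Proof. by move=> nB; apply: u0; apply: contra_not nB; exact: Or. Qed.

Let g0r k j x : ~ ball c0 r x -> g k j x = 0.
Proof. by move=> nB; apply: g0; apply: contra_not nB; exact: Or. Qed.

(** The set {|u_k| >= e / 2} is compact and contained in Omega, so the quotients converge on an open
    neighbourhood U of it; this is all that [trunc_diffq_cvg] requires. *)
Let trunc_cvg e k j : 0 < e ->
  @mean_cvg _ L R mu m.+1 setT (fun h => diffq h (i_ j) (fun x => trunc e (u k x)))
    (fun x => dtrunc e (u k x) * g k j x).
Proof.
move=> e0; have e20 : 0 < e / 2 by rewrite divr_gt0.
have [|x ex|i h|i|x0 s d s0 d0 sO i|U [oU KU UO H]] :=
  @compact_mean_cvg R n m.+1 Omega [set x | e / 2 <= `|u k x|] 'I_m.+1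
    (fun j h => diffq h (i_ j) (u k)) (g k) openO.
- exact: (superlevel_compact r0 (@cu k) (@u0r k) e20).
- by apply: contrapT => nO; move: ex; rewrite /= u0// normr0 leNgt e20.
- by apply: continuous_measurable_rV; exact: continuous_diffq.
- exact: mg.
- exact: (ug s0 d0 sO).
exact: (trunc_diffq_cvg (ltn0Sn m) r0 (@cu k) (@u0r k) (mg k j) (goo k j)
  oU e0 KU (H j)).
Qed.

Let e_ (N : nat) : R := N.+1%:R^-1.
Let e_0 N : 0 < e_ N. Proof. by rewrite invr_gt0. Qed.

Let Z k j x : R := \1_[set x | u k x = 0] x * g k j x.

Let mdt N k : measurable_fun [set: L] ((fun x => dtrunc (e_ N) (u k x)) : L -> R).
Proof. by apply: measurable_dtrunc; exact: continuous_measurable_rV. Qed.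

Let mG N k j : measurable_fun [set: L] ((fun x => dtrunc (e_ N) (u k x) * g k j x) : L -> R).
Proof. exact: (measurable_funM (mdt N k) (mg k j)). Qed.

Let mZ k j : measurable_fun [set: L] (Z k j : L -> R).
Proof.
apply: (measurable_funM _ (mg k j)); apply: measurable_indic.
apply: closed_measurable_rV; apply: ((continuous_closedP _).1 (@cu k) [set y | y = 0]).
exact: closed_eq.
Qed.

Let mc N k j : measurable_fun [set: L]
  ((fun x => dtrunc (e_ N) (u k x) * g k j x - g k j x) : L -> R).
Proof. exact: (measurable_funB (mG N k j) (mg k j)). Qed.

Let Z0 k j : abs_pow_int mu m.+1 setT (Z k j) = 0%E.
Proof.
rewrite (@abs_pow_int_support_rV _ _ m.+1 Omega) => [|//|x nO]; last first.
  by rewrite /Z g0// mulr0.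
exact: (zero_level_open (ltn0Sn m) r0 openO (@cu k) (mg k j) (@g0r k j) (goo k j)
  (fun x0 s d s0 d0 sO => ug s0 d0 sO k j)).
Qed.

(** As the level decreases, [dtrunc] tends to the indicator of u_k != 0, with 2|g| as dominating
    function. The limit misses g only by [Z], its restriction to the zero set, which is null by
    [zero_level_open]. *)
Let small e : 0 < e -> exists N, forall k j,
  (abs_pow_int mu m.+1 setT (fun x => dtrunc (e_ N) (u k x) * g k j x - g k j x)%R <= e%:E)%E.
Proof.
move=> e0.
pose F N k j (x : V) := dtrunc (e_ N) (u k x) * g k j x - (g k j x - Z k j x).
have mgZ k j : measurable_fun [set: L] ((fun x => g k j x - Z k j x) : L -> R).
  exact: (measurable_funB (mg k j) (mZ k j)).
have mF N k j : measurable_fun [set: L] (F N k j : L -> R).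
  exact: (measurable_funB (mG N k j) (mgZ k j)).
have e'0 : 0 < e / 2 ^+ m.+1 by rewrite divr_gt0// exprn_gt0.
have F0 k j : (abs_pow_int mu m.+1 setT (F N k j) @[N --> \oo] --> 0)%E.
  have m2 : measurable_fun [set: L] ((fun x => 2 * `|g k j x|) : L -> R).
    apply: (measurable_funM (measurable_cst _)).
    exact: (measurableT_comp (@normr_measurable R setT) (mg k j)).
  apply: (@abs_pow_int_dominated _ L R mu m.+1 setT (fun N => F N k j)
     (fun x => 2 * `|g k j x|) (ltn0Sn m) measurableT (fun N => mF N k j) m2) => [x _|N x _|].
  - have -> : (fun N => F N k j x) =
        (fun N => (dtrunc N.+1%:R^-1 (u k x) - (u k x != 0)%:R) * g k j x).
      apply/funext => N; rewrite /F /Z indicE; have [ux|ux] := eqVneq (u k x) 0.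
        by rewrite mem_set//= mulr0n mulr1n; ring.
      by rewrite memNset /= ?mulr0n ?mulr1n; [ring|exact/eqP].
    have h : dtrunc N.+1%:R^-1 (u k x) - (u k x != 0)%:R @[N --> \oo] --> (0 : R).
      rewrite -[X in _ --> X](subrr ((u k x != 0)%:R)).
      by apply: cvgB; [exact: cvg_dtrunc|exact: cvg_cst].
    by have := cvgM h (@cvg_cst _ (g k j x) _ \oo _); rewrite mul0r; exact.
  - rewrite /F (_ : _ - _ = (dtrunc (e_ N) (u k x) - (1 - \1_[set x | u k x = 0] x)) * g k j x); last first.
      by rewrite /Z; ring.
    rewrite normrM ler_wpM2r//; apply: le_trans (ler_normB _ _) _.
    rewrite [leRHS](_ : 2 = 1 + 1)// lerD ?dtrunc_norm_le1// indicE.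
    by case: (_ \in _); rewrite ?subrr ?subr0 ?normr0 ?normr1.
  - rewrite (@eq_abs_pow_int _ L R mu m.+1 setT _ (fun x => 2 * g k j x)) => [|x _]; last first.
      by rewrite !normrM normr_id.
    rewrite (@abs_pow_intZ _ L R mu m.+1 setT 2 _ measurableT (mg k j)).
    by apply: lte_mul_pinfty => //; rewrite lee_fin exprn_ge0.
have H : \forall N \near \oo, forall kj : 'I_m.+1 * 'I_m.+1,
    (abs_pow_int mu m.+1 setT (F N kj.1 kj.2) <= (e / 2 ^+ m.+1)%:E)%E.
  apply: filter_forall => -[k j] /=.
  have /fine_cvgP[fin /cvgr0_norm_le/(_ _ e'0) h] := F0 k j.
  apply: filterS2 fin h => N finN hN.
  by rewrite -(fineK finN) lee_fin; exact: le_trans (ler_norm _) hN.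
have [N _ HN] := H.
exists N => k j.
have -> : (fun x => dtrunc (e_ N) (u k x) * g k j x - g k j x) =
    (fun x => F N k j x + - 1 * Z k j x).
  by apply/funext => x; rewrite /F; ring.
have mNZ : measurable_fun [set: L] ((fun x => -1 * Z k j x) : L -> R).
  exact: (measurable_funM (measurable_cst _) (mZ k j)).
apply: le_trans (@abs_pow_intD _ L R mu m.+1 setT _ _ measurableT (mF N k j) mNZ) _.
rewrite (@abs_pow_intZ _ L R mu m.+1 setT (-1) _ measurableT (mZ k j)) Z0 mule0 adde0.
apply: le_trans (lee_wpmul2l _ (HN N (leqnn N) (k, j))) _.
  by rewrite lee_fin exprn_ge0.
rewrite -EFinM lee_fin mulrCA divff ?mulr1// expf_neq0//.
Qed.

Let Q : set L := ball c0 (r + 1).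

(** [det_integral0] holds for each truncation, and by [small] the truncated derivatives are close to
    g in L^(m+1), so the integrals of the determinants pass to the limit. *)
Lemma det_integral_sobolev :
  (\int[mu]_(x in Q) (\det (\matrix_(k, j) ((k == j)%:R + g k j x)) - 1)%:E = 0)%E.
Proof.
have mQ : measurable Q by apply: open_measurable_rV; exact: ball_open.
have Qoo : (mu Q < +oo)%E by rewrite lebesgue_rV_ball ?ltry// addr_gt0.
have measurable_restr (f : V -> R) : measurable_fun [set: L] (f : L -> R) ->
    measurable_fun Q (f : L -> R).
  exact: (@measurable_funS _ _ L _ setT Q _ measurableT (@subsetT _ _)).
have restr (f : V -> R) : measurable_fun [set: L] (f : L -> R) ->
    (abs_pow_int mu m.+1 Q f <= abs_pow_int mu m.+1 setT f)%E.
  by move=> mf; exact: (@abs_pow_int_subset _ L R mu m.+1 Q setT _ mQ measurableT mf (@subsetT _ _)).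
pose b (k j : 'I_m.+1) (x : V) : R := (k == j)%:R + g k j x.
have mb k j : measurable_fun Q (b k j : L -> R).
  by apply: measurable_restr; exact: (measurable_funD (measurable_cst _) (mg k j)).
have boo k j : (abs_pow_int mu m.+1 Q (b k j) < +oo)%E.
  apply: (@abs_pow_int_cstD _ L R mu Q mQ Qoo m.+1 _ _ (measurable_restr _ (mg k j))).
  exact: le_lt_trans (restr _ (mg k j)) (goo k j).
apply: (@integral_close0 _ L R mu Q mQ) => [|e e0].
  exact: (@integrable_det _ L R mu Q mQ Qoo m b mb boo).
have [d d0 close] := @det_close _ L R mu Q mQ m b e e0 mb boo.
have [N HN] := small d0.
pose gN (k j : 'I_m.+1) (x : V) : R := dtrunc (e_ N) (u k x) * g k j x.
have gNoo k j : (abs_pow_int mu m.+1 setT (gN k j) < +oo)%E.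
  apply: le_lt_trans (goo k j).
  apply: (@abs_pow_int_le _ L R mu m.+1 setT _ _ measurableT (mG N k j) (mg k j)) => x _.
  by rewrite normrM ler_piMl// dtrunc_norm_le1.
have gN0 k j x : ~ ball c0 r x -> gN k j x = 0 by move=> nB; rewrite /gN g0r// mulr0.
have w0 k x : ~ ball c0 r x -> trunc (e_ N) (u k x) = 0.
  by move=> nB; apply: (trunc_small (e_0 N) _).1; rewrite u0r// normr0 ltW.
have := @det_integral0 R n m c0 r i_ (fun k x => trunc (e_ N) (u k x)) gN r0
  (fun k => trunc_bounded_measurable (e_0 N) (@cu k) (@u0r k)) w0 (fun k j => mG N k j)
  gN0 gNoo (fun k j => trunc_cvg k j (e_0 N)).
exists (fun x => \det (\matrix_(k, j) ((k == j)%:R + gN k j x)) - 1); split.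
- apply: (@integrable_det _ L R mu Q mQ Qoo m (fun k j x => (k == j)%:R + gN k j x)) => k j.
    by apply: measurable_restr; exact: (measurable_funD (measurable_cst _) (mG N k j)).
  apply: (@abs_pow_int_cstD _ L R mu Q mQ Qoo m.+1 _ _ (measurable_restr _ (mG N k j))).
  exact: le_lt_trans (restr _ (mG N k j)) (gNoo k j).
- by [].
have -> : (fun x => `|\det (\matrix_(k, j) ((k == j)%:R + g k j x)) - 1 -
      (\det (\matrix_(k, j) ((k == j)%:R + gN k j x)) - 1)|) =
    (fun x => `|\det (\matrix_(k, j) b k j x) -
      \sum_(s : {perm 'I_m.+1}) (-1) ^+ s *
        \prod_k (b k (s k) x + (gN k (s k) x - g k (s k) x))|).
  apply/funext => x; rewrite opprB addrA subrK; congr (`|_ - _|).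
  apply: eq_bigr => s _; congr (_ * _); apply: eq_bigr => k _.
  by rewrite mxE /b; ring.
apply: (close (fun s k x => gN k (s k) x - g k (s k) x)) => s k.
  exact: (measurable_restr _ (mc N k (s k))).
exact: le_trans (restr _ (mc N k (s k))) (HN k (s k)).
Qed.

End sobolev_determinant.

(** * From L^p to L^q, and from minors to rank *)

Section lebesgue_space_embedding.
Context d (T : measurableType d) (R : realType) (mu : {measure set T -> \bar R}).

(** On a set of finite measure a larger exponent is stronger: |f|^q <= 1 + |f|^p for finite p. For p
    = +oo, positivity of the total measure identifies the norm with the essential supremum, which
    bounds f. *)
Lemma Lfun_abs_pow_int (p : \bar R) q (D : set T) (f : T -> R) : (0 < q)%N ->
  measurable D -> (mu D < +oo)%E -> (0 < mu setT)%E -> (q%:R%:E <= p)%E ->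
  f \in Lfun mu p -> (forall x, ~ D x -> f x = 0) ->
  measurable_fun setT f /\ (abs_pow_int mu q setT f < +oo)%E.
Proof.
move=> q0 mD Doo mu0 qp fp f0.
have mf : measurable_fun setT f by have := sub_Lfun_mfun fp; rewrite inE.
split=> //; rewrite (abs_pow_int_support mu q0 f0).
have mfD : measurable_fun D f by exact: measurable_funS mf.
have q1 : 1 <= q%:R :> R by rewrite ler1n.
case: p qp fp => [r||//] qp fp.
- have r1 : 1 <= r by apply: le_trans q1 _; rewrite -lee_fin.
  have If := integrableS measurableT mD (@subsetT _ _) (Lfun_integrable r1 fp).
  have H x : `|f x| ^+ q <= 1 + `|f x| `^ r.
    have [f1|f1] := leP `|f x| 1.
      by apply: (@le_trans _ _ 1); [exact: exprn_ile1|rewrite lerDl powR_ge0].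
    rewrite -powR_mulrn//; apply: ler_wpDl => //.
    by apply: ler_powR; [exact: ltW|rewrite -lee_fin].
  have mp : measurable_fun D (fun x => `|f x| `^ r).
    by apply/measurable_EFinP; exact: measurable_int If.
  apply: (@le_lt_trans _ _ (\int[mu]_(x in D) (1 + `|f x| `^ r)%:E)%E).
    apply: ge0_le_integral => //; try (by move=> t _; rewrite lee_fin ?addr_ge0 ?powR_ge0).
    + exact: measurable_abs_pow.
    + by apply/measurable_EFinP; exact: measurable_funD.
  under eq_integral do rewrite EFinD.
  rewrite ge0_integralD//; try exact/measurable_EFinP;
    try (by move=> t _; rewrite lee_fin powR_ge0).
  rewrite integral_cst// mul1e lte_add_pinfty//.
  have /integrableP[_] := If; apply: le_lt_trans.
  by rewrite [leRHS](eq_integral (fun x => (`|f x| `^ r)%:E)) => [//|x _]; rewrite gee0_abs// lee_fin powR_ge0.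
- have := sub_Lfun_finLfun fp; rewrite inE /= /finite_norm unlock /Lnorm mu0 => fin.
  have [M fM] := ess_supr_bounded fin.
  apply: (@le_lt_trans _ _ (\int[mu]_(x in D) (`|M| ^+ q)%:E)%E); last first.
    by rewrite integral_cst// lte_mul_pinfty// lee_fin exprn_ge0.
  apply: ae_ge0_le_integral => //; try (by move=> x _; rewrite lee_fin exprn_ge0).
  + exact: measurable_abs_pow.
  + apply: filterS fM => x fxM _; rewrite lee_fin lerXn2r ?nnegrE//.
    by apply: le_trans fxM _; exact: ler_norm.
Qed.

End lebesgue_space_embedding.

Section submatrix_rank.
Context {F : fieldType}.

(** A submatrix is the matrix multiplied by selection matrices on both sides, which cannot raise the
    rank; an invertible one has full rank m. *)
Lemma minor_rank m n (i_ : 'I_m -> 'I_n) (A : 'M[F]_n) :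
  \det (mxsub i_ i_ A) != 0 -> (m <= \rank A)%N.
Proof.
move=> detA; have {detA} : mxsub i_ i_ A \in unitmx by rewrite unitmxE unitfE.
move=> /mxrank_unit {1}<-; rewrite mxsubrc rowsubE.
apply: leq_trans (mxrankM_maxr _ _) _.
rewrite -mxrank_tr (_ : (colsub i_ A)^T = rowsub i_ A^T); last first.
  by apply/matrixP => a b; rewrite !mxE.
rewrite rowsubE.
by apply: leq_trans (mxrankM_maxr _ _) _; rewrite mxrank_tr.
Qed.

End submatrix_rank.

(** * The displacement f - id and the conclusion *)

Section displacement.
Context {R : realType} {n : nat}.
Local Notation V := 'rV[R]_n.
Local Notation L := (lebesgue_space R n).
Local Notation mu := (@lebesgue_rV R n).
Variables (Omega : set V) (openO : open Omega).

(** On the closure of Omega the extension equals f_i - x_i, since this vanishes on the boundary;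
    outside Omega it is 0. At a boundary point nearby values are of one kind or the other, and both
    are close to 0. *)
Lemma displacement_continuous (f : V -> V) (i : 'I_n) :
  {within closure Omega, continuous f} ->
  (forall x, boundary Omega x -> f x = x) ->
  continuous ((fun x : V => f x 0 i - x 0 i) \_ Omega).
Proof.
move=> /subspace_continuousP cf fb; set u := _ \_ Omega.
pose phi (x : V) := f x 0 i - x 0 i.
have uO x : Omega x -> u x = phi x by move=> Ox; rewrite /u patchT// inE.
have u0 x : ~ Omega x -> u x = 0 by move=> nO; rewrite /u patchN// notin_setE.
have uC x : closure Omega x -> u x = phi x.
  move=> cx; have [/uO//|nO] := pselect (Omega x).
  rewrite u0// /phi fb ?subrr//; split=> //.
  by have := (interior_id Omega).1 openO => ->.
suff H x e : 0 < e -> \forall y \near nbhs x, `|u x - u y| < e.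
  by move=> x; apply: (iffRL (@cvgrPdist_lt _ _ V (nbhs x) _ u (u x))) => e; exact: H.
move=> e0.
have open_ball (A : set V) y : open A -> A y -> exists2 d : R, 0 < d & ball y d `<=` A.
  by move=> oA Ay; have /nbhs_ballP[d /= d0 dA] := open_nbhs_nbhs (conj oA Ay); exists d.
apply/nbhs_ballP.
have [cx|ncx] := pselect (closure Omega x); last first.
  have [||d d0 dC] := open_ball (~` closure Omega) x; [|by []|].
    exact/closed_openC/closed_closure.
  exists d => // y /dC ncy.
  by rewrite !u0 ?subrr ?normr0// => /subset_closure.
have cphi : phi y @[y --> within (closure Omega) (nbhs x)] --> phi x.
  apply: cvgB.
    exact: (cvg_comp f (fun M : V => M 0 i) (cf x cx) (@coord_continuous R 1 n 0 i (f x))).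
  apply: cvg_trans (@coord_continuous R 1 n 0 i x).
  by apply: cvg_app; exact: cvg_within.
have /nbhs_ballP[d /= d0 dphi] : nbhs x [set y | closure Omega y -> `|phi x - phi y| < e].
  by move/cvgrPdist_lt : cphi => /(_ _ e0); exact.
have [Ox|nOx] := pselect (Omega x).
  have [d' d'0 dO] := open_ball _ x openO Ox.
  exists (Num.min d d'); first by rewrite /= lt_min d0 d'0.
  move=> y xy.
  have Oy : Omega y by apply: dO; apply: le_ball xy; rewrite ge_min lexx orbT.
  rewrite !uO//; apply: dphi; last exact: subset_closure.
  by apply: le_ball xy; rewrite ge_min lexx.
exists d => // y xy; have [Oy|nOy] := pselect (Omega y).
  by rewrite uC// (uO y)//; apply: dphi => //; exact: subset_closure.
by rewrite !u0// subrr normr0.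
Qed.

Lemma loc_integrable_eq (f g : V -> R) : (forall x, Omega x -> f x = g x) ->
  loc_integrable Omega f -> loc_integrable Omega g.
Proof.
move=> fg If K cK KO; have mK : measurable (K : set L).
  by apply: closed_measurable_rV; exact: (compact_closed (@norm_hausdorff _ _) cK).
apply: (@eq_integrable _ L R mu K mK (EFin \o f)) (If K cK KO) => x; rewrite inE => Kx /=.
by rewrite fg//; exact: KO.
Qed.

Lemma weak_partial_eq (j : 'I_n) (f f' g g' : V -> R) :
  (forall x, Omega x -> f x = f' x) -> (forall x, Omega x -> g x = g' x) ->
  weak_partial Omega j f g -> weak_partial Omega j f' g'.
Proof.
move=> ff gg [If Ig fg]; split.
- exact: loc_integrable_eq If.
- exact: loc_integrable_eq Ig.
- move=> phi tphi.
  rewrite (eq_integral (fun x : L => (f x * partial j phi x)%:E)) => [|x]; last first.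
    by rewrite inE => Ox; rewrite ff.
  rewrite (fg phi tphi); congr (- _)%E.
  by apply: eq_integral => x; rewrite inE => Ox; rewrite gg.
Qed.

Lemma diffq_add_coord (h : R) (i j : 'I_n) (u : V -> R) (x : V) : h != 0 ->
  diffq h j (fun y : V => y 0 i + u y) x = (i == j)%:R + diffq h j u x.
Proof.
move=> h0; rewrite /diffq !mxE eqxx /=.
by rewrite (_ : _ - _ = h * (i == j)%:R + (u (x + h *: delta_mx 0 j) - u x));
  [rewrite mulrDr mulKf|ring].
Qed.

End displacement.

Lemma bounded_set_ball (R : realType) (n : nat) (A : set 'rV[R]_n) :
  bounded_set A -> exists2 r : R, 0 < r & A `<=` ball 0 r.
Proof.
move=> [M [_ HM]]; exists (`|M| + 2); first by rewrite ltr_wpDl.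
move=> x Ax; rewrite -ball_normE /= sub0r normrN.
apply: (@le_lt_trans _ _ (`|M| + 1)); last by rewrite ltrD2l ltr1n.
by apply: HM Ax; rewrite (le_lt_trans (ler_norm _))// ltrDl.
Qed.

Theorem theorem12 (R : realType) (n m : nat) (p : \bar R)
    (Omega : set 'rV[R]_n) (f : 'rV[R]_n -> 'rV[R]_n)
    (Df : 'rV[R]_n -> 'M[R]_n) :
  (2 <= m)%N -> (m <= n)%N ->
  Omega !=set0 -> open Omega -> bounded_set Omega ->
  homeo_onto_image (closure Omega) f ->
  W1p Omega p f Df ->
  (forall x, boundary Omega x -> f x = x) ->
  (p = m%:R%:E /\ hoelder_on (closure Omega) f) \/ (m%:R%:E < p)%E ->
  exists A : set (lebesgue_space R n),
    [/\ A `<=` Omega, measurable A, (0 < @lebesgue_rV R n A)%E &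
        forall x, A x -> (m <= \rank (Df x))%N].
Proof.
case: m => [//|m]; case: m => [//|m] _ le_mn [y Oy] openO bO [cf _] [_ Dp wp] fb hp.
(* Either alternative gives an exponent p at least m, which puts the entries of an m by m minor in
   L^m. *)
have {hp} mp : (m.+2%:R%:E <= p)%E by case: hp => [[-> _]//|/ltW].
pose L := lebesgue_space R n; pose mu := @lebesgue_rV R n.
pose V := 'rV[R]_n.
pose i_ : 'I_m.+2 -> 'I_n := widen_ord le_mn.
have ijE k j : (i_ k == i_ j) = (k == j) by [].
have [r r0 Or] := bounded_set_ball bO.
have mO : measurable (Omega : set L) by exact: open_measurable_rV.
have Ooo : (mu Omega < +oo)%E.
  apply: (@le_lt_trans _ _ (mu (ball 0 r))).
    apply: le_measure; rewrite ?inE; [exact: mO| |exact: Or].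
    by apply: open_measurable_rV; exact: ball_open.
  by rewrite /mu lebesgue_rV_ball// ltry.
have O0 : (0 < mu Omega)%E.
  have /nbhs_ballP[s /= s0 sO] := open_nbhs_nbhs (conj openO Oy).
  apply: (@lt_le_trans _ _ (mu (ball y s))).
    by rewrite /mu lebesgue_rV_ball// lte_fin exprn_gt0// mulr_gt0.
  apply: le_measure; rewrite ?inE; [|exact: mO|exact: sO].
  by apply: open_measurable_rV; exact: ball_open.
have T0 : (0 < mu [set: L])%E.
  apply: lt_le_trans O0 _; apply: le_measure; rewrite ?inE; [exact: mO|exact: measurableT|exact: subsetT].
pose u (k : 'I_m.+2) : V -> R := (fun x : V => f x 0 (i_ k) - x 0 (i_ k)) \_ Omega.
pose G (k j : 'I_m.+2) : V -> R := (fun x : V => Df x (i_ k) (i_ j)) \_ Omega.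
(* With this extension, delta + g is the upper left block of Df inside Omega and the identity matrix
   outside. *)
pose g (k j : 'I_m.+2) : V -> R := (fun x : V => Df x (i_ k) (i_ j) - (k == j)%:R) \_ Omega.
have patchO (h : V -> R) x : Omega x -> (h \_ Omega) x = h x by move=> Ox; rewrite patchT// inE.
have patch0 (h : V -> R) x : ~ Omega x -> (h \_ Omega) x = 0 by move=> nO; rewrite patchN// notin_setE.
have cu k : continuous (u k) by exact: displacement_continuous.
have HG k j : measurable_fun [set: L] (G k j : L -> R) /\ (abs_pow_int mu m.+2 setT (G k j) < +oo)%E.
  apply: (@Lfun_abs_pow_int _ L R mu p m.+2 Omega (G k j) (ltn0Sn _) mO Ooo T0 mp (Dp _ _)).
  exact: patch0.
have gE k j : g k j = (fun x => - (k == j)%:R * \1_Omega x + G k j x).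
  apply/funext => x; rewrite indicE.
  have [Ox|nOx] := pselect (Omega x).
    by rewrite /g /G !patchO// mem_set// mulr1 addrC.
  by rewrite /g /G !patch0// memNset// mulr0 addr0.
have mg k j : measurable_fun [set: L] (g k j : L -> R).
  rewrite gE; apply: (measurable_funD _ (HG k j).1).
  have mI := @measurable_indic _ L R setT Omega mO.
  exact: (measurable_funM (measurable_cst _) mI).
have goo k j : (abs_pow_int mu m.+2 setT (g k j) < +oo)%E.
  have g0 x : ~ Omega x -> g k j x = 0 by exact: patch0.
  rewrite (@abs_pow_int_support_rV _ _ m.+2 Omega _ (ltn0Sn _) g0).
  rewrite (@eq_abs_pow_int _ L R mu m.+2 Omega _ (fun x => - (k == j)%:R + G k j x)) => [|x Ox]; last first.
    by rewrite gE indicE mem_set// mulr1.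
  apply: (@abs_pow_int_cstD _ L R mu Omega mO Ooo).
    exact: (@measurable_funS _ _ L _ setT Omega _ measurableT (@subsetT _ _) (HG k j).1).
  apply: le_lt_trans (HG k j).2.
  exact: (@abs_pow_int_subset _ L R mu m.+2 Omega setT _ mO measurableT (HG k j).1 (@subsetT _ _)).
(* [W k] agrees with the k-th component of f on Omega, hence has the same weak derivatives there,
   and is continuous on the whole space as [diffq_cvg_ball] requires. *)
pose W (k : 'I_m.+2) (x : V) : R := x 0 (i_ k) + u k x.
have cW k : continuous (W k).
  move=> x; apply: (@continuousD _ _ _ _ _ x); [exact: coord_continuous|exact: cu].
have wpW k j : weak_partial Omega (i_ j) (W k) (G k j).
  apply: weak_partial_eq (wp (i_ k) (i_ j)) => x Ox; last by rewrite /G patchO.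
  by rewrite /W /u patchO// addrC subrK.
have G0 k j x : ~ ball 0 r x -> G k j x = 0.
  by move=> nB; apply: patch0; apply: contra_not nB; exact: Or.
have ug x0 s d : 0 < s -> 0 < d -> ball x0 (s + d) `<=` Omega -> forall k j,
    @mean_cvg _ L R mu m.+2 (ball x0 s) (fun h => diffq h (i_ j) (u k)) (g k j).
  move=> s0 d0 sO k j e e0.
  have [dt dt0 H] := diffq_cvg_ball s0 d0 sO (@cW k) (HG k j).1 r0 (@G0 k j) (HG k j).2 (wpW k j) e0.
  exists dt; first exact: dt0.
  move=> h h0 hd; apply: le_trans (H h h0 hd).
  rewrite le_eqVlt; apply/orP; left; apply/eqP.
  apply: (@eq_abs_pow_int _ L R mu m.+2) => x sx.
  have Ox : Omega x by apply: sO; apply: le_ball sx; rewrite lerDl ltW.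
  rewrite /W (diffq_add_coord _ _ _ _ (lt0r_neq0 h0)) ijE gE indicE mem_set// mulr1.
  by congr (`|_|); ring.
have det0 := @det_integral_sobolev R n m.+1 Omega 0 r i_ u g r0 openO Or cu
  (fun k x nO => patch0 _ x nO) mg (fun k j x nO => patch0 _ x nO) goo ug.
pose D (x : V) : R := \det (\matrix_(k, j) ((k == j)%:R + g k j x)).
have D1 x : ~ Omega x -> D x = 1.
  move=> nO; rewrite -[RHS](det1 R m.+2) /D; congr (\det _).
  by apply/matrixP => k j; rewrite !mxE /g patch0// addr0.
have DE x : Omega x -> D x = \det (mxsub i_ i_ (Df x)).
  move=> Ox; rewrite /D; congr (\det _).
  by apply/matrixP => k j; rewrite !mxE /g patchO// addrC subrK.
have mD : measurable_fun [set: L] (D : L -> R).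
  apply: measurable_sum => s; apply: (measurable_funM (measurable_cst _)).
  apply: measurable_prod => k _.
  rewrite (_ : (fun x : V => _) = (fun x : V => (k == s k)%:R + g k (s k) x)).
    exact: (measurable_funD (measurable_cst _) (mg k (s k))).
  by apply/funext => x; rewrite mxE.
pose A : set L := Omega `&` D @^-1` [set~ 0].
have mA : measurable A.
  apply: measurableI; first exact: mO.
  rewrite -[X in measurable X]setTI; apply: mD; first exact: measurableT.
  exact: measurableC.
exists A; split.
- by move=> x [].
- exact: mA.
(* If A were null, D - 1 would equal -1_Omega almost everywhere on Q, and [det0] would force Omega
   to have measure 0. *)
- rewrite lt0e measure_ge0 andbT; apply/eqP => A0.
  move: O0; rewrite lt0e => /andP[/eqP + _]; apply.
  pose Q : set L := ball 0 (r + 1).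
  have mQ : measurable Q by apply: open_measurable_rV; exact: ball_open.
  have OQ : Omega `<=` Q.
    by move=> x /Or; apply: le_ball; rewrite lerDl.
  have mDQ : measurable_fun Q (fun x : L => (D x - 1)%:E).
    apply/measurable_EFinP; apply: (measurable_funB _ (measurable_cst _)).
    exact: (@measurable_funS _ _ L _ setT Q _ measurableT (@subsetT _ _) mD).
  have mIQ : measurable_fun Q (fun x : L => (- \1_Omega x : R)%:E).
    apply/measurable_EFinP; apply: measurable_funN.
    exact: (@measurable_indic _ L R Q Omega mO).
  have : (\int[mu]_(x in Q) (- \1_Omega x : R)%:E = 0)%E.
    rewrite -[RHS]det0; apply/esym; apply: (@ae_eq_integral _ L R mu Q _ _ mQ mDQ mIQ).
    exists A; split; [exact: mA|exact: A0|].
    move=> x /= nx; apply: contrapT => nA; apply: nx => _; congr EFin.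
    rewrite indicE; have [Ox|nOx] := pselect (Omega x).
      rewrite mem_set// (_ : D x = 0) ?sub0r//.
      by apply: contrapT => Dx; apply: nA.
    by rewrite memNset// D1// subrr oppr0.
  have -> : (\int[mu]_(x in Q) (- \1_Omega x : R)%:E = - mu Omega)%E.
    have I1 := @integral_indic _ L R (@lebesgue_rV R n) Q mQ Omega mO.
    have OIQ : Omega `&` Q = Omega by apply/setIidPl.
    rewrite OIQ in I1.
    rewrite /mu -[X in (- X)%E]I1 -integral_ge0N; first by apply: eq_integral => x _.
    by move=> x _; rewrite lee_fin.
  by move/eqP; rewrite oppe_eq0 => /eqP.
- by move=> x [Ox Dx]; apply: (minor_rank (i_ := i_)); rewrite -DE//; exact/eqP.
Qed.
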